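(* Let $d,p,q\ge 1$ be integers, $A\in\mathcal{M}_d(\mathbb{C})$, $B\in\mathcal{M}_{d,p}(\mathbb{C})$, $C\in\mathcal{M}_{q,d}(\mathbb{C})$, $D\in\mathcal{M}_{q,p}(\mathbb{C})$, and let $\mathbb{F}$ be the associated input-output map and $\mathbf{H}$ the associated transfer function. The following assertions are equivalent to each other. 1. The operator $\mathbb{F}:L^2_{\mathrm{loc}}([0,\infty);\mathbb{C}^p)\to L^2_{\mathrm{loc}}([0,\infty);\mathbb{C}^q)$ has dense range. 2. For all $0<\tau<\infty$, the operator $\mathbb{F}:L^2(0,\tau;\mathbb{C}^p)\to L^2(0,\tau;\mathbb{C}^q)$ has dense range. 3. For some $0<\tau<\infty$, the operator $\mathbb{F}:L^2(0,\tau;\mathbb{C}^p)\to L^2(0,\tau;\mathbb{C}^q)$ has dense range. 4. The transfer function $\mathbf{H}$ is a surjective rational matrix. 5. There is $s\in\rho(A)$ (the resolvent set of $A$) such that $$\operatorname{rank}_{\mathbb{C}}\begin{pmatrix}A-s & B\\ C & D\end{pmatrix}=d+q.$$ 6. The matrix $$\mathfrak{T}:=\begin{pmatrix} D & CB & CAB & \cdots & CA^{d-1}B & \cdots & CA^{2d-1}B\\ 0 & D & CB & \cdots & CA^{d-2}B & \cdots & CA^{2d-2}B\\ \vdots & \vdots & \vdots & & \vdots & & \vdots\\ 0 & 0 & 0 & \cdots & D & \cdots & CA^{d-1}B\end{pmatrix}$$ is surjective. 7. There is $L\in\mathbb{N}$ such that for all $0<\tau<\infty$, $$H^L_{(0)}(0,\tau;\mathbb{C}^q)\subset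 \mathbb{F}L^2(0,\tau;\mathbb{C}^p).$$ 8. $d\ge q$ and, with $L=\min(d-q+\operatorname{rank}D+1,\,d)$, the inclusion $H^L_{(0)}(0,\tau;\mathbb{C}^q)\subset \mathbb{F}L^2(0,\tau;\mathbb{C}^p)$ holds for all $0<\tau<\infty$.
   Context: The system is $\dot x(t)=Ax(t)+Bu(t)$, $x(0)=0$, $y(t)=Cx(t)+Du(t)$. Its input-output map is $\mathbb{F}:u\mapsto y$, $$y(t)=\int_0^t Ce^{(t-\sigma)A}Bu(\sigma)\,d\sigma+Du(t),$$ considered as an operator $L^2(0,\tau;\mathbb{C}^p)\to L^2(0,\tau;\mathbb{C}^q)$ for $0<\tau<\infty$, or $L^2_{\mathrm{loc}}([0,\infty);\mathbb{C}^p)\to L^2_{\mathrm{loc}}([0,\infty);\mathbb{C}^q)$ (Fréchet topology of $L^2$ convergence on each $(0,T)$). Its transfer function is the rational matrix $\mathbf{H}(s)=C(s-A)^{-1}B+D\in\mathcal{M}_{q,p}(\mathbb{C}(s))$; it is called surjective when it is surjective as a $\mathbb{C}(s)$-linear map $\mathbb{C}(s)^p\to\mathbb{C}(s)^q$. The block matrix $\mathfrak{T}$ has $d+1$ block rows and $2d+1$ block columns; indexing these from $0$, its $(i,j)$ block is $0$ if $j<i$, $D$ if $j=i$, and $CA^{j-i-1}B$ if $j>i$. For $L\in\mathbb{N}$, $H^L_{(0)}(0,\tau;\mathbb{C}^n)=\{f\in H^L(0,\tau;\mathbb{C}^n): f(0)=\dots=f^{(L-1)}(0)=0\}$, where $H^L$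 is the Sobolev space of order $L$ based on $L^2$.
   Formalization: In assertion 8 the condition d ≥ q is replaced by d ≥ q − rank D (L unchanged), since as printed the equivalence fails for d=1, p=q=2, A=B=C=0, D=I₂, where 1–7 hold but d < q. *)

(* Defs.v *)
(* MathComp / MathComp-Analysis, with the complex numbers R[i] over a
   realType R from mathcomp-real-closed. *)
From HB Require Import structures.
From mathcomp Require Import all_boot all_order all_algebra.
From mathcomp Require Import fraction.
From mathcomp Require Import complex.
From mathcomp Require Import all_classical all_reals all_analysis.

Set Implicit Arguments.
Unset Strict Implicit.
Unset Printing Implicit Defensive.

Import Order.TTheory GRing.Theory Num.Theory.
Import numFieldNormedType.Exports.

Local Open Scope classical_set_scope.
Local Open Scope ring_scope.
Local Open Scope complex_scope.

Section SquareIntegrable.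
Context {R : realType}.
Local Notation mu := (@lebesgue_measure R).

(* Functions are total on R and only their values on the relevant interval
   matter; elements of L^2 are represented by functions, and equality in L^2
   is equality almost everywhere on the interval. *)

Definition sqnorm n (v : 'cV[R[i]]_n) : R :=
  \sum_(i < n) ((complex.Re (v i ord0)) ^+ 2 + (complex.Im (v i ord0)) ^+ 2).

Definition cmeasurable n (I : set R) (f : R -> 'cV[R[i]]_n) : Prop :=
  forall i, measurable_fun I (fun t => complex.Re (f t i ord0)) /\
            measurable_fun I (fun t => complex.Im (f t i ord0)).

Definition L2norm n (I : set R) (f : R -> 'cV[R[i]]_n) : \bar R :=
  ((\int[mu]_(t in I) (sqnorm (f t))%:E) `^ 2^-1)%E.

Definition L2 n (I : set R) (f : R -> 'cV[R[i]]_n) : Prop :=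
  cmeasurable I f /\ (L2norm I f < +oo)%E.

Definition L2loc n (f : R -> 'cV[R[i]]_n) : Prop :=
  forall T : R, 0 < T -> L2 `]0, T[ f.

Definition cvintegral n (I : set R) (f : R -> 'cV[R[i]]_n) : 'cV[R[i]]_n :=
  \col_i ((\int[mu]_(t in I) complex.Re (f t i ord0))%R +i*
          (\int[mu]_(t in I) complex.Im (f t i ord0))%R).

End SquareIntegrable.

Section Sobolev.
Context {R : realType}.

Definition test_function (tau : R) (phi : R -> R) : Prop :=
  (forall (k : nat) (x : R), derivable (derive1n k phi) x 1) /\
  exists a b : R, [/\ 0 < a, b < tau & forall x : R, x \notin `[a, b] -> phi x = 0].

Definition weak_derivative n (tau : R) (k : nat) (f g : R -> 'cV[R[i]]_n) :=
  forall phi, test_function tau phi ->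
    cvintegral `]0, tau[ (fun t => (derive1n k phi t)%:C *: f t) =
    (-1) ^+ k *: cvintegral `]0, tau[ (fun t => (phi t)%:C *: g t).

Definition HL n (L : nat) (tau : R) (f : R -> 'cV[R[i]]_n) : Prop :=
  L2 `]0, tau[ f /\
  forall k, (k <= L)%N ->
    exists2 g, L2 `]0, tau[ g & weak_derivative tau k f g.

Definition ccontinuous_on n (I : set R) (h : R -> 'cV[R[i]]_n) : Prop :=
  forall i, {within I, continuous (fun t => complex.Re (h t i ord0))} /\
            {within I, continuous (fun t => complex.Im (h t i ord0))}.

(* For k < L the derivative f^(k) has a unique representative h that is
   continuous on [0, tau]; f^(k)(0) is the value h 0. *)
Definition HL0 n (L : nat) (tau : R) (f : R -> 'cV[R[i]]_n) : Prop :=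
  HL L tau f /\
  forall k, (k < L)%N ->
    exists h, [/\ ccontinuous_on `[0, tau] h, weak_derivative tau k f h &
                  h 0 = 0].

End Sobolev.

Section LinearSystem.
Context {R : realType} {d p q : nat}.
Variables (A : 'M[R[i]]_d) (B : 'M[R[i]]_(d, p)).
Variables (C : 'M[R[i]]_(q, d)) (D : 'M[R[i]]_(q, p)).
Local Notation mu := (@lebesgue_measure R).

(* The matrix exponential e^(tA), as the entrywise limit of its series. *)
Definition expmx_partial (t : R) (n : nat) : 'M[R[i]]_d :=
  \sum_(0 <= k < n) (t ^+ k / k`!%:R)%:C *: A ^+ k.

Definition expmx (t : R) : 'M[R[i]]_d :=
  \matrix_(i, j)
    (limn (fun n => complex.Re (expmx_partial t n i j) : R) +i*
     limn (fun n => complex.Im (expmx_partial t n i j) : R)).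

Definition io_map (u : R -> 'cV[R[i]]_p) : R -> 'cV[R[i]]_q := fun t =>
  cvintegral `]0, t[ (fun s => C *m expmx (t - s) *m B *m u s) + D *m u t.

Definition io_dense_L2 (tau : R) : Prop :=
  forall f, L2 `]0, tau[ f -> forall eps : R, 0 < eps ->
  exists2 u, L2 `]0, tau[ u &
    (L2norm `]0%R, tau[ (fun t => (io_map u t - f t)%R) < eps%:E)%E.

(* The L^2(0, T) seminorms increase with T, so that the sets
   {g | L2norm (0, T) (g - f) < eps} form a neighborhood base of f. *)
Definition io_dense_L2loc : Prop :=
  forall f, L2loc f -> forall T eps : R, 0 < T -> 0 < eps ->
  exists2 u, L2loc u &
    (L2norm `]0%R, T[ (fun t => (io_map u t - f t)%R) < eps%:E)%E.

Definition HL0_in_range (L : nat) (tau : R) : Prop :=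
  forall f, HL0 L tau f ->
  exists2 u, L2 `]0, tau[ u &
    {ae mu, forall t, t \in `]0, tau[ -> io_map u t = f t}.

Definition ratmx m n (M : 'M[R[i]]_(m, n)) :
    'M[{fraction {poly R[i]}}]_(m, n) :=
  map_mx (fun c => FracField.tofrac c%:P) M.

Definition transfer : 'M[{fraction {poly R[i]}}]_(q, p) :=
  ratmx C *m invmx ((FracField.tofrac 'X)%:M - ratmx A) *m ratmx B + ratmx D.

Definition resolvent_set : set R[i] := [set s | s%:M - A \in unitmx].

Definition Toeplitz_block (i j : nat) : 'M[R[i]]_(q, p) :=
  if (j < i)%N then 0 else
  if j == i then D else C *m A ^+ (j - i).-1 *m B.

Definition Toeplitz :
    'M[R[i]]_(\sum_(i < d.+1) q, \sum_(j < (2 * d).+1) p) :=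
  \mxblock_(i < d.+1, j < (2 * d).+1) Toeplitz_block i j.

End LinearSystem.

Definition surjective_mx (K : fieldType) m n (M : 'M[K]_(m, n)) : Prop :=
  forall y : 'cV[K]_m, exists x : 'cV[K]_n, M *m x = y.

(* The integer min (d - q + r + 1, d), for q <= d + r.  When r is the rank of
   the feedthrough matrix of a system with a surjective transfer function,
   q <= d + r always holds, whereas q <= d may fail: if the feedthrough matrix
   is the identity and C = 0, then the input-output map is the identity for
   every d >= 1 and every q. *)
Definition sobolev_order (d q r : nat) : nat := minn (d + r - q).+1 d.

(* Main.v *)
(* Everything is reduced to the condition [dual_injective] on the transposed
   system: no nonzero finite input started from the state 0 has zero output and
   returns to the state 0.  Reading the input as the coefficients of a
   polynomial, this says that the left kernel of [H] is 0, and
   the Toeplitz matrix is long enough to detect such an input.  If the condition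
   fails, the polynomial gives a nonzero continuous function orthogonal to the
   range of the input-output map.  If it holds, an input with nonzero first value
   has a nonzero output at some time at most [L = sobolev_order d q (\rank D)];
   by duality the system has a right inverse up to [L] integrations, so that all
   [L]-fold primitives of square integrable functions, that is, all of [HL0], are
   outputs.  These primitives are dense. *)
Require Import Defs.
From mathcomp Require Import all_boot all_order all_algebra.
From mathcomp Require Import fraction ring lra zify.
From mathcomp Require Import complex.
From mathcomp Require Import all_classical all_reals all_analysis.
From mathcomp Require Import measurable_realfun.

Set Implicit Arguments.
Unset Strict Implicit.
Unset Printing Implicit Defensive.

Import Order.TTheory GRing.Theory Num.Theory.
Import numFieldNormedType.Exports.

Local Open Scope classical_set_scope.
Local Open Scope ring_scope.
Local Open Scope complex_scope.

(** * Duality and the transposed discrete-time system *)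

(** Asking the dual input to return to the state 0 keeps everything finite: the condition becomes
    polynomial, and the time domain never meets a Laplace transform. Its use rests on time
    invariance: a combination of delayed copies of one input is again an input, so a linear
    dependency among states reached at different times yields an input that returns to 0. Such
    dependencies explain the number of rows of [Toeplitz], the number of its columns (through
    Cayley-Hamilton, for the free motion after the last input) and the order [L]: if [w 0] is
    nonzero and the output vanishes up to time m, then the states at times 2 to m+1 and the image
    under C of the left kernel of D provide m + q - rank D independent vectors in a space of
    dimension d. Between discrete and continuous time, input number i is paired with (tau - t)^i /
    i!, because differentiation lowers i. In the other direction a formal right inverse in powers of
    1/s is cut after finitely many terms and the remainder is fed back through a linear differential
    equation, so that no series of operators has to converge. *)

Section LeftKernel.
Context {K : fieldType}.

Lemma surjective_mxP m n (M : 'M[K]_(m, n)) :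
  surjective_mx M <-> forall w : 'rV_m, w *m M = 0 -> w = 0.
Proof.
split=> [surjM w wM|injM].
  apply/rowP => j; have [x Mx] := surjM (delta_mx j 0).
  have := congr1 (mulmx w) Mx; rewrite mulmxA wM mul0mx -colE.
  by move=> /matrixP/(_ 0 0); rewrite !mxE => <-.
have /row_freeP[N MN] : row_free M.
  rewrite -kermx_eq0; apply/eqP/row_matrixP => i.
  by rewrite row0; apply: injM; rewrite -row_mul mulmx_ker row0.
by move=> y; exists (N *m y); rewrite mulmxA MN mul1mx.
Qed.

Lemma surjective_row_free m n (M : 'M[K]_(m, n)) :
  surjective_mx M <-> row_free M.
Proof.
split=> [/surjective_mxP injM|/row_freeP[N MN] y].
  rewrite -kermx_eq0; apply/eqP/row_matrixP => i.
  by rewrite row0; apply: injM; rewrite -row_mul mulmx_ker row0.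
by exists (N *m y); rewrite mulmxA MN mul1mx.
Qed.

(* Duality: a linear form vanishing on the left kernel of [T] factors
   through [T]. *)
Lemma factor_left_kernel m n k (T : 'M[K]_(m, n)) (P : 'M[K]_(m, k)) :
  (forall w : 'rV_m, w *m T = 0 -> w *m P = 0) -> exists X, T *m X = P.
Proof.
move=> TP.
suff /submxP[Y PY] : (P^T <= T^T)%MS.
  by exists Y^T; rewrite -[LHS]trmxK trmx_mul trmxK -PY trmxK.
rewrite submxE; apply/eqP/trmx_inj; rewrite trmx_mul trmxK trmx0.
apply/row_matrixP => i; rewrite row0 row_mul.
apply: TP; rewrite -row_mul.
have -> : (cokermx T^T)^T *m T = (T^T *m cokermx T^T)^T.
  by rewrite [RHS]trmx_mul trmxK.
by rewrite mulmx_coker trmx0 row0.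
Qed.

End LeftKernel.

(** * Clearing denominators in matrices of fractions *)

Section Denominators.
Context {P : idomainType}.

Lemma fracP (x : {fraction P}) :
  exists nd : P * P, nd.2 != 0 /\ x * FracField.tofrac nd.2 = FracField.tofrac nd.1.
Proof.
elim/quotW: x => x; exists (frac x); split; first exact: denom_ratioP.
unlock FracField.tofrac; rewrite -[LHS]FracField.pi_mul.
apply/eqP; rewrite FracField.equivf_def /FracField.mulf; apply/eqP.
by rewrite !numden_Ratio ?(oner_neq0, mulr1) ?mulf_neq0 ?denom_ratioP // mulrC.
Qed.

Lemma common_denominator m n (M : 'M[{fraction P}]_(m, n)) :
  exists (e : P) (N : 'M[P]_(m, n)),
    e != 0 /\ map_mx (@FracField.tofrac P) N = FracField.tofrac e *: M.
Proof.
pose nd i j := projT1 (cid (fracP (M i j))).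
have nd0 i j : (nd i j).2 != 0 by rewrite /nd; case: cid => ? [].
have ndE i j : M i j * FracField.tofrac (nd i j).2 = FracField.tofrac (nd i j).1.
  by rewrite /nd; case: cid => ? [].
exists (\prod_(ij : 'I_m * 'I_n) (nd ij.1 ij.2).2).
exists (\matrix_(i, j) ((nd i j).1 * \prod_(kl | kl != (i, j)) (nd kl.1 kl.2).2)).
split; first by apply/prodf_neq0 => -[i j] _; exact: nd0.
apply/matrixP => i j; rewrite !mxE rmorphM /= -ndE [in RHS](bigD1 (i, j)) //=.
by rewrite [in RHS]rmorphM /= [RHS]mulrC mulrA.
Qed.

End Denominators.

(** * Polynomial form of the condition on the transposed system *)

Section DualSystem.
Context {K : fieldType} {d p q : nat}.
Variables (A : 'M[K]_d) (B : 'M[K]_(d, p)) (C : 'M[K]_(q, d)) (D : 'M[K]_(q, p)).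
Local Notation "M ^P" := (map_mx polyC M) (at level 2, format "M ^P").
Local Notation S := (char_poly_mx A).

(* The transposed discrete-time system, started from the state 0. *)
Fixpoint dual_state (w : nat -> 'rV[K]_q) n : 'rV[K]_d :=
  if n is m.+1 then dual_state w m *m A + w m *m C else 0.

Definition dual_output w i : 'rV[K]_p := dual_state w i *m B + w i *m D.

Definition dual_injective := forall w n,
  (forall i, (i < n)%N -> dual_output w i = 0) -> dual_state w n = 0 ->
  forall i, (i < n)%N -> w i = 0.

(** Eliminating Z = W C (X - A)^-1 leaves W H = 0, so this concerns the polynomial left kernel of H.
    That Z is a polynomial corresponds to the state returning to 0. *)
Definition poly_injective := forall (W : 'rV[{poly K}]_q) (Z : 'rV[{poly K}]_d),
  Z *m S = W *m C^P -> Z *m B^P + W *m D^P = 0 -> W = 0.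

Let cf k n (V : 'rV[{poly K}]_n) : 'rV[K]_n := map_mx (coefp k) V.

Let cfM k m n (V : 'rV[{poly K}]_m) (M : 'M[K]_(m, n)) :
  cf k (V *m M^P) = cf k V *m M.
Proof.
apply/rowP => j; rewrite !mxE /= coef_sum; apply: eq_bigr => i _.
by rewrite !mxE coefMC.
Qed.

Let char_poly_mxE : S = 'X%:M - A^P. Proof. by []. Qed.

Let cfS k (Z : 'rV[{poly K}]_d) :
  cf k (Z *m S) = (if k is k'.+1 then cf k' Z else 0) - cf k Z *m A.
Proof.
rewrite char_poly_mxE mulmxBr /cf map_mxB; congr (_ - _); last exact: cfM.
rewrite mul_mx_scalar; apply/rowP => j; case: k => [|k]; rewrite !mxE /=.
  by rewrite mulrC coefMX.
by rewrite mulrC coefMX.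
Qed.

(** Coefficients are read from the highest degree down: multiplication by X then becomes one time
    step, Z (X - A) = W C becomes the state recursion, and its coefficient of degree 0 is the return
    to 0. *)
Lemma dual_injective_poly : dual_injective <-> poly_injective.
Proof.
split=> [inj W Z ZW ZWB|inj w n w0 wn].
  have [m [Wm Zm]] : exists m, (forall j, size (W ord0 j) <= m)%N /\
      (forall j, size (Z ord0 j) <= m)%N.
    exists (\max_j size (W ord0 j) + \max_j size (Z ord0 j))%N; split=> j.
      by apply: leq_trans (leq_addr _ _); exact: (@leq_bigmax _ (fun j => size (W ord0 j))).
    by apply: leq_trans (leq_addl _ _); exact: (@leq_bigmax _ (fun j => size (Z ord0 j))).
  pose w i := cf (m - i) W.
  have wZ i : (i <= m)%N -> dual_state w i = cf (m - i) Z.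
    elim: i => [_|i IH im].
      rewrite subn0; apply/rowP => j; rewrite !mxE /=.
      by rewrite nth_default.
    have mk : (m - i = (m - i.+1).+1)%N by lia.
    have := congr1 (@cf (m - i.+1).+1 d) ZW; rewrite cfM cfS => /eqP.
    by rewrite subr_eq /= IH ?(ltnW im) // /w mk addrC => /eqP ->.
  have wB i : (i < m.+1)%N -> dual_output w i = 0.
    move=> im; rewrite /dual_output wZ // -!cfM /cf -map_mxD ZWB.
    by apply/rowP => j; rewrite !mxE /= coef0.
  have wm : dual_state w m.+1 = 0.
    rewrite /= wZ // subnn /w subnn.
    have := congr1 (@cf 0%N d) ZW; rewrite cfM cfS sub0r => <-.
    by rewrite subrr.
  apply/rowP => j; rewrite mxE; apply/polyP => k; rewrite coef0.
  have [km|km] := ltnP k m; last by rewrite nth_default // (leq_trans _ km).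
  have := inj w m.+1 wB wm (m - k)%N; rewrite ltnS leq_subr => /(_ isT).
  by rewrite /w subKn ?(ltnW km) // => /rowP/(_ j); rewrite !mxE.
(* Horner's scheme, with the earliest input as leading coefficient. The defect of Z (X - A) = W C at
   stage k is exactly the state at time k. *)
pose pol n (v : nat -> 'rV[K]_n) := fix F i : 'rV[{poly K}]_n :=
  if i is i'.+1 then 'X *: F i' + (v i')^P else 0.
have ZW k : pol _ (dual_state w) k *m S = pol _ w k *m C^P - (dual_state w k)^P.
  elim: k => [|k IH]; first by rewrite /= !mul0mx map_mx0 subr0.
  rewrite /= !mulmxDl -!scalemxAl IH map_mxD !map_mxM /= char_poly_mxE mulmxBr.
  by rewrite mul_mx_scalar [in RHS]opprD [RHS]addrACA subrr addr0 scalerBr addrA subrK.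
have ZWB k : (k <= n)%N -> pol _ (dual_state w) k *m B^P + pol _ w k *m D^P = 0.
  elim: k => [|k IH] kn; first by rewrite /= !mul0mx addr0.
  rewrite /= !mulmxDl -!scalemxAl addrACA -scalerDr IH ?(ltnW kn) //.
  by rewrite scaler0 add0r -!map_mxM -map_mxD -/(dual_output w k) w0 // map_mx0.
have Wn : pol _ w n = 0.
  apply: inj (ZWB _ (leqnn _)); by rewrite ZW wn map_mx0 subr0.
move: Wn {wn w0 ZW ZWB}; elim: n => // n IH /= Wn.
have wn : w n = 0.
  apply/rowP => j; have /rowP/(_ j) := Wn; rewrite !mxE => /(congr1 (coefp 0)).
  by rewrite /= coefD mulrC coefMX coefC add0r coef0.
have Wn0 : pol _ w n = 0.
  apply/rowP => j; move/rowP/(_ j): Wn; rewrite wn map_mx0 addr0 !mxE.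
  by move/eqP; rewrite mulf_eq0 polyX_eq0 /= => /eqP.
by move=> i; rewrite ltnS leq_eqVlt => /orP[/eqP ->//|]; exact: IH.
Qed.

(** A right inverse [Y] at the single point s makes the determinant of [P' *m Y^P] equal to 1 at s,
    hence a nonzero polynomial; multiplying by the adjugate then forces the row of Z and W to be
    0. *)
Lemma rosenbrock_poly_injective s :
  row_free (block_mx (A - s%:M) B C D) -> poly_injective.
Proof.
move=> /row_freeP[Y PY] W Z ZW ZWB.
pose P' := block_mx (- S) B^P C^P D^P.
have evP : map_mx (horner_eval s) P' = block_mx (A - s%:M) B C D.
  have ev m n (M : 'M[K]_(m, n)) : map_mx (horner_eval s) M^P = M.
    by apply/matrixP => i j; rewrite !mxE /horner_eval hornerC.
  rewrite map_block_mx !ev map_mxN char_poly_mxE map_mxB ev opprB.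
  by rewrite map_scalar_mx /= /horner_eval hornerX.
have v0 : row_mx Z W *m (P' *m Y^P) = 0.
  rewrite mulmxA mul_row_block mulmxN ZW addNr ZWB.
  by rewrite row_mx0 mul0mx.
have det0 : \det (P' *m Y^P) != 0.
  apply/eqP => /(congr1 (horner_eval s)); rewrite -det_map_mx map_mxM evP.
  have -> : map_mx (horner_eval s) Y^P = Y.
    by apply/matrixP => i j; rewrite !mxE /horner_eval hornerC.
  by rewrite PY det1 rmorph0 => /eqP; rewrite oner_eq0.
have : row_mx Z W = 0.
  have := congr1 (mulmxr (\adj (P' *m Y^P))) v0.
  rewrite /= mul0mx -mulmxA mul_mx_adj mul_mx_scalar => /eqP.
  by rewrite scalemx_eq0 (negPf det0) => /eqP.
by rewrite -row_mx0 => /eq_row_mx[].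
Qed.

End DualSystem.

(** * The transfer function and the rank condition at a point *)

Section TransferFunction.
Context {R : realType} {d p q : nat}.
Variables (A : 'M[R[i]]_d) (B : 'M[R[i]]_(d, p)).
Variables (C : 'M[R[i]]_(q, d)) (D : 'M[R[i]]_(q, p)).
Local Notation K := (R[i]).
Local Notation "M ^P" := (map_mx polyC M) (at level 2, format "M ^P").
Local Notation S := (char_poly_mx A).
Local Notation F := (map_mx (@FracField.tofrac {poly K})).

Let F_inj m n : injective (@map_mx _ _ (@FracField.tofrac {poly K}) m n).
Proof.
move=> M N /matrixP MN; apply/matrixP => i j; have := MN i j; rewrite !mxE.
by move/eqP; rewrite tofrac_eq => /eqP.
Qed.

Let ratmxE m n (M : 'M[K]_(m, n)) : ratmx M = F M^P.
Proof. by apply/matrixP => i j; rewrite !mxE. Qed.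

Let resE : (FracField.tofrac 'X)%:M - ratmx A = F S.
Proof. by rewrite ratmxE map_mxB map_scalar_mx. Qed.

Let S_unit : F S \in unitmx.
Proof.
rewrite unitmxE det_map_mx unitfE -/(char_poly A) tofrac_eq0.
exact/monic_neq0/char_poly_monic.
Qed.

Definition numerator : 'M[{poly K}]_(q, p) :=
  C^P *m \adj S *m B^P + char_poly A *: D^P.

Let numeratorE :
  F numerator = FracField.tofrac (char_poly A) *: transfer A B C D.
Proof.
rewrite /transfer resE !ratmxE /numerator map_mxD map_mxZ scalerDr; congr (_ + _).
rewrite !map_mxM map_mx_adj /= scalemxAl scalemxAr /invmx S_unit.
rewrite det_map_mx -/(char_poly A) scalerA mulfV; first by rewrite scale1r.
by rewrite tofrac_eq0 monic_neq0 // char_poly_monic.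
Qed.

Let char_poly_neq0 : char_poly A != 0.
Proof. exact/monic_neq0/char_poly_monic. Qed.

Lemma transfer_surjective_poly :
  surjective_mx (transfer A B C D) <-> poly_injective A B C D.
Proof.
rewrite surjective_mxP; split=> [inj W Z ZW ZWB|inj w wH].
  apply: F_inj; rewrite map_mx0; apply: inj.
  have : F W *m F C^P = F Z *m F S by rewrite -!map_mxM ZW.
  rewrite /transfer resE !ratmxE mulmxDr !mulmxA => ->.
  by rewrite mulmxK // -!map_mxM -map_mxD ZWB map_mx0.
have [e [N [e0 NE]]] := common_denominator w.
(* The extra factor [char_poly A] makes the state a polynomial: for W = chi N, the choice Z = N C
   adj(X - A) solves Z (X - A) = W C. *)
have W0 : char_poly A *: N = 0.
  apply: (inj _ (N *m C^P *m \adj S)).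
    by rewrite -[LHS]mulmxA [X in _ *m X]mul_adj_mx mul_mx_scalar -scalemxAl.
  have -> : N *m C^P *m \adj S *m B^P + char_poly A *: N *m D^P = N *m numerator.
    by rewrite /numerator mulmxDr !mulmxA -scalemxAl scalemxAr.
  apply: F_inj; rewrite map_mxM numeratorE NE -scalemxAr -scalemxAl wH.
  by rewrite !scaler0 map_mx0.
move/eqP: W0; rewrite scalemx_eq0 (negPf char_poly_neq0) /= => /eqP N0.
move/eqP: NE; rewrite N0 map_mx0 eq_sym scaler_eq0 tofrac_eq0 (negPf e0) /=.
by move/eqP.
Qed.

Lemma transfer_surjective_rosenbrock : surjective_mx (transfer A B C D) ->
  exists s : K, resolvent_set A s /\
    \rank (block_mx (A - s%:M) B C D) = (d + q)%N.
Proof.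
move=> /surjective_row_free/row_freeP[M HM].
have [e [N [e0 NE]]] := common_denominator M.
have numN : numerator *m N = (char_poly A * e)%:M.
  apply: F_inj; rewrite map_mxM numeratorE NE -scalemxAr -scalemxAl HM.
  by rewrite map_scalar_mx rmorphM /= scalerA scalemx1 mulrC.
(* At such an s the characteristic polynomial is nonzero, which puts s in the resolvent set, and the
   cleared right inverse [N] still has an invertible product with [numerator]. *)
have [s se] : exists s : K, (char_poly A * e).[s] != 0.
  have [//|noroot] := pselect (exists s : K, (char_poly A * e).[s] != 0).
  suff : char_poly A * e = 0.
    by move/eqP; rewrite mulf_eq0 (negPf char_poly_neq0) (negPf e0).
  apply: (@roots_geq_poly_eq0 _ _ [seq i%:R | i <- iota 0 (size (char_poly A * e))]).
  - apply/allP => s _; apply/negP => sr; apply: noroot; exists s.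
    by apply/negP.
  - rewrite map_inj_uniq ?iota_uniq // => i j /eqP.
    by rewrite eqr_nat => /eqP.
  - by rewrite size_map size_iota.
have ev m n (V : 'M[K]_(m, n)) : map_mx (horner_eval s) V^P = V.
  by apply/matrixP => i j; rewrite !mxE /horner_eval hornerC.
have evS : map_mx (horner_eval s) S = s%:M - A.
  by rewrite map_mxB ev map_scalar_mx /= /horner_eval hornerX.
have cE : (char_poly A).[s] = \det (s%:M - A).
  by rewrite -evS det_map_mx.
have c0 : \det (s%:M - A) != 0.
  by move: se; rewrite hornerM mulf_eq0 negb_or cE => /andP[].
exists s; split; first by rewrite /resolvent_set /= unitmxE unitfE.
apply/eqP; rewrite -/(row_free _) -kermx_eq0; apply/eqP/row_matrixP => i.
rewrite row0; set v := row i _.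
have : v *m block_mx (A - s%:M) B C D = 0 by rewrite /v -row_mul mulmx_ker row0.
rewrite -(hsubmxK v) mul_row_block -row_mx0 => /eq_row_mx[].
set z := lsubmx v; set w := rsubmx v => /eqP.
rewrite addrC addr_eq0 -mulmxN opprB => /eqP wC zwB.
(* Substituting w C = z (s - A) turns w times [numerator] at s into chi(s) (z B + w D), which is
   0. *)
have w0 : w = 0.
  have : w *m map_mx (horner_eval s) numerator = 0.
    rewrite map_mxD !map_mxM !ev map_mx_adj evS map_mxZ ev mulmxDr !mulmxA wC.
    rewrite -(mulmxA z) mul_mx_adj mul_mx_scalar -scalemxAl -scalemxAr.
    by rewrite /= /horner_eval cE -scalerDr zwB scaler0.
  move/(congr1 (mulmxr (map_mx (horner_eval s) N))).
  rewrite /= -mulmxA -map_mxM numN map_scalar_mx mul0mx mul_mx_scalar => /eqP.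
  by rewrite scaler_eq0 /= /horner_eval (negPf se) => /eqP.
have z0 : z = 0.
  have Su : s%:M - A \in unitmx by rewrite unitmxE unitfE.
  by rewrite -[z](mulmxK Su) -wC w0 !mul0mx.
by rewrite z0 w0 row_mx0.
Qed.

End TransferFunction.

(** * Convolution of scalar and vector sequences *)

Section Convolution.
Context {K : fieldType}.

(** The coefficients of a product of power series; as an input, a combination of delayed copies of
    [w]. *)
Definition conv (V : lmodType K) (c : nat -> K) (w : nat -> V) n : V :=
  \sum_(j < n.+1) c j *: w (n - j)%N.

Lemma conv_widen (V : lmodType K) (c : nat -> K) (w : nat -> V) m n :
  (m <= n.+1)%N -> (forall j, (m <= j)%N -> c j = 0) ->
  conv c w n = \sum_(j < m) c j *: w (n - j)%N.
Proof.
move=> mn c0; rewrite (big_ord_widen _ (fun j => c j *: w (n - j)%N) mn).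
rewrite /conv [RHS]big_mkcond /=; apply: eq_bigr => j _.
by case: ltnP => // /c0 ->; rewrite scale0r.
Qed.

Lemma conv_inj (V : lmodType K) c (w : nat -> V) n : c 0%N != 0 ->
  (forall i, (i < n)%N -> conv c w i = 0) -> forall i, (i < n)%N -> w i = 0.
Proof.
move=> c0 cw; elim/ltn_ind => i IH ni.
have := cw i ni; rewrite /conv big_ord_recl subn0 big1 ?addr0 => [/eqP|j _].
  by rewrite scaler_eq0 (negPf c0) => /eqP.
rewrite IH ?scaler0 // /lift /= /bump /=; first by case: j => /=; lia.
by apply: leq_ltn_trans ni; exact: leq_subr.
Qed.

(** Here the nonzero lowest coefficient is [w 0], so the delayed copies of [w] are independent and
    the [c i] are eliminated one after the other. *)
Lemma conv_injl (V : lmodType K) c (w : nat -> V) n : w 0%N != 0 ->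
  (forall i, (i < n)%N -> conv c w i = 0) -> forall i, (i < n)%N -> c i = 0.
Proof.
move=> w0 cw; elim/ltn_ind => i IH ni.
have := cw i ni; rewrite /conv big_ord_recr /= subnn big1 ?add0r => [/eqP|j _ /=].
  by rewrite scaler_eq0 (negPf w0) orbF => /eqP.
by rewrite IH ?scale0r // (ltn_trans (ltn_ord j)).
Qed.

Definition seq_of_row m (v : 'rV[K]_m) (j : nat) : K :=
  if insub j is Some i then v 0 i else 0.

Lemma seq_of_row_ord m (v : 'rV[K]_m) (i : 'I_m) : seq_of_row v i = v 0 i.
Proof. by rewrite /seq_of_row valK. Qed.

Lemma seq_of_row_ge m (v : 'rV[K]_m) j : (m <= j)%N -> seq_of_row v j = 0.
Proof. by move=> mj; rewrite /seq_of_row insubF // ltnNge mj. Qed.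

End Convolution.

(** * Dimension counts and the block Toeplitz matrix *)

Section DualBounds.
Context {K : fieldType} {d p q : nat}.
Variables (A : 'M[K]_d) (B : 'M[K]_(d, p)) (C : 'M[K]_(q, d)) (D : 'M[K]_(q, p)).
Local Notation state := (dual_state A C).
Local Notation output := (dual_output A B C D).
Implicit Types w : nat -> 'rV[K]_q.

Lemma eq_dual_state w w' n :
  (forall i, (i < n)%N -> w i = w' i) -> state w n = state w' n.
Proof.
elim: n => //= n IH ww'; rewrite ww' // IH // => i ni.
by rewrite ww' // ltnW.
Qed.

Lemma eq_dual_output w w' n :
  (forall i, (i <= n)%N -> w i = w' i) -> output w n = output w' n.
Proof.
move=> ww'; rewrite /dual_output ww' // (@eq_dual_state w w') // => i /ltnW.
exact: ww'.
Qed.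

Lemma dual_stateD w w' n :
  state (fun i => w i + w' i) n = state w n + state w' n.
Proof. by elim: n => [|n IH] /=; rewrite ?addr0 // IH !mulmxDl addrACA. Qed.

Lemma dual_outputD w w' n :
  output (fun i => w i + w' i) n = output w n + output w' n.
Proof. by rewrite /dual_output dual_stateD !mulmxDl addrACA. Qed.

(** Linearity together with time invariance: from the initial state 0, delaying the input delays the
    state. *)
Lemma dual_state_conv c w n : state (conv c w) n = conv c (state w) n.
Proof.
elim: n => [|n IH]; first by rewrite /conv big_ord1 scaler0.
rewrite /= IH /conv !mulmx_suml -big_split /= [RHS]big_ord_recr /= subnn scaler0 addr0.
apply: eq_bigr => j _; rewrite -!scalemxAl -scalerDr subSn //.
by rewrite -ltnS.
Qed.

Lemma dual_output_conv c w n : output (conv c w) n = conv c (output w) n.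
Proof.
rewrite /dual_output dual_state_conv /conv !mulmx_suml -big_split /=.
by apply: eq_bigr => j _; rewrite -!scalemxAl -scalerDr.
Qed.

Lemma dual_state_shift w n : w 0%N = 0 ->
  state w n.+1 = state (fun i => w i.+1) n.
Proof.
move=> w0; elim: n => [|n IH]; first by rewrite /= w0 !mul0mx addr0.
by rewrite [LHS]/= -/(state w n.+1) IH.
Qed.

Lemma dual_output_shift w n : w 0%N = 0 ->
  output w n.+1 = output (fun i => w i.+1) n.
Proof. by move=> w0; rewrite /dual_output dual_state_shift. Qed.

Definition pulse (m : nat) (k : 'rV[K]_q) (i : nat) := if i == m then k else 0.

Lemma dual_state_pulse m k n : (n <= m)%N -> state (pulse m k) n = 0.
Proof.
elim: n => //= n IH nm; rewrite IH ?(ltnW nm) // /pulse (ltn_eqF nm).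
by rewrite !mul0mx addr0.
Qed.

(** A dimension count: m states reached under [w] and the q - rank D rows of [N *m C] are
    independent in a space of dimension d. A dependency would give delayed copies of [w], plus a
    last input in the left kernel of D, with zero output and return to 0. *)
Lemma dual_length_bound w m : dual_injective A B C D ->
  (forall i, (i <= m)%N -> output w i = 0) -> w 0%N != 0 ->
  (m + (q - \rank D) <= d)%N.
Proof.
move=> inj w_out w0; rewrite -mxrank_ker.
pose N := row_base (kermx D).
have ND : N *m D = 0 by apply/eqP; rewrite -sub_kermx eq_row_base.
(* The delays stop at j < m: the next state, at time 1, is [w 0 *m C], which already lies in the row
   space of [N *m C] because the zero output at time 0 puts [w 0] in the left kernel of D. *)
pose M := col_mx (\matrix_(j < m) state w (m.+1 - j)) (N *m C).
suff /eqP <- : row_free M by exact: rank_leq_col.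
rewrite -kermx_eq0; apply/eqP/row_matrixP => r; rewrite row0.
set v := row r _.
have : v *m M = 0 by rewrite /v -row_mul mulmx_ker row0.
rewrite -(hsubmxK v) mul_row_col; set c := lsubmx v; set e := rsubmx v => vM.
pose w' i := conv (seq_of_row c) w i + pulse m (e *m N) i.
have w'0 i : (i < m.+1)%N -> w' i = 0.
  apply: inj.
    move=> j jm; rewrite dual_outputD dual_output_conv.
    have -> : conv (seq_of_row c) (output w) j = 0.
      rewrite /conv big1 // => k _; rewrite w_out ?scaler0 //.
      by rewrite (leq_trans (leq_subr _ _)).
    rewrite add0r /dual_output dual_state_pulse // mul0mx add0r /pulse.
    by case: eqP; rewrite ?mul0mx // -mulmxA ND mulmx0.
  rewrite dual_stateD dual_state_conv.
  have -> : conv (seq_of_row c) (state w) m.+1 =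
      \sum_(j < m) seq_of_row c j *: state w (m.+1 - j).
    by apply: conv_widen; [lia|exact: seq_of_row_ge].
  rewrite [state (pulse _ _) _]/= dual_state_pulse // mul0mx add0r /pulse eqxx.
  rewrite -[RHS]vM mulmxA; congr (_ + _); rewrite mulmx_sum_row; apply: eq_bigr => j _.
  by rewrite rowK seq_of_row_ord.
(* Before time m the pulse is silent, so the convolution alone vanishes there; at time m only the
   pulse is left. *)
have c0 : c = 0.
  apply/rowP => j; rewrite [RHS]mxE -seq_of_row_ord.
  apply: (@conv_injl _ _ _ w m w0) => // i im.
  by have := w'0 i (ltnW im); rewrite /w' /pulse (ltn_eqF im) addr0.
have := w'0 m (leqnn _); rewrite /w' /pulse eqxx c0.
have -> : conv (seq_of_row (0 : 'rV[K]_m)) w m = 0.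
  rewrite /conv big1 // => j _; rewrite /seq_of_row.
  by case: insub => [i|]; rewrite ?mxE scale0r.
rewrite add0r => eN; have /row_freeP[N' NN'] := row_base_free (kermx D).
by rewrite -[e]mulmx1 -NN' mulmxA eN mul0mx row_mx0.
Qed.

Lemma dual_injective_rank : dual_injective A B C D -> (q <= d + \rank D)%N.
Proof.
move=> inj; have [qr|] := leqP q (\rank D); first lia.
rewrite -subn_gt0 -mxrank_ker lt0n mxrank_eq0 => /rowV0Pn[k].
rewrite sub_kermx => /eqP kD k0.
suff : (0 + (q - \rank D) <= d)%N by lia.
apply: (@dual_length_bound (pulse 0 k)) => // -[|//] _.
by rewrite /dual_output /= mul0mx add0r.
Qed.

(** The origin of [sobolev_order]: for rank D < q it equals d + rank D - q + 1, one more than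
    [dual_length_bound] allows when [w 0] is nonzero. For rank D = q the output at time 0 decides,
    and the minimum lowers d + 1 to d. *)
Lemma dual_order_bound w : dual_injective A B C D ->
  (forall i, (i <= sobolev_order d q (\rank D))%N -> output w i = 0) ->
  w 0%N = 0.
Proof.
move=> inj w_out; apply/eqP; apply: contraT => w0.
have := dual_length_bound inj w_out w0; have := dual_injective_rank inj.
have := rank_leq_row D; rewrite leq_eqVlt => /orP[/eqP Dq|].
  have /row_freeP[N DN] : row_free D by apply/eqP.
  have := w_out 0%N (leq0n _); rewrite /dual_output /= mul0mx add0r => wD.
  by move: w0; rewrite -[w 0%N]mulmx1 -DN mulmxA wD mul0mx eqxx.
rewrite /sobolev_order; lia.
Qed.

(** The blocks of [Toeplitz_block] over an arbitrary field, so that [markov_mx d.+1 (2 * d).+1]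
    converts to [Toeplitz] over R[i]. The free sizes of [markov_mx] also cover the square matrix
    that yields the right inverse. *)
Definition markov_block (i j : nat) : 'M[K]_(q, p) :=
  if (j < i)%N then 0 else
  if j == i then D else C *m A ^+ (j - i).-1 *m B.

Lemma dual_stateE w n :
  state w n = \sum_(i < n) w i *m C *m A ^+ (n - i).-1.
Proof.
elim: n => [|n IH]; first by rewrite big_ord0.
rewrite /= IH big_ord_recr /= subSnn expr0 mulmx1 mulmx_suml; congr (_ + _).
apply: eq_bigr => i _; rewrite -mulmxA; congr (_ *m _).
have -> : (n.+1 - i).-1 = (n - i).-1.+1 by case: i => /=; lia.
by rewrite exprSr.
Qed.

Lemma sum_markov_block w n j : (j < n)%N ->
  \sum_(i < n) w i *m markov_block i j = output w j.
Proof.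
move=> jn; rewrite /dual_output dual_stateE mulmx_suml.
rewrite -(big_mkord xpredT (fun i => w i *m markov_block i j)).
rewrite (@big_cat_nat _ _ _ j.+1) //= big_nat_recr //= [X in _ + X]big_nat_cond.
rewrite [X in _ + X]big1 ?addr0; last first.
  by move=> i /andP[/andP[ji _] _]; rewrite /markov_block ji mulmx0.
rewrite big_mkord {2}/markov_block ltnn eqxx; congr (_ + _).
apply: eq_bigr => i _; rewrite /markov_block ltnNge (ltnW (ltn_ord i)) /=.
by rewrite gtn_eqF // !mulmxA.
Qed.

(** From time n on the input is over, and the block columns observe the free motion of the state
    reached. *)
Lemma sum_markov_block_ge w n j : (n <= j)%N ->
  \sum_(i < n) w i *m markov_block i j = state w n *m A ^+ (j - n) *m B.
Proof.
move=> nj; rewrite dual_stateE !mulmx_suml; apply: eq_bigr => i _.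
have ij : (i < j)%N by rewrite (leq_trans (ltn_ord i)).
rewrite /markov_block ltnNge (ltnW ij) /= gtn_eqF // -!mulmxA; congr (_ *m (_ *m _)).
rewrite !mulmxA; congr (_ *m _).
have -> : (j - i).-1 = ((n - i).-1 + (j - n))%N by case: i ij => /=; lia.
by rewrite exprD.
Qed.

Definition markov_mx m n : 'M[K]_(\sum_(i < m) q, \sum_(j < n) p) :=
  \mxblock_(i < m, j < n) markov_block i j.

Lemma mul_markov_mx m n w :
  (\mxrow_(i < m) w i) *m markov_mx m n =
  \mxrow_(j < n) \sum_(i < m) w i *m markov_block i j.
Proof. by rewrite mul_mxrow_mxblock. Qed.

Definition block_seq m (u : 'rV[K]_(\sum_(i < m) q)) (i : nat) : 'rV[K]_q :=
  if insub i is Some j then submxrow u j else 0.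

Lemma block_seqE m (u : 'rV[K]_(\sum_(i < m) q)) :
  u = \mxrow_(i < m) block_seq u i.
Proof.
rewrite [LHS](esym (submxrowK u)); apply: eq_mxrow => i.
by rewrite /block_seq valK.
Qed.

(** Induction on the length of the input. Up to length d + 1 the input fits into a row vector for
    the Toeplitz matrix; a longer one is shortened by a dependency among its states. *)
Lemma markov_mx_surjective_injective : surjective_mx (markov_mx d.+1 (2 * d).+1) ->
  dual_injective A B C D.
Proof.
move=> /surjective_mxP injT w n; elim: n w => // n IH w w_out wn i ni.
have [nd|dn] := leqP n d.
  (* Padding by 0 is harmless: once the state has returned to 0, it stays there and the outputs stay
     0. *)
  pose w' i := if (i < n.+1)%N then w i else 0.
  have w'n k : (n < k)%N -> state w' k = 0.
    elim: k => // k IHk; rewrite ltnS leq_eqVlt => /orP[/eqP <-|nk].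
      by rewrite -[RHS]wn; apply: eq_dual_state => j; rewrite /w' => ->.
    by rewrite /= IHk // /w' ltnNge nk /= !mul0mx addr0.
  have := injT (\mxrow_(i < d.+1) w' i); rewrite mul_markov_mx => u0.
  have /eq_mxrowP/(_ (inord i)) : \mxrow_(i < d.+1) w' i = \mxrow_(i < d.+1) 0.
    rewrite mxrow0; apply: u0; rewrite -[RHS]mxrow0; apply: eq_mxrow => j.
    have [jd|dj] := ltnP j d.+1; last first.
      by rewrite sum_markov_block_ge // w'n // !mul0mx.
    rewrite sum_markov_block //; have [jn|nj] := ltnP j n.+1.
      rewrite -[RHS](w_out j) //; apply: eq_dual_output => k kj.
      by rewrite /w' (leq_ltn_trans kj).
    by rewrite /dual_output w'n // /w' ltnNge nj /= !mul0mx addr0.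
  by rewrite inordK ?(leq_trans ni) // /w' ni.
have w0 : w 0%N = 0.
  apply/eqP; apply: contraT => w0.
  (* These d + 1 states live in dimension d. A dependency [c] makes the filtered input return to 0
     already at time n, where the induction hypothesis applies; a nonzero [w 0] would then force [c]
     to be 0. *)
  pose M : 'M[K]_(d.+1, d) := \matrix_(j < d.+1) state w (n - j).
  have : kermx M != 0.
    rewrite kermx_eq0 /row_free; apply/negP => /eqP Md.
    by have := rank_leq_col M; rewrite Md ltnn.
  move=> /rowV0Pn[c]; rewrite sub_kermx => /eqP cM /negP[]; apply/eqP/rowP => j.
  rewrite mxE -seq_of_row_ord; apply: (@conv_injl _ _ _ w n w0); last first.
    exact: leq_trans (ltn_ord j) dn.
  apply: IH => [k kn|].
    rewrite dual_output_conv /conv big1 // => l _.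
    by rewrite w_out ?scaler0 // (leq_ltn_trans (leq_subr _ _)) // ltnW.
  have -> : state (conv (seq_of_row c) w) n =
      \sum_(j < d.+1) seq_of_row c j *: state w (n - j).
    rewrite dual_state_conv; apply: conv_widen; last exact: seq_of_row_ge.
    by rewrite ltnS ltnW.
  rewrite -[RHS]cM mulmx_sum_row; apply: eq_bigr => l _.
  by rewrite rowK seq_of_row_ord.
case: i ni => // i ni; apply: (IH (fun i => w i.+1)) => [k kn||].
- by rewrite -dual_output_shift // w_out.
- by rewrite -dual_state_shift.
- by rewrite -ltnS.
Qed.

(** A row in the left kernel is an input of length d + 1 with zero output up to time 2d. Its output
    then vanishes for ever, but its state need not return to 0; filtering it by the characteristic
    polynomial of A makes it return. *)
Lemma injective_markov_mx_surjective : dual_injective A B C D ->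
  surjective_mx (markov_mx d.+1 (2 * d).+1).
Proof.
move=> inj; apply/surjective_mxP => u; rewrite (block_seqE u).
set w := block_seq u; rewrite mul_markov_mx -[X in _ = X]mxrow0 => /eq_mxrowP uT.
have w_ge i : (d < i)%N -> w i = 0.
  by move=> di; rewrite /w /block_seq insubF // ltnNge di.
have w_out i : (i < d.+1)%N -> output w i = 0.
  move=> id; have i2 : (i < (2 * d).+1)%N by lia.
  by have := uT (Ordinal i2); rewrite sum_markov_block.
pose chi := char_poly A.
have sizechi : size chi = d.+1 by exact: size_char_poly.
have chid : chi`_d = 1.
  by have /monicP := char_poly_monic A; rewrite lead_coefE sizechi.
(* [Cayley_Hamilton] is about matrices of successor size; for d = 0 both sides are empty
   matrices. *)
have CH : \sum_(a < d.+1) chi`_a *: A ^+ a = 0.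
  case: (d) A @chi sizechi {chid} => [|d'] A' chi sizechi; first exact: flatmx0.
  have := Cayley_Hamilton A'; rewrite -/chi /horner_mx /horner_morph horner_coef.
  rewrite size_map_poly_id0 ?sizechi => [CH|].
    rewrite -[RHS]CH; apply: eq_bigr => a _; rewrite coef_map_id0 ?scalar_mx_is_scalar //=.
      by rewrite -mul_scalar_mx.
    exact: raddf0.
  by have /monicP -> := char_poly_monic A'; rewrite /= oner_neq0.
have w_st k : state w (d.+1 + k) = state w d.+1 *m A ^+ k.
  elim: k => [|k IH]; first by rewrite addn0 expr0 mulmx1.
  rewrite addnS.
  have -> : state w (d.+1 + k).+1 = state w (d.+1 + k) *m A + w (d.+1 + k)%N *m C by [].
  rewrite IH w_ge ?ltn_addr //.
  by rewrite mul0mx addr0 exprSr -mulmxA.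
(* Block columns d + 1 to 2d give the cases k < d, and Cayley-Hamilton propagates them to all k. *)
have w_B k : state w d.+1 *m A ^+ k *m B = 0.
  elim/ltn_ind: k => k IH; have [kd|dk] := ltnP k d.
    have i2 : (d.+1 + k < (2 * d).+1)%N by lia.
    have := uT (Ordinal i2); rewrite sum_markov_block_ge ?leq_addr //=.
    by rewrite addKn.
  have -> : A ^+ k = - \sum_(a < d) chi`_a *: A ^+ (k - d + a).
    apply/eqP; rewrite -addr_eq0.
    have -> : A ^+ k = chi`_d *: A ^+ (k - d + d) by rewrite chid scale1r subnK.
    rewrite addrC -(big_ord_recr _ (fun a => chi`_a *: A ^+ (k - d + a))) /=.
    under eq_bigr do rewrite exprD -[_ * _]/(_ *m _) scalemxAr.
    by rewrite -mulmx_sumr CH mulmx0.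
  rewrite mulmxN mulNmx mulmx_sumr mulmx_suml big1 ?oppr0 // => a _.
  rewrite -scalemxAr -scalemxAl IH ?scaler0 //.
  by case: a => /=; lia.
have w_out' i : output w i = 0.
  have [|di] := ltnP i d.+1; first exact: w_out.
  rewrite /dual_output -(subnKC di) w_st w_B w_ge ?mul0mx ?addr0 //.
  by rewrite subnKC.
(* The characteristic polynomial in reverse order: at time 2d + 1 the delayed states add up to
   [state w d.+1] times chi(A), and the leading coefficient 1 comes first, as [conv_inj]
   requires. *)
pose c a := if (a <= d)%N then chi`_(d - a) else 0.
have w0 i : (i < (2 * d).+1)%N -> w i = 0.
  apply: (@conv_inj _ _ c); first by rewrite /c /= subn0 chid oner_neq0.
  apply: inj => [j _|].
    by rewrite dual_output_conv /conv big1 // => l _; rewrite w_out' scaler0.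
  have -> : state (conv c w) (2 * d).+1 =
      \sum_(j < d.+1) c j *: state w ((2 * d).+1 - j).
    rewrite dual_state_conv; apply: conv_widen; first lia.
    by move=> j dj; rewrite /c leqNgt dj.
  rewrite (reindex_inj rev_ord_inj) /=.
  transitivity (state w d.+1 *m \sum_(a < d.+1) chi`_a *: A ^+ a); last first.
    by rewrite CH mulmx0.
  rewrite mulmx_sumr; apply: eq_bigr => j _; have jd : (j <= d)%N by rewrite -ltnS.
  rewrite /c subSS leq_subr subKn // -scalemxAr -w_st; congr (_ *: state _ _).
  lia.
rewrite -[RHS]mxrow0; apply: eq_mxrow => i; apply: w0.
by case: i => /= i; lia.
Qed.

(** The original system in discrete time with matrix inputs; the [X k] are the coefficients of a
    formal right inverse in powers of 1/s. *)
Fixpoint direct_state (X : nat -> 'M[K]_(p, q)) n : 'M[K]_(d, q) :=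
  if n is m.+1 then A *m direct_state X m + B *m X m else 0.

Lemma direct_stateE X n :
  direct_state X n = \sum_(i < n) A ^+ (n - i).-1 *m B *m X i.
Proof.
elim: n => [|n IH]; first by rewrite big_ord0.
rewrite /= IH big_ord_recr /= subSnn expr0 mul1mx mulmx_sumr; congr (_ + _).
apply: eq_bigr => i _; rewrite !mulmxA; congr (_ *m _ *m _).
have -> : (n.+1 - i).-1 = (n - i).-1.+1 by case: i => /=; lia.
by rewrite exprS.
Qed.

(** By [factor_left_kernel] it is enough that every row killed by a square block Toeplitz matrix has
    first block 0, and this is the hypothesis. The result inverts the system on the right up to a
    delay of L steps. *)
Lemma right_inverse_coefficients L :
  (forall w, (forall i, (i <= L)%N -> output w i = 0) -> w 0%N = 0) ->
  exists X, forall k, (k <= L)%N ->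
    C *m direct_state X k + D *m X k = if k == L then 1%:M else 0.
Proof.
move=> w0.
pose P : 'M[K]_(\sum_(i < L.+1) q, q) :=
  \mxcol_(i < L.+1) (if i == 0%N :> nat then 1%:M else 0 : 'M[K]_q).
have [Y TY] : exists Y, markov_mx L.+1 L.+1 *m Y = P.
  apply: factor_left_kernel => u; rewrite (block_seqE u); set w := block_seq u.
  rewrite mul_markov_mx -[X in _ = X]mxrow0 => /eq_mxrowP uT.
  have w00 : w 0%N = 0.
    apply: w0 => i iL; rewrite -(@sum_markov_block _ L.+1) //.
    exact: (uT (Ordinal (iL : (i < L.+1)%N))).
  rewrite mul_mxrow_mxcol big_ord_recl /= w00 mul0mx add0r big1 // => i _.
  by rewrite mulmx0.
(* The Toeplitz matrix is upper triangular, so its blocks run backwards in time: block row 0, where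
   the identity stands, becomes time L. *)
pose X k := if insub (L - k)%N is Some j then submxcol Y (j : 'I_L.+1) else 0.
exists X => k kL.
have Lk : (L - k < L.+1)%N by rewrite ltnS leq_subr.
move: TY; rewrite /P -[Y in _ *m Y = _](submxcolK Y) mul_mxblock_mxrow => /eq_mxcolP/(_ (Ordinal Lk)) /=.
have -> : ((L - k)%N == 0%N) = (k == L) by apply/eqP/eqP; lia.
move=> <-; rewrite (reindex_inj rev_ord_inj) /=.
have XE (j : 'I_L.+1) : submxcol Y (rev_ord j) = X j.
  rewrite /X; have jL : (L - j < L.+1)%N by rewrite ltnS leq_subr.
  rewrite insubT /=; congr submxcol; apply: val_inj => /=.
  by rewrite subSS.
under eq_bigr do rewrite XE subSS.
rewrite -(big_mkord xpredT (fun i => markov_block (L - k) (L - i) *m X i)).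
rewrite (@big_cat_nat _ _ _ k.+1) //= big_nat_recr //= [X in _ = _ + X]big_nat_cond.
rewrite [X in _ = _ + X]big1 ?addr0; last first.
  move=> i /andP[/andP[ki iL] _].
  by rewrite /markov_block (_ : (L - i < L - k)%N) ?mul0mx //; lia.
rewrite {2}/markov_block ltnn eqxx big_mkord direct_stateE mulmx_sumr; congr (_ + _).
apply: eq_bigr => i _; rewrite /markov_block ifF; last by case: i => /= *; lia.
rewrite ifF; last by case: i => /= *; apply/eqP; lia.
rewrite !mulmxA; congr (_ *m _ ^+ _ *m _ *m _).
by case: i => /= *; lia.
Qed.

End DualBounds.

(** * Primitives and integration by parts *)

Section Primitive.
Context {R : realType}.
Local Notation mu := (@lebesgue_measure R).
Implicit Types (f g phi : R -> R) (a b t T : R).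

Definition primitive f t : R := \int[mu]_(s in `]0, t[) f s.

Definition c1 phi phi' := (forall t : R, is_derive t (1 : R) phi (phi' t)) /\
  continuous (phi' : R -> R).

Lemma is_derive_continuous phi phi' :
  (forall t : R, is_derive t (1 : R) phi (phi' t)) -> continuous (phi : R -> R).
Proof.
move=> dphi t; apply: differentiable_continuous; apply/derivable1_diffP.
exact: (@ex_derive _ _ _ _ _ _ _ (dphi t)).
Qed.

Lemma continuous_integrable f a b : {within `[a, b], continuous f} ->
  mu.-integrable `[a, b] (EFin \o f).
Proof. by move=> cf; apply: continuous_compact_integrable => //; exact: segment_compact. Qed.

Lemma integrable_oo f a b : mu.-integrable `[a, b] (EFin \o f) ->
  mu.-integrable `]a, b[ (EFin \o f).
Proof. by apply: integrableS => //; exact: subset_itv_oo_cc. Qed.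

Lemma integrable_cc f a b : mu.-integrable `]a, b[ (EFin \o f) ->
  mu.-integrable `[a, b] (EFin \o f).
Proof.
move=> /integrableP[mf fi]; apply/integrableP; split.
  apply/emeasurable_fun_itv_bndo_bndcP; apply/emeasurable_fun_itv_obnd_cbndP.
  exact: mf.
by rewrite (@integral_itv_bndoo _ _ _ _ true false) //; apply: measurableT_comp.
Qed.

Lemma Rintegral_oo_cc f a b : mu.-integrable `]a, b[ (EFin \o f) ->
  \int[mu]_(s in `]a, b[) f s = \int[mu]_(s in `[a, b]) f s.
Proof.
move=> fi; rewrite -(@Rintegral_itv_obnd_cbnd _ a (BRight b)); last first.
  by apply: integrableS (integrable_cc fi) => //; exact: subset_itv_oc_cc.
rewrite -(@Rintegral_itv_bndo_bndc _ (BRight a) b) //.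
Qed.

Lemma Rintegral_derive phi phi' a b : c1 phi phi' -> a <= b ->
  \int[mu]_(s in `]a, b[) phi' s = phi b - phi a.
Proof.
move=> [dphi cphi']; rewrite le_eqVlt => /predU1P[->|ab].
  by rewrite set_itvoo0 Rintegral_set0 subrr.
have cw : {within `[a, b], continuous phi'} by exact: continuous_subspaceT.
rewrite Rintegral_oo_cc; last exact/integrable_oo/continuous_integrable.
rewrite /Rintegral (@continuous_FTC2 _ _ phi) //.
- split=> [x _||]; first exact: (@ex_derive _ _ _ _ _ _ _ (dphi x)).
    by apply: cvg_at_right_filter; exact: is_derive_continuous dphi _.
  by apply: cvg_at_left_filter; exact: is_derive_continuous dphi _.
- by move=> x _; rewrite derive1E (@derive_val _ _ _ _ _ _ _ (dphi x)).
Qed.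

Lemma continuous_bounded phi a b : {within `[a, b], continuous phi} ->
  exists M : R, 0 <= M /\ forall t, t \in `[a, b] -> `|phi t| <= M.
Proof.
move=> cphi.
have /compact_bounded[M [_ phiM]] := continuous_compact cphi (@segment_compact _ a b).
exists (`|M| + 1); split; first by rewrite addr_ge0.
move=> t tab; apply: (phiM (`|M| + 1)).
  by rewrite ltr_pwDr // ler_norm.
by exists t.
Qed.

Lemma integrable_mul_bounded phi f (D : set R) (M : R) : measurable D ->
  measurable_fun D phi -> (forall t, D t -> `|phi t| <= M) ->
  mu.-integrable D (EFin \o f) ->
  mu.-integrable D (EFin \o (fun t => phi t * f t)).
Proof.
move=> mD mphi phiM fi.
have := @integrableMr _ _ _ mu D mD phi _ mphi _ fi.
apply; exists M; split; first by rewrite num_real.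
by move=> x Mx t /phiM /le_trans; apply; exact: ltW.
Qed.

Lemma measurable_continuous_oo phi a b : {within `[a, b], continuous phi} ->
  measurable_fun `]a, b[ phi.
Proof.
move=> cphi; apply: (@measurable_funS _ _ _ _ `[a, b]) => //.
  exact: subset_itv_oo_cc.
exact: subspace_continuous_measurable_fun.
Qed.

Lemma primitive_norm g t T : mu.-integrable `]0, T[ (EFin \o g) -> t <= T ->
  `|primitive g t| <= \int[mu]_(s in `]0, T[) `|g s|.
Proof.
move=> gi tT.
have sub : `]0, t[ `<=` `]0, T[ by apply: subset_itvl; rewrite bnd_simp.
have git : mu.-integrable `]0, t[ (EFin \o g) by exact: integrableS gi.
apply: le_trans (le_normr_Rintegral _ _) _ => //.
rewrite /Rintegral fine_le //.
- by apply: integrable_fin_num => //; exact: integrable_norm.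
- by apply: integrable_fin_num => //; exact: integrable_norm.
apply: ge0_subset_integral => //.
do 2 apply: measurableT_comp => //.
by case/integrableP: gi => /measurable_EFinP.
Qed.

Lemma integrable_mul_continuous phi f a b : {within `[a, b], continuous phi} ->
  mu.-integrable `]a, b[ (EFin \o f) ->
  mu.-integrable `]a, b[ (EFin \o (fun t => phi t * f t)).
Proof.
move=> cphi fi; have [M [_ phiM]] := continuous_bounded cphi.
apply: (@integrable_mul_bounded _ _ _ M) => //; first exact: measurable_continuous_oo.
by move=> t tab; apply: phiM; exact: subset_itv_oo_cc.
Qed.

Lemma primitive_continuous g T : 0 <= T -> mu.-integrable `]0, T[ (EFin \o g) ->
  {within `[0, T], continuous (primitive g)}.
Proof.
move=> T0 /integrable_cc gi.
have := parameterized_integral_continuous T0 gi.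
apply: subspace_eq_continuous => t; rewrite inE /= in_itv /= => /andP[t0 tT].
rewrite /from_subspace /parameterized_integral /primitive Rintegral_oo_cc //.
apply: integrable_oo; apply: integrableS gi => //.
exact: subset_itvl.
Qed.

Lemma integrable_scale (D : set R) k f : measurable D ->
  mu.-integrable D (EFin \o f) -> mu.-integrable D (EFin \o (fun t => k * f t)).
Proof. by move=> mD fi; exact: (@integrableZl _ _ _ mu D mD k _ fi). Qed.

Lemma EFin_Rintegral (D : set R) f : measurable D -> mu.-integrable D (EFin \o f) ->
  (\int[mu]_(x in D) f x)%:E = (\int[mu]_(x in D) (f x)%:E)%E.
Proof. by move=> mD fi; rewrite /Rintegral fineK //; exact: integrable_fin_num. Qed.

Lemma integrable_patch (D : set R) f : measurable D -> mu.-integrable D (EFin \o f) ->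
  mu.-integrable setT (EFin \o (f \_ D)).
Proof.
move=> mD fi; rewrite -restrict_EFin; apply/integrable_restrict => //.
by rewrite setTI.
Qed.

(** Both sides are iterated integrals over the triangle 0 < s < t < T. *)
Lemma fubini_triangle (phi' g : R -> R) T : 0 <= T -> continuous (phi' : R -> R) ->
  mu.-integrable `]0, T[ (EFin \o g) ->
  \int[mu]_(t in `]0, T[) (phi' t * primitive g t) =
  \int[mu]_(s in `]0, T[) (g s * \int[mu]_(t in `]s, T[) phi' t).
Proof.
move=> T0 cphi gi.
pose I := [set` `]0, T[] : set R.
have mI0 : measurable I by exact: measurable_itv.
pose g0 : R -> R := g \_ I.
(* The integrand extended by 0 to the plane; it is dominated by M |g(s)| on the square, which gives
   the integrability needed for Fubini. *)
pose f (z : R * R) := phi' z.2 * \1_I z.2 * g0 z.1 * (if z.1 < z.2 then 1 else 0).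
have mphi : measurable_fun setT phi' by exact: continuous_measurable_fun.
have mg : measurable_fun setT g0.
  apply/(measurable_restrictT g mI0).
  by case/integrableP: gi => /measurable_EFinP.
have mI : measurable_fun setT (\1_I : R -> R) by exact: measurable_indic.
have mf : measurable_fun setT f.
  apply: measurable_funM; last first.
    by apply: measurable_fun_ifT => //; exact: measurable_fun_ltr.
  apply: measurable_funM; first apply: measurable_funM.
  - exact: (measurableT_comp mphi).
  - exact: (measurableT_comp mI).
  - exact: (measurableT_comp mg).
have [M [M0 phiM]] : exists M : R, 0 <= M /\ forall t, t \in `[0, T] -> `|phi' t| <= M.
  by apply: continuous_bounded; exact: continuous_subspaceT.
have f_le x y : `|f (x, y)| <= M * `|g0 x|.
  rewrite /f /= !normrM indicE.
  have [yI|yI] := boolP (y \in I); last by rewrite normr0 mulr0 !mul0r mulr_ge0.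
  rewrite normr1 mulr1 -[leRHS]mulr1 ler_pM ?mulr_ge0 //.
    rewrite ler_wpM2r // phiM //.
    by move: yI; rewrite inE; exact: subset_itv_oo_cc.
  by case: ifP; rewrite ?normr1 ?normr0.
have f_out x y : y \notin I -> f (x, y) = 0.
  by move=> yI; rewrite /f /= indicE (negPf yI) mulr0 !mul0r.
have imf : (mu \x mu)%E.-integrable setT (EFin \o f).
  apply/integrable12ltyP; first exact/measurable_EFinP.
  have g0i : mu.-integrable setT (EFin \o g0) by exact: integrable_patch.
  have : (\int[mu]_x ((M * T)%:E * `|g0 x|%:E) < +oo)%E.
    rewrite ge0_integralZl//; last by rewrite lee_fin mulr_ge0.
      by case/integrableP: g0i => _ g0oo; rewrite lte_mul_pinfty // lee_fin mulr_ge0.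
    by apply/measurable_EFinP; exact: measurableT_comp.
  apply: le_lt_trans; apply: ge0_le_integral => //.
  - by move=> x _; exact: integral_ge0.
  - have mabs : measurable_fun setT (abse \o (EFin \o f)).
      by apply/measurable_EFinP; exact: measurableT_comp.
    have := measurable_fun_fubini_tonelli_F (m2 := mu) _ mabs (fun=> abse_ge0 _).
    exact.
  - apply/measurable_EFinP; apply: measurable_funM => //; exact: measurableT_comp.
  - move=> x _.
    have -> : (\int[mu]_y `|(EFin \o f) (x, y)| = \int[mu]_(y in I) `|(f (x, y))%:E|)%E.
      rewrite [RHS]integral_mkcond; apply: eq_integral => y _.
      by rewrite patchE; case: ifPn => //= yI; rewrite f_out // normr0.
    have -> : ((M * T)%:E * `|g0 x|%:E = (M * `|g0 x|)%:E * mu I)%E.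
      rewrite lebesgue_measure_itv /= lte_fin; case: ltgtP T0 => // [T0 _|<- _].
        by rewrite ?EFinN ?oppr0 ?oppe0 ?addr0 ?adde0 ?sube0 -!EFinM mulrAC.
      by rewrite mulr0 mul0e mule0.
    apply: integral_le_bound => //.
    - have := measurableT_comp mf (measurable_pair1 x).
      by move=> /measurable_EFinP h; exact: measurable_funS h.
    - by rewrite lee_fin mulr_ge0.
    - by apply: aeW => y _; rewrite lee_fin.
have Fub := Fubini imf.
have gt t : mu.-integrable `]0, t[ (EFin \o g0).
  have : mu.-integrable setT (EFin \o g0) by exact: integrable_patch.
  exact: integrableS.
have phis s : mu.-integrable `]s, T[ (EFin \o phi').
  apply/integrable_oo/continuous_integrable; exact: continuous_subspaceT.
rewrite [LHS]Rintegral_mkcond [RHS]Rintegral_mkcond /Rintegral.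
have inner1 t : (((fun t => phi' t * primitive g t) \_ I) t)%:E =
    (\int[mu]_s (EFin \o f) (s, t))%E.
  rewrite patchE; case: ifPn => [tI|tI]; last first.
    by rewrite integral0_eq // => s _ /=; rewrite f_out.
  have -> : primitive g t = \int[mu]_(s in `]0, t[) g0 s.
    apply: eq_Rintegral => s; rewrite inE /= => st.
    rewrite /g0 patchE mem_set //; move: tI; rewrite inE /I /= !in_itv /=.
    move: st; rewrite in_itv /= => /andP[-> st] /andP[_ tT].
    by rewrite (lt_trans st tT).
  rewrite -RintegralZl //.
  rewrite Rintegral_mkcond EFin_Rintegral //; last first.
    apply: integrable_patch => //.
    exact: integrable_scale.
  apply: eq_integral => s _ /=; congr EFin; rewrite patchE /f /= indicE tI mulr1.
  case: ifPn => st.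
    by move: st; rewrite inE /= in_itv /= => /andP[_ ->]; rewrite mulr1.
  case: ifPn => st'; rewrite ?mulr0 // mulr1.
  rewrite /g0 patchE ifN ?mulr0 //; apply: contra st; rewrite !inE /I /= !in_itv /=.
  by move=> /andP[-> _].
have inner2 s : (((fun s => g s * \int[mu]_(t in `]s, T[) phi' t) \_ I) s)%:E =
    (\int[mu]_t (EFin \o f) (s, t))%E.
  rewrite patchE; case: ifPn => [sI|sI]; last first.
    rewrite integral0_eq // => t _ /=.
    by rewrite /f /= /g0 patchE (negPf sI) mulr0 mul0r.
  rewrite -RintegralZl //.
  rewrite Rintegral_mkcond EFin_Rintegral //; last first.
    apply: integrable_patch => //.
    exact: integrable_scale.
  apply: eq_integral => t _ /=; congr EFin; rewrite patchE /f /= indicE /g0 patchE sI.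
  case: ifPn => st.
    move: st; rewrite inE /= in_itv /= => /andP[st tT].
    have -> : t \in I.
      move: sI; rewrite !inE /I /= !in_itv /= => /andP[s0 _].
      by rewrite tT (lt_trans s0 st).
    by rewrite st !mulr1 mulrC.
  have [tI|] := boolP (t \in I); last by rewrite mulr0 !mul0r.
  case: ifPn => st'; rewrite ?mulr0 // mulr1.
  case/negP: st; rewrite inE /= in_itv /= st'.
  by move: tI; rewrite inE /I /= in_itv /= => /andP[_ ->].
congr fine; under eq_integral do rewrite inner1.
under [RHS]eq_integral do rewrite inner2.
by rewrite Fub.
Qed.

(** As [g] is merely integrable, its primitive need not be differentiable everywhere; exchanging the
    order of integration replaces the product rule. *)
Lemma integral_by_parts phi phi' g T : 0 <= T -> c1 phi phi' ->
  mu.-integrable `]0, T[ (EFin \o g) ->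
  \int[mu]_(t in `]0, T[) (phi' t * primitive g t) =
  phi T * primitive g T - \int[mu]_(t in `]0, T[) (phi t * g t).
Proof.
move=> T0 phi1 gi; have [dphi cphi'] := phi1.
have cphi := is_derive_continuous dphi.
rewrite fubini_triangle // /primitive -RintegralZl // -RintegralB //.
- apply: eq_Rintegral => s; rewrite inE /= in_itv /= => /andP[s0 sT].
  by rewrite (Rintegral_derive phi1) ?ltW // mulrBr mulrC [g s * _]mulrC.
- exact: integrable_scale.
- by apply: integrable_mul_continuous gi; exact: continuous_subspaceT.
Qed.

End Primitive.

Section SquareIntegrableReal.
Context {R : realType}.
Local Notation mu := (@lebesgue_measure R).
Implicit Types (f g h phi : R -> R) (a b t T : R).

Definition sq_integrable T f := measurable_fun `]0, T[ f /\
  mu.-integrable `]0, T[ (EFin \o (fun t => f t ^+ 2)).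

Lemma integrable_cst T k : mu.-integrable `]0, T[ (EFin \o (fun=> k)).
Proof. by apply/integrable_oo/continuous_integrable; apply: continuous_subspaceT => x; exact: cvg_cst. Qed.

Lemma integrable_add (D : set R) f g : measurable D ->
  mu.-integrable D (EFin \o f) -> mu.-integrable D (EFin \o g) ->
  mu.-integrable D (EFin \o (fun t => f t + g t)).
Proof. by move=> mD fi gi; exact: (@integrableD _ _ _ mu D mD _ _ fi gi). Qed.

Lemma integrable_le (D : set R) f g : measurable D -> measurable_fun D f ->
  (forall t, D t -> `|f t| <= g t) -> mu.-integrable D (EFin \o g) ->
  mu.-integrable D (EFin \o f).
Proof.
move=> mD mf fg gi; apply: (@le_integrable _ _ _ mu D mD _ _ _ _ gi).
  exact/measurable_EFinP.
by move=> t Dt /=; rewrite lee_fin (le_trans (fg t Dt)) // ler_norm.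
Qed.

Lemma sq_integrable_integrable T f : sq_integrable T f ->
  mu.-integrable `]0, T[ (EFin \o f).
Proof.
move=> [mf fi]; apply: integrable_le (integrable_add _ (integrable_cst T 1) fi) => //.
move=> t _; have := sqr_ge0 (`|f t| - 1); rewrite sqrrB real_normK ?num_real //.
have := normr_ge0 (f t); nra.
Qed.

Lemma sq_integrableD T f g : sq_integrable T f -> sq_integrable T g ->
  sq_integrable T (fun t => f t + g t).
Proof.
move=> [mf fi] [mg gi]; split; first exact: measurable_funD.
have mfg : measurable_fun `]0, T[ (fun t => (f t + g t) ^+ 2).
  by apply: measurable_funX; exact: measurable_funD.
apply: integrable_le (integrable_add _ (integrable_scale 2 _ fi)
  (integrable_scale 2 _ gi)) => // t _.
by rewrite ger0_norm ?sqr_ge0 //; have := sqr_ge0 (f t - g t); nra.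
Qed.

Lemma sq_integrableZ T k f : sq_integrable T f -> sq_integrable T (fun t => k * f t).
Proof.
move=> [mf fi]; split; first exact: measurable_funM.
rewrite (_ : (fun t => (k * f t) ^+ 2) = (fun t => k ^+ 2 * f t ^+ 2)).
  exact: integrable_scale.
by apply/funext => t; rewrite exprMn.
Qed.

Lemma sq_integrable0 T : sq_integrable T (fun=> 0).
Proof. by split=> //; rewrite expr0n; exact: integrable_cst. Qed.

Lemma continuous_sq_integrable T f : {within `[0, T], continuous f} ->
  sq_integrable T f.
Proof.
move=> cf; split; first exact: measurable_continuous_oo.
apply: integrable_mul_continuous => //.
exact/integrable_oo/continuous_integrable.
Qed.

Lemma primitive_sq_integrable T g : 0 <= T -> mu.-integrable `]0, T[ (EFin \o g) ->
  sq_integrable T (primitive g).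
Proof. by move=> T0 gi; apply: continuous_sq_integrable; exact: primitive_continuous. Qed.

Lemma primitive_at0 g : primitive g 0 = 0.
Proof. by rewrite /primitive set_itvoo0 Rintegral_set0. Qed.

Lemma eq_primitive g h T t : t <= T -> (forall s, 0 < s < T -> g s = h s) ->
  primitive g t = primitive h t.
Proof.
move=> tT gh; apply: eq_Rintegral => s; rewrite inE /= in_itv /= => /andP[s0 st].
by apply: gh; rewrite s0 (lt_le_trans st tT).
Qed.

Lemma integrable_sub T t g : t <= T -> mu.-integrable `]0, T[ (EFin \o g) ->
  mu.-integrable `]0, t[ (EFin \o g).
Proof. by move=> tT; apply: integrableS => //; apply: subset_itvl; rewrite bnd_simp. Qed.

Lemma primitiveD g h T t : t <= T -> mu.-integrable `]0, T[ (EFin \o g) ->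
  mu.-integrable `]0, T[ (EFin \o h) ->
  primitive (fun s => g s + h s) t = primitive g t + primitive h t.
Proof.
by move=> tT gi hi; rewrite /primitive RintegralD //; exact: integrable_sub tT _.
Qed.

Lemma primitiveZ k g T t : t <= T -> mu.-integrable `]0, T[ (EFin \o g) ->
  primitive (fun s => k * g s) t = k * primitive g t.
Proof. by move=> tT gi; rewrite /primitive RintegralZl //; exact: integrable_sub tT _. Qed.

(** Lebesgue differentiation: at almost every point [g] is the derivative of its primitive, here
    locally constant. *)
Lemma primitive_eq0_ae g T : mu.-integrable `]0, T[ (EFin \o g) ->
  (forall t, 0 < t < T -> primitive g t = 0) ->
  {ae mu, forall t, t \in `]0, T[ -> g t = 0}.
Proof.
move=> gi g0.
pose G := g \_ `]0, T[.
have Gi : mu.-integrable setT (EFin \o G) by exact: integrable_patch.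
have GI y : mu.-integrable [set` Interval (BRight 0) (BRight y)] (EFin \o G).
  exact: integrableS Gi.
have locG : locally_integrable setT G by exact: integrable_locally_restrict.
have := FTC1 GI locG; apply: filterS; first exact: (ae_filter_ringOfSetsType mu).
move=> x + xT; move: (xT); rewrite in_itv /= => /andP[x0 xltT].
have x0' : (BRight 0 < BRight x)%O by rewrite bnd_simp.
move=> /(_ x0')[_]; rewrite derive1E.
have GF : {near x, (fun y => \int[mu]_(t in [set` Interval (BRight 0) (BRight y)]) G t) =1 cst 0}.
  near=> y; have yT : 0 < y < T.
    have : y \in `]0, T[ by near: y; exact: near_in_itvoo.
    by rewrite in_itv.
  rewrite -Rintegral_itv_bndo_bndc; last exact: integrableS Gi.
  rewrite /= -[RHS](g0 y yT); apply: eq_Rintegral => s; rewrite inE /= in_itv /=.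
  move=> /andP[s0 sy]; rewrite /G patchE mem_set //= in_itv /= s0 /=.
  by case/andP: yT => _; exact: lt_trans.
rewrite (near_eq_derive _ GF) derive_cst /G patchE mem_set //.
Unshelve. all: by end_near. Qed.

Lemma ae_eq_primitive g h T t : t <= T -> mu.-integrable `]0, T[ (EFin \o g) ->
  mu.-integrable `]0, T[ (EFin \o h) ->
  {ae mu, forall t, t \in `]0, T[ -> g t = h t} -> primitive g t = primitive h t.
Proof.
move=> tT gi hi gh; rewrite /primitive /Rintegral; congr fine.
apply: ae_eq_integral => //.
- by have /integrableP[] := integrable_sub tT gi.
- by have /integrableP[] := integrable_sub tT hi.
move: gh; apply: filterS; first exact: (ae_filter_ringOfSetsType mu).
move=> s gh st /=; rewrite gh //.
by move: st; rewrite /= !in_itv /= => /andP[-> st]; rewrite (lt_le_trans st).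
Qed.

(** At inner points both functions are the derivative of one common primitive; the end points follow
    by one-sided limits. *)
Lemma continuous_ae_eq f h T : 0 < T -> {within `[0, T], continuous f} ->
  {within `[0, T], continuous h} ->
  {ae mu, forall t, t \in `]0, T[ -> f t = h t} ->
  forall t, t \in `[0, T] -> f t = h t.
Proof.
move=> T0 cf ch fh.
have /(continuous_within_itvP _ T0)[cfo f0 fT] := cf.
have /(continuous_within_itvP _ T0)[cho h0 hT] := ch.
have io k : {within `[0, T], continuous k} -> mu.-integrable `]0, T[ (EFin \o k).
  by move=> ck; exact/integrable_oo/continuous_integrable.
have key t : 0 < t < T -> f t = h t.
  move=> /andP[t0 tT].
  have tI : t \in `]0, T[ by rewrite in_itv /= t0 tT.
  have dprim k : {within `[0, T], continuous k} -> {for t, continuous k} ->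
      derive1 (fun x => \int[mu]_(s in `[0, x]) k s) t = k t.
    move=> ck ct; have ki := continuous_integrable ck.
    by have [] := continuous_FTC1_closed tT ki t0 ct.
  rewrite -(dprim f) //; last exact: cfo.
  rewrite -(dprim h) //; last exact: cho.
  rewrite !derive1E; apply: near_eq_derive => //.
  near=> y; have yT : y <= T by near: y; exact: lt_le_nbhsl.
  rewrite -!Rintegral_oo_cc; [|exact: integrable_sub yT (io _ _)..].
  by apply: (@ae_eq_primitive _ _ T) => //; exact: io.
move=> t; rewrite in_itv /= => /andP[]; rewrite le_eqVlt => /predU1P[<- _|t0].
  suff h0' : f x @[x --> 0^'+] --> h 0 by exact: (cvg_unique _ f0 h0').
  apply: cvg_trans h0; apply: near_eq_cvg; near=> y; rewrite key //.
  by apply/andP; split.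
rewrite le_eqVlt => /predU1P[->|tT]; last by apply: key; rewrite t0 tT.
suff hT' : f x @[x --> T^'-] --> h T by exact: (cvg_unique _ fT hT').
apply: cvg_trans hT; apply: near_eq_cvg; near=> y; rewrite key //.
by apply/andP; split.
Unshelve. all: by end_near. Qed.

End SquareIntegrableReal.

(** * Test functions and weak derivatives *)

Section Smooth.
Context {R : realType}.
Local Notation mu := (@lebesgue_measure R).
Implicit Types (f g h phi : R -> R) (a b t T x : R).

Lemma is_derive_mul f g x df dg : is_derive x (1 : R) f df ->
  is_derive x (1 : R) g dg ->
  is_derive x (1 : R) (fun y => f y * g y) (df * g x + f x * dg).
Proof.
move=> hf hg; have h := is_deriveM hf hg.
by rewrite addrC [df * _]mulrC; exact: h.
Qed.

Lemma is_derive_affine c d x : is_derive x (1 : R) (fun y => c * y + d) c.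
Proof.
have h := is_deriveD (is_derive_mul (is_derive_cst c x 1) (is_derive_id x (1 : R)))
  (is_derive_cst d x (1 : R)).
by move: h; rewrite mul0r mulr1 add0r addr0.
Qed.

(** With a finite order, closure under sums, products and affine substitutions goes by induction on
    n, without formulas for higher derivatives. *)
Definition smooth_upto n f :=
  forall k, (k < n)%N -> forall x, derivable (derive1n k f) x 1.

Lemma smooth_upto0 f : smooth_upto 0 f.
Proof. by move=> k; rewrite ltn0. Qed.

Lemma smooth_uptoI n f f' : (forall x, is_derive x (1 : R) f (f' x)) ->
  smooth_upto n f' -> smooth_upto n.+1 f.
Proof.
move=> ff' sf' [_ x|k kn x]; first exact: (@ex_derive _ _ _ _ _ _ _ (ff' x)).
rewrite /derive1n iterSr; have -> : derive1 f = f'; last exact: sf'.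
by apply/funext => y; rewrite derive1E (@derive_val _ _ _ _ _ _ _ (ff' y)).
Qed.

Lemma smooth_uptoE n f : smooth_upto n.+1 f ->
  (forall x, is_derive x (1 : R) f (derive1 f x)) /\ smooth_upto n (derive1 f).
Proof.
move=> sf; split=> [x|k kn x].
  by apply: DeriveDef; [exact: (sf 0%N)|rewrite derive1E].
by have := sf k.+1 kn x; rewrite /derive1n iterSr.
Qed.

Lemma smooth_upto_le m n f : (m <= n)%N -> smooth_upto n f -> smooth_upto m f.
Proof. by move=> mn sf k km; apply: sf; exact: leq_trans mn. Qed.

Lemma smooth_uptoD n f g : smooth_upto n f -> smooth_upto n g ->
  smooth_upto n (fun x => f x + g x).
Proof.
elim: n f g => [f g _ _|n IH f g]; first exact: smooth_upto0.
move=> /smooth_uptoE[df sf] /smooth_uptoE[dg sg].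
by apply: smooth_uptoI (IH _ _ sf sg) => x; exact: is_deriveD.
Qed.

Lemma smooth_uptoZ n k f : smooth_upto n f -> smooth_upto n (fun x => k * f x).
Proof.
elim: n f => [f _|n IH f]; first exact: smooth_upto0.
move=> /smooth_uptoE[df sf].
by apply: smooth_uptoI (IH _ sf) => x; exact: is_deriveZ.
Qed.

Lemma smooth_uptoM n f g : smooth_upto n f -> smooth_upto n g ->
  smooth_upto n (fun x => f x * g x).
Proof.
elim: n f g => [f g _ _|n IH f g]; first exact: smooth_upto0.
move=> sfn sgn.
have /smooth_uptoE[df sf] := sfn; have /smooth_uptoE[dg sg] := sgn.
have sf' := smooth_upto_le (leqnSn n) sfn; have sg' := smooth_upto_le (leqnSn n) sgn.
refine (@smooth_uptoI n _ (fun x => derive1 f x * g x + f x * derive1 g x) _ _).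
  by move=> x; exact: is_derive_mul.
by apply: smooth_uptoD; exact: IH.
Qed.

Lemma smooth_upto_affine n f c d : smooth_upto n f ->
  smooth_upto n (fun x => f (c * x + d)).
Proof.
elim: n f => [f _|n IH f]; first exact: smooth_upto0.
move=> /smooth_uptoE[df sf].
refine (@smooth_uptoI n _ (fun x => c * derive1 f (c * x + d)) _ _); last first.
  exact: smooth_uptoZ (IH _ sf).
move=> x.
have aff := is_derive_affine c d x.
have := @is_derive1_comp _ f (fun x => c * x + d) x _ _ (df _) aff.
by rewrite mulrC.
Qed.

(* [flat 0] is the standard flat function [exp (- 1 / x)]; the family is
   closed under differentiation up to linear combinations. *)
Definition flat k x : R := if 0 < x then x^-1 ^+ k * expR (- x^-1) else 0.

(** One term of the exponential series at 1/x. The square on the right is what makes the difference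
    quotient at 0 tend to 0. *)
Lemma flat_le k x : 0 < x -> flat k x <= (k.+2)`!%:R * x ^+ 2.
Proof.
move=> x0; rewrite /flat x0.
have xi : 0 <= x^-1 by rewrite invr_ge0 ltW.
have := expR_ge1Dxn k.+1 xi => h.
have {}h : x^-1 ^+ k.+2 / (k.+2)`!%:R <= expR x^-1.
  by apply: le_trans h; rewrite lerDr.
rewrite expRN ler_pdivrMr ?expR_gt0 //.
have f0 : 0 < (k.+2)`!%:R :> R by rewrite ltr0n fact_gt0.
move: h; rewrite ler_pdivrMr // => h.
have -> : x^-1 ^+ k = x ^+ 2 * x^-1 ^+ k.+2.
  by rewrite !exprS expr0 mulr1; field; rewrite gt_eqF.
rewrite [leRHS]mulrAC [leRHS]mulrC ler_wpM2l ?sqr_ge0 //.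
by rewrite mulrC.
Qed.

Lemma flat_ge0 k x : 0 <= flat k x.
Proof.
by rewrite /flat; case: ifP => // x0; rewrite mulr_ge0 ?expR_ge0 // exprn_ge0 // invr_ge0 ltW.
Qed.

Lemma is_derive_flat k x :
  is_derive x (1 : R) (flat k) (- k%:R * flat k.+1 x + flat k.+2 x).
Proof.
have [x0|x0|->] := ltgtP x 0.
- apply: (@near_eq_is_derive _ _ _ (cst 0)); last first.
    by rewrite /flat ltNge ltW //= mulr0 addr0; exact: is_derive_cst.
  near=> y; rewrite /flat ifF //; apply/negbTE; rewrite -leNgt.
  by near: y; exact: lt_le_nbhsl.
- apply: (@near_eq_is_derive _ _ _ (fun x => x^-1 ^+ k * expR (- x^-1))).
    near=> y; rewrite /flat ifT //.
    have : y \in `]0, +oo[ by near: y; apply: near_in_itvoy; rewrite in_itv /= x0.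
    by rewrite in_itv /= andbT.
  have dV : is_derive x (1 : R) (fun y : R => y^-1) (- x ^- 2).
    apply: is_derive_eq; first by apply: is_deriveV; rewrite gt_eqF.
    by rewrite /GRing.scale /= mulr1.
  have dN : is_derive x (1 : R) (fun y : R => - y^-1) (x ^- 2).
    by have h := is_deriveN dV; rewrite opprK in h; exact: h.
  have dE := @is_derive1_comp _ expR (fun y => - y^-1) x _ _ (is_derive_expR _) dN.
  have dX := @is_deriveX _ _ (fun y : R => y^-1 : R) k x 1 _ dV.
  have XE : (fun y : R => y^-1 ^+ k) = (fun y : R => y^-1 : R) ^+ k.
    by apply/funext => y; rewrite exprfctE.
  rewrite -XE in dX; apply: (is_derive_eq (is_derive_mul dX dE)).
  rewrite /flat x0 /GRing.scale /=.
  clear; case: k => [|k].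
    by rewrite !expr0 ?mulr0n ?oppr0 !mul0r ?mulr0 ?addr0 ?add0r mul1r exprVn mulrC.
  move: (expR _) => E; rewrite -[x ^- 2]exprVn /= !exprS expr0 mulr1.
  move: (x^-1 ^+ k) (x^-1) (k.+1%:R) => z y c; ring.
have f0 j : flat j 0 = 0 by rewrite /flat ltxx.
(* At the junction the quotient is at most (k+2)! |h| by [flat_le]. *)
suff cv : (fun h : R => h^-1 *: (flat k (h *: 1 + 0) - flat k 0)) @ 0^' --> (0 : R).
  by rewrite !f0 mulr0 addr0; apply: DeriveDef; [apply/cvg_ex; exists 0|exact: cvg_lim cv].
apply/cvgrPdist_le => e e0; near=> h.
have h0 : h != 0 by near: h; exact: nbhs_dnbhs_neq.
have K0 : 0 < (k.+2)`!%:R :> R by rewrite ltr0n fact_gt0.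
rewrite sub0r normrN addr0 f0 subr0 /GRing.scale /= mulr1 normrM normfV.
rewrite ler_pdivrMl ?normr_gt0 //.
apply: (@le_trans _ _ ((k.+2)`!%:R * `|h| ^+ 2)).
  rewrite real_normK ?num_real // ger0_norm ?flat_ge0 //.
  have [h_gt0|h_le0] := ltP 0 h; first exact: flat_le.
  by rewrite /flat ltNge h_le0 /= mulr_ge0 ?sqr_ge0 // ltW.
rewrite expr2 mulrCA ler_wpM2l // mulrC -ler_pdivlMr //.
near: h; apply: dnbhs0_le; exact: divr_gt0.
Unshelve. all: by end_near. Qed.

Lemma smooth_flat n k : smooth_upto n (flat k).
Proof.
elim: n k => [k|n IH k]; first exact: smooth_upto0.
apply: smooth_uptoI (is_derive_flat k) _; apply: smooth_uptoD; last exact: IH.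
exact: smooth_uptoZ.
Qed.

Lemma flat0_le1 x : flat 0 x <= 1.
Proof.
rewrite /flat; case: ifP => // x0; rewrite expr0 mul1r -expR0 ler_expR.
by rewrite oppr_le0 invr_ge0 ltW.
Qed.

Lemma flat0_cvg (u : nat -> R) : u @ \oo --> +oo -> flat 0 \o u @ \oo --> (1 : R).
Proof.
move=> uoo; rewrite -[1]expR0 -oppr0.
have pos : \forall n \near \oo, 0 < u n by move/cvgryPgt : uoo; exact.
have : (fun n => expR (- (u n)^-1)) @ \oo --> expR (- 0).
  apply: continuous_cvg; first exact: continuous_expR.
  by apply: cvgN; apply/gtr0_cvgV0.
apply: cvg_trans; apply: near_eq_cvg; near=> n.
by rewrite /flat /= ifT ?expr0 ?mul1r //; near: n.
Unshelve. all: by end_near. Qed.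

(** The two factors confine the support to [t / (m+1), t]. Inside (0, t) both arguments tend to
    infinity with m, so the limit is the indicator function of (0, t). *)
Definition cutoff t m x := flat 0 (m.+1%:R * x + - t) * flat 0 ((- m.+1%:R) * x + m.+1%:R * t).

Lemma cutoff_test t T m : 0 < t -> t < T -> test_function T (cutoff t m).
Proof.
move=> t0 tT; split=> [k x|].
  apply: (@smooth_uptoM k.+1) => //; apply: smooth_upto_affine; exact: smooth_flat.
have m0 : 0 < m.+1%:R :> R by rewrite ltr0n.
exists (t / m.+1%:R), t; split=> //; first by rewrite divr_gt0.
move=> x; rewrite in_itv /= negb_and -!ltNge => /orP[xt|tx]; rewrite /cutoff.
  rewrite /flat ifF ?mul0r //; apply/negbTE; rewrite -leNgt subr_le0.
  by move: xt; rewrite ltr_pdivlMr // mulrC => /ltW.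
rewrite [X in _ * X]/flat ifF ?mulr0 //; apply/negbTE; rewrite -leNgt.
by rewrite addrC mulNr subr_le0 ler_pM2l // ltW.
Qed.

Lemma cutoff_ge0 t m x : 0 <= cutoff t m x.
Proof. by rewrite mulr_ge0 ?flat_ge0. Qed.

Lemma cutoff_le1 t m x : cutoff t m x <= 1.
Proof. by rewrite -[1]mulr1 ler_pM ?flat_ge0 ?flat0_le1. Qed.

Lemma cutoff_cvg t x : 0 < x -> x < t -> cutoff t ^~ x @ \oo --> (1 : R).
Proof.
move=> x0 xt; rewrite -[1]mulr1; apply: cvgM.
  apply: (@flat0_cvg (fun m => m.+1%:R * x + - t)); apply/cvgryPge => M.
  near=> m; rewrite lerBrDr -ler_pdivrMr //.
  apply: le_trans (_ : m%:R <= _); last by rewrite ler_nat.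
  by near: m; exact: nbhs_infty_ger.
apply: (@flat0_cvg (fun m => (- m.+1%:R) * x + m.+1%:R * t)); apply/cvgryPge => M.
near=> m; rewrite addrC mulNr -mulrBr -ler_pdivrMr ?subr_gt0 //.
apply: le_trans (_ : m%:R <= _); last by rewrite ler_nat.
by near: m; exact: nbhs_infty_ger.
Unshelve. all: by end_near. Qed.

Lemma cutoff_out t m x : t <= x -> cutoff t m x = 0.
Proof.
move=> tx; rewrite /cutoff [X in _ * X]/flat ifF ?mulr0 //; apply/negbTE.
by rewrite -leNgt addrC mulNr subr_le0 ler_pM2l ?ltr0n.
Qed.

Lemma test_function_c1 T phi : test_function T phi -> c1 phi (derive1 phi).
Proof.
move=> [dphi _]; split=> [x|].
  by apply: DeriveDef; [exact: (dphi 0%N)|rewrite derive1E].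
apply: (@is_derive_continuous _ _ (derive1 (derive1 phi))) => x.
by apply: DeriveDef; [exact: (dphi 1%N)|rewrite derive1E].
Qed.

Lemma test_function_continuous T phi : test_function T phi -> continuous (phi : R -> R).
Proof. by move=> /test_function_c1[dphi _]; exact: is_derive_continuous dphi. Qed.

Lemma test_function_end T phi : test_function T phi -> phi T = 0.
Proof.
by move=> [_ [a [b [_ bT ->]]]] //; rewrite in_itv /= negb_and -!ltNge bT orbT.
Qed.

Lemma test_function_derive T phi : test_function T phi -> test_function T (derive1 phi).
Proof.
move=> [dphi [a [b [a0 bT phi0]]]]; split=> [k x|].
  by have := dphi k.+1 x; rewrite /derive1n iterSr.
exists a, b; split=> // x xab; rewrite derive1E.
have : {near x, phi =1 cst 0}.
  have : nbhs x (~` [set` `[a, b]]).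
    apply: open_nbhs_nbhs; split; first exact/closed_openC/interval_closed.
    exact/negP.
  by apply: filterS => y /negP; exact: phi0.
by move=> /near_eq_derive ->; rewrite derive_cst.
Qed.

Lemma integrable_test T phi g : test_function T phi ->
  mu.-integrable `]0, T[ (EFin \o g) ->
  mu.-integrable `]0, T[ (EFin \o (fun t => phi t * g t)).
Proof.
move=> tphi gi; apply: integrable_mul_continuous => //.
by apply: continuous_subspaceT; exact: test_function_continuous tphi.
Qed.

(** Dominated convergence along [cutoff t m], with |g| as the bound. *)
Lemma test_primitive_eq0 T g : mu.-integrable `]0, T[ (EFin \o g) ->
  (forall phi, test_function T phi -> \int[mu]_(t in `]0, T[) (phi t * g t) = 0) ->
  forall t, 0 < t < T -> primitive g t = 0.
Proof.
move=> gi tg t /andP[t0 tT].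
have sub : `]0, t[ `<=` `]0, T[ by apply: subset_itvl; rewrite bnd_simp ltW.
pose f_ m x := (cutoff t m x * g x)%:E.
pose gt : R -> R := g \_ `]0, t[.
pose f (x : R) : \bar R := (gt x)%:E.
have mg : measurable_fun `]0, T[ g by case/integrableP: gi => /measurable_EFinP.
have bi m : mu.-integrable `]0, T[ (f_ m).
  by apply: integrable_test => //; exact: cutoff_test.
have mf : measurable_fun `]0, T[ f.
  apply/measurable_EFinP; apply: (@measurable_funS _ _ _ _ setT) => //.
  have mt : measurable (`]0, t[%classic : set R) by exact: measurable_itv.
  by apply/(measurable_restrictT g mt); exact: measurable_funS mg.
have f_f : {ae mu, forall x, (`]0, T[%classic : set R) x -> f_ ^~ x @ \oo --> f x}.
  apply: aeW => x /=; rewrite in_itv /= => /andP[x0 _].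
  apply/cvg_EFin; first exact: nearW.
  rewrite /f_ /f /gt patchE; case: ifPn => xt.
    rewrite -[X in _ --> X]mul1r; apply: cvgM; last exact: cvg_cst.
    by apply: cutoff_cvg => //; move: xt; rewrite inE /= in_itv /= => /andP[].
  apply: cvg_near_cst; apply: nearW => m; rewrite /= cutoff_out ?mul0r //.
  by rewrite leNgt; apply: contra xt => xt; rewrite inE /= in_itv /= x0.
have gi' : mu.-integrable `]0, T[ (abse \o (EFin \o g)) by exact: integrable_abse.
have f_g : {ae mu, forall x n, (`]0, T[%classic : set R) x -> (`|f_ n x| <= (abse \o (EFin \o g)) x)%E}.
  apply: aeW => x m _; rewrite /f_ lee_fin normrM ger0_norm ?cutoff_ge0 //.
  by rewrite -[leRHS]mul1r ler_wpM2r // cutoff_le1.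
have [_ _] := @dominated_convergence _ _ _ mu `]0, T[%classic (measurable_itv _) f_ f _
  (fun m => measurable_int _ (bi m)) mf f_f gi' f_g.
have -> : [sequence (\int[mu]_(x in `]0%R, T[) f_ n x)%E]_n = cst 0%E.
  apply/funext => m /=; rewrite -EFin_Rintegral; last 2 first.
  - exact: measurable_itv.
  - exact: bi.
  by rewrite tg //; exact: cutoff_test.
move=> h; have e := cvg_unique (@ereal_hausdorff R) (cvg_cst _) h.
by rewrite /primitive -(setIidr sub) Rintegral_mkcondr /Rintegral -e.
Qed.

Lemma test_ae_eq0 T g : mu.-integrable `]0, T[ (EFin \o g) ->
  (forall phi, test_function T phi -> \int[mu]_(t in `]0, T[) (phi t * g t) = 0) ->
  {ae mu, forall t, t \in `]0, T[ -> g t = 0}.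
Proof. by move=> gi tg; apply: primitive_eq0_ae => //; exact: test_primitive_eq0. Qed.

(** If all integrals were 0, [test_primitive_eq0] applied to the constant 1 would give T / 2 = 0. *)
Lemma test_nonzero T : 0 < T ->
  exists2 rho, test_function T rho & \int[mu]_(t in `]0, T[) rho t != 0.
Proof.
move=> T0; apply: contrapT => no.
have t0 : 0 < T / 2 < T by rewrite divr_gt0 //= ltr_pdivrMr // ltr_pMr // ltr1n.
have := @test_primitive_eq0 T (cst 1) (integrable_cst T 1) _ _ t0.
case/andP: t0 => t0 _.
have c1id : c1 (id : R -> R) (cst 1) by split=> [x|x]; [exact: is_derive_id|exact: cvg_cst].
rewrite /primitive (Rintegral_derive c1id (ltW t0)) subr0 => h.
have : T / 2 = 0; last by move/eqP; rewrite gt_eqF.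
apply: h => phi tphi; apply/eqP; apply: contraT => phi0; case: no; exists phi => //.
by under eq_Rintegral do rewrite -[phi _]mulr1.
Qed.

Lemma test_smooth T phi n : test_function T phi -> smooth_upto n phi.
Proof. by move=> [dphi _] k _ x; exact: dphi. Qed.

Lemma test_functionD T phi psi : test_function T phi -> test_function T psi ->
  test_function T (fun x => phi x + psi x).
Proof.
move=> tphi tpsi; split=> [k x|].
  apply: (@smooth_uptoD k.+1) (ltnSn k) x.
    exact: test_smooth tphi.
  exact: test_smooth tpsi.
have [_ [a [b [a0 bT phi0]]]] := tphi; have [_ [a' [b' [a'0 b'T psi0]]]] := tpsi.
exists (Num.min a a'), (Num.max b b'); split.
- by rewrite lt_min a0.
- by rewrite gt_max bT.
move=> x; rewrite in_itv /= ge_min le_max negb_and !negb_or => xab.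
rewrite phi0 ?psi0 ?addr0 // in_itv /=; move: xab;
by case: (a <= x); case: (a' <= x); case: (x <= b); case: (x <= b').
Qed.

Lemma test_functionZ T k phi : test_function T phi -> test_function T (fun x => k * phi x).
Proof.
move=> tphi; split=> [j x|].
  apply: (@smooth_uptoZ j.+1) (ltnSn j) x; exact: test_smooth tphi.
have [_ [a [b [a0 bT phi0]]]] := tphi.
by exists a, b; split=> // x xab; rewrite phi0 ?mulr0.
Qed.

(** The mean value 0 is what makes the primitive vanish again to the right of the support. *)
Lemma test_function_primitive T theta : 0 < T -> test_function T theta ->
  \int[mu]_(t in `]0, T[) theta t = 0 ->
  test_function T (primitive theta) /\ derive1 (primitive theta) = theta.
Proof.
move=> T0 ttheta theta0; have ctheta := test_function_continuous ttheta.
have [dtheta [a [b [a0 bT th0]]]] := ttheta.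
have out x : x \notin `[a, b] -> primitive theta x = 0.
  rewrite in_itv /= negb_and -!ltNge => /orP[xa|bx].
    rewrite /primitive Rintegral_mkcond (_ : _ \_ _ = cst 0) ?Rintegral_cst ?mul0r //.
    apply/funext => s; rewrite patchE; case: ifPn => // sx.
    apply: th0; rewrite in_itv /= negb_and -ltNge.
    by move: sx; rewrite inE /= in_itv /= => /andP[_ /lt_trans] ->.
  rewrite -[RHS]theta0 /primitive Rintegral_mkcond [RHS]Rintegral_mkcond.
  congr Rintegral; apply/funext => s; rewrite !patchE !mem_setE /= !in_itv /=.
  have [s0|s0] := ltP 0 s => //=.
  case: (ltP s x) => sx; case: (ltP s T) => sT //.
    rewrite th0 // in_itv /= negb_and -!ltNge.
    by rewrite (lt_le_trans bT sT) orbT.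
  by rewrite th0 // in_itv /= negb_and -!ltNge (lt_le_trans bx sx) orbT.
have dprim x : is_derive x (1 : R) (primitive theta) (theta x).
  have [xa|ax] := ltP x a.
    apply: (@near_eq_is_derive _ _ _ (cst 0)).
      near=> y; rewrite out // in_itv /= negb_and -ltNge.
      by apply/orP; left; near: y; exact: lt_nbhsl.
    rewrite th0 ?in_itv /= ?negb_and -?ltNge ?xa //; exact: is_derive_cst.
  have x0 : 0 < x by exact: lt_le_trans ax.
  have thi y : mu.-integrable `[0, y] (EFin \o theta).
    by apply: continuous_integrable; exact: continuous_subspaceT.
  have xx1 : x < x + 1 by rewrite ltrDl.
  have [d1 d2] := continuous_FTC1_closed xx1 (thi _) x0 (ctheta x).
  apply: (@near_eq_is_derive _ _ _ (fun x => \int[mu]_(t in `[0, x]) theta t)).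
    by near=> y; rewrite /primitive Rintegral_oo_cc //; exact: integrable_oo.
  by apply: DeriveDef => //; rewrite -derive1E.
have dE : derive1 (primitive theta) = theta.
  by apply/funext => y; rewrite derive1E (@derive_val _ _ _ _ _ _ _ (dprim y)).
split=> //; split; last by exists a, b.
move=> [|k] x; first exact: (@ex_derive _ _ _ _ _ _ _ (dprim x)).
by rewrite /derive1n iterSr dE; exact: dtheta.
Unshelve. all: by end_near. Qed.

(* du Bois-Reymond *)
Lemma weak_derivative_ae_primitive T f g : 0 < T ->
  mu.-integrable `]0, T[ (EFin \o f) -> mu.-integrable `]0, T[ (EFin \o g) ->
  (forall phi, test_function T phi ->
     \int[mu]_(t in `]0, T[) (derive1 phi t * f t) =
     - \int[mu]_(t in `]0, T[) (phi t * g t)) ->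
  exists c, {ae mu, forall t, t \in `]0, T[ -> f t = c + primitive g t}.
Proof.
move=> T0 fi gi fg.
have Gi : mu.-integrable `]0, T[ (EFin \o primitive g).
  by apply: sq_integrable_integrable; apply: primitive_sq_integrable => //; exact: ltW.
(* This difference has weak derivative 0; it remains to see that it is constant. *)
pose w t := f t + (-1) * primitive g t.
have wi : mu.-integrable `]0, T[ (EFin \o w).
  by apply: integrable_add => //; exact: integrable_scale.
have w0 phi : test_function T phi -> \int[mu]_(t in `]0, T[) (derive1 phi t * w t) = 0.
  move=> tphi; have tphi' := test_function_derive tphi.
  under eq_Rintegral do rewrite mulrDr.
  rewrite RintegralD //; [|exact: integrable_test..|]; last first.
    by apply: integrable_test => //; exact: integrable_scale.
  rewrite fg //; under [X in _ + X]eq_Rintegral do rewrite mulrCA.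
  rewrite RintegralZl //; last exact: integrable_test.
  rewrite (integral_by_parts (ltW T0) (test_function_c1 tphi) gi).
  by rewrite (test_function_end tphi) mul0r sub0r mulN1r opprK addNr.
have [rho trho rho0] := test_nonzero T0.
set I := \int[mu]_(t in `]0, T[) rho t in rho0.
pose c := \int[mu]_(t in `]0, T[) (rho t * w t) / I.
have ti phi : test_function T phi -> mu.-integrable `]0, T[ (EFin \o phi).
  move=> tphi; apply/integrable_oo/continuous_integrable.
  by apply: continuous_subspaceT; exact: test_function_continuous tphi.
have wc : {ae mu, forall t, t \in `]0, T[ -> w t + (- c) = 0}.
  apply: test_ae_eq0; first by apply: integrable_add => //; exact: integrable_cst.
  (* Subtracting the right multiple of [rho] gives mean value 0, hence the derivative of a test
     function, and [w] annihilates such derivatives. *)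
  move=> psi tpsi; set k := \int[mu]_(t in `]0, T[) psi t / I.
  have ttheta : test_function T (fun t => psi t + (- k) * rho t).
    by apply: test_functionD => //; exact: test_functionZ.
  have theta0 : \int[mu]_(t in `]0, T[) (psi t + (- k) * rho t) = 0.
    rewrite RintegralD //; [|exact: ti|by apply: ti; exact: test_functionZ].
    by rewrite RintegralZl ?ti // -/I mulNr /k divfK // subrr.
  have [tprim dprim] := test_function_primitive T0 ttheta theta0.
  have := w0 _ tprim; rewrite dprim; under eq_Rintegral do rewrite mulrDl.
  rewrite RintegralD //; [|exact: integrable_test|]; last first.
    by apply: integrable_test => //; exact: test_functionZ.
  under [X in _ + X]eq_Rintegral do rewrite -mulrA.
  rewrite RintegralZl //; last exact: integrable_test.
  move=> e; under eq_Rintegral do rewrite mulrDr.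
  rewrite RintegralD //; [|exact: integrable_test|]; last first.
    by apply: integrable_test => //; exact: integrable_cst.
  under [X in _ + X]eq_Rintegral do rewrite mulrC.
  rewrite RintegralZl ?ti // -[RHS]e; congr (_ + _).
  by rewrite /c /k; ring.
exists c; move: wc; apply: filterS; first exact: (ae_filter_ringOfSetsType mu).
move=> t wt tT; have := wt tT; rewrite /w mulN1r => /eqP.
by rewrite subr_eq0 subr_eq => /eqP.
Qed.

End Smooth.

(** * Density of iterated primitives *)

Section Density.
Context {R : realType}.
Local Notation mu := (@lebesgue_measure R).
Implicit Types (f g h phi : R -> R) (a b t T x : R).

Definition sqint T f : R := \int[mu]_(t in `]0, T[) (f t ^+ 2).

Lemma sqint_cvg0 T (u : nat -> R -> R) G :
  (forall n, measurable_fun `]0, T[ (u n)) -> sq_integrable T G ->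
  (forall n t, 0 < t < T -> `|u n t| <= G t) ->
  (forall t, 0 < t < T -> u ^~ t @ \oo --> (0 : R)) ->
  forall eps, 0 < eps -> exists n, sqint T (u n) < eps.
Proof.
move=> mu_ [mG iG] uG u0 eps eps0.
pose f_ n (t : R) : \bar R := (u n t ^+ 2)%:E.
pose f (t : R) : \bar R := 0%E.
have mf_ n : measurable_fun `]0, T[ (f_ n).
  by apply/measurable_EFinP; exact: measurable_funX.
have uG2 n t : 0 < t < T -> u n t ^+ 2 <= G t ^+ 2.
  move=> tT; rewrite -[u n t ^+ 2]real_normK ?num_real // ler_pXn2r ?nnegrE //.
    exact: uG.
  exact: le_trans (normr_ge0 _) (uG n t tT).
have f_f : {ae mu, forall x, (`]0, T[%classic : set R) x -> f_ ^~ x @ \oo --> f x}.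
  apply: aeW => x /=; rewrite in_itv /= => xT.
  have h : (fun n => u n x ^+ 2) @ \oo --> (0 : R).
    have -> : (fun n => u n x ^+ 2) = (fun n => u n x * u n x).
      by apply/funext => n; rewrite expr2.
    by rewrite -[X in _ --> X](mulr0 0); apply: cvgM; exact: u0.
  by apply/cvg_EFin; [exact: nearW|exact: h].
have f_g : {ae mu, forall x n, (`]0, T[%classic : set R) x ->
    (`|f_ n x| <= (EFin \o (fun t => (G t ^+ 2)%R)) x)%E}.
  apply: aeW => x n /=; rewrite in_itv /= => xT.
  by rewrite lee_fin ger0_norm ?sqr_ge0 // uG2.
have mf : measurable_fun `]0, T[ f by exact: measurable_cst.
have [_ _] := @dominated_convergence _ _ _ mu `]0, T[%classic (measurable_itv _) f_ f _
  mf_ mf f_f iG f_g.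
rewrite /f integral0 => /fine_cvgP[fin] /cvgrPdist_lt/(_ _ eps0)[N _ hN].
exists N; have := hN N (leqnn N); rewrite /= sub0r normrN => /(le_lt_trans _); apply.
exact: ler_norm.
Qed.

Lemma sqint_ge0 T f : 0 <= sqint T f.
Proof. by apply: Rintegral_ge0 => t _; exact: sqr_ge0. Qed.

Lemma sqint_le T f (g : R -> R) : measurable_fun `]0, T[ f ->
  mu.-integrable `]0, T[ (EFin \o g) -> (forall t, 0 < t < T -> f t ^+ 2 <= g t) ->
  sqint T f <= \int[mu]_(t in `]0, T[) g t.
Proof.
move=> mf gi fg.
have fi : mu.-integrable `]0, T[ (EFin \o (fun t => f t ^+ 2)).
  apply: integrable_le gi => //; first exact: measurable_funX.
  by move=> t /=; rewrite in_itv /= => tT; rewrite ger0_norm ?sqr_ge0 // fg.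
by apply: le_Rintegral => // t /=; rewrite in_itv; exact: fg.
Qed.

Lemma sqintD_le T f g : sq_integrable T f -> sq_integrable T g ->
  sqint T (fun t => f t + g t) <= 2 * sqint T f + 2 * sqint T g.
Proof.
move=> [mf fi] [mg gi]; rewrite /sqint -!RintegralZl // -RintegralD //;
  [|exact: integrable_scale..].
apply: sqint_le; first exact: measurable_funD.
  by apply: integrable_add => //; exact: integrable_scale.
by move=> t _; have := sqr_ge0 (f t - g t); nra.
Qed.

(** Differentiability is asked only to the right of [c] because the integral of [h] from -1, to
    which this applies, is differentiated only there. *)
Lemma Rintegral_derive_gt phi phi' c a b : (forall x, c < x -> is_derive x (1 : R) phi (phi' x)) ->
  continuous (phi' : R -> R) -> c < a -> a <= b ->
  \int[mu]_(s in `]a, b[) phi' s = phi b - phi a.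
Proof.
move=> dphi cphi' ca; rewrite le_eqVlt => /predU1P[->|ab].
  by rewrite set_itvoo0 Rintegral_set0 subrr.
have cphi x : c < x -> {for x, continuous phi}.
  move=> cx; apply: differentiable_continuous; apply/derivable1_diffP.
  exact: (@ex_derive _ _ _ _ _ _ _ (dphi x cx)).
have cw : {within `[a, b], continuous phi'} by exact: continuous_subspaceT.
rewrite Rintegral_oo_cc; last exact/integrable_oo/continuous_integrable.
have cx x : a < x -> c < x by exact: lt_trans.
rewrite /Rintegral (@continuous_FTC2 _ _ phi) //.
- split=> [x||].
  + by rewrite in_itv /= => /andP[ax _]; exact: (@ex_derive _ _ _ _ _ _ _ (dphi x (cx x ax))).
  + by apply: cvg_at_right_filter; exact: cphi.
  + by apply: cvg_at_left_filter; apply: cphi; exact: cx.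
- move=> x; rewrite in_itv /= => /andP[ax _].
  by rewrite derive1E (@derive_val _ _ _ _ _ _ _ (dphi x (cx x ax))).
Qed.

Lemma Rintegral_bound f a b M : a <= b -> continuous (f : R -> R) ->
  (forall t, `|f t| <= M) -> `|\int[mu]_(s in `]a, b[) f s| <= M * (b - a).
Proof.
move=> ab cf fM.
have ci (k : R -> R) : continuous (k : R -> R) -> mu.-integrable `]a, b[ (EFin \o k).
  by move=> ck; apply/integrable_oo/continuous_integrable; exact: continuous_subspaceT.
apply: le_trans (le_normr_Rintegral _ (ci _ cf)) _ => //.
have -> : M * (b - a) = \int[mu]_(s in `]a, b[) (M * (1 : R)).
  rewrite RintegralZl //; last by apply: ci => x; exact: cvg_cst.
  congr (_ * _); have c1id : c1 (id : R -> R) (cst 1).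
    by split=> [x|x]; [exact: is_derive_id|exact: cvg_cst].
  by rewrite (Rintegral_derive c1id ab).
apply: le_Rintegral => //.
- by apply: ci => x; apply: cvg_norm; exact: cf.
- by apply: ci => x; exact: cvg_cst.
- by move=> t _; rewrite mulr1.
Qed.

(** Forward averages of [h] over intervals of length 1/(n+1) are differentiable and converge to [h],
    but a primitive must vanish at 0. A cutoff removes the initial value at a cost that tends to
    0. *)
Lemma continuous_primitive_approx T h M : 0 < T -> continuous (h : R -> R) ->
  (forall t, `|h t| <= M) -> forall eps, 0 < eps ->
  exists2 g, sq_integrable T g & sqint T (fun t => primitive g t - h t) < eps.
Proof.
move=> T0 ch hM.
have M0 : 0 <= M by exact: le_trans (normr_ge0 _) (hM 0).
(* Starting at -1 leaves 0 in the interior, where the integral is differentiable. *)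
pose P x := \int[mu]_(t in `[-1, x]) h t.
have dP x : -1 < x -> is_derive x (1 : R) P (h x).
  move=> x1; have xx1 : x < x + 1 by rewrite ltrDl.
  have hi : mu.-integrable `[-1, x + 1] (EFin \o h).
    by apply: continuous_integrable; exact: continuous_subspaceT.
  have [d1 d2] := continuous_FTC1_closed xx1 hi x1 (ch x).
  by apply: DeriveDef => //; rewrite -derive1E.
have PB x y : -1 < x -> x <= y -> `|P y - P x| <= M * (y - x).
  by move=> x1 xy; rewrite -(Rintegral_derive_gt dP ch x1 xy); exact: Rintegral_bound.
pose d n : R := n.+1%:R^-1.
have d0 n : 0 < d n by rewrite invr_gt0 ltr0n.
pose avg n x := (d n)^-1 * (P (1 * x + d n) - P x).
have avgM n x : -1 < x -> `|avg n x| <= M.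
  move=> x1; rewrite /avg normrM gtr0_norm ?invr_gt0 // ler_pdivrMl //.
  rewrite mul1r; apply: le_trans (PB _ _ x1 _) _; first by rewrite lerDl ltW.
  by rewrite [x + _]addrC addrK mulrC.
pose k n x := (d n)^-1 * (h (1 * x + d n) - h x).
have davg n x : -1 < x -> is_derive x (1 : R) (avg n) (k n x).
  move=> x1; have x1' : -1 < 1 * x + d n by rewrite mul1r ltr_wpDr // ltW.
  have aff := is_derive_affine 1 (d n) x.
  have h1 := @is_derive1_comp _ P (fun x => 1 * x + d n) x _ _ (dP _ x1') aff.
  have h2 := is_deriveB h1 (dP _ x1).
  have h3 := is_derive_mul (is_derive_cst (d n)^-1 x (1 : R)) h2.
  by move: h3; rewrite mul0r add0r mulr1.
have ck n : continuous (k n : R -> R).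
  move=> x; apply: cvgM; first exact: cvg_cst.
  apply: cvgB; last exact: ch.
  apply: continuous_comp; last exact: ch.
  by apply: cvgD; [apply: cvgM; [exact: cvg_cst|exact: cvg_id]|exact: cvg_cst].
(* The initial value to be removed: the approximant is [avg n - c n * (1 - B n)], with [B n] equal
   to 0 at 0 and tending to 1 on (0, T). *)
pose c n := avg n 0.
pose B n := cutoff T n.
have dB n x : is_derive x (1 : R) (B n) (derive1 (B n) x).
  have s : smooth_upto 1 (B n).
    by apply: smooth_uptoM; apply: smooth_upto_affine; exact: smooth_flat.
  exact: (smooth_uptoE s).1.
have cB n : continuous (derive1 (B n) : R -> R).
  have s : smooth_upto 2 (B n).
    by apply: smooth_uptoM; apply: smooth_upto_affine; exact: smooth_flat.
  have [_ /smooth_uptoE[s' _]] := smooth_uptoE s.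
  exact: is_derive_continuous s'.
have B0 n : B n 0 = 0.
  rewrite /B /cutoff mulr0 add0r [flat 0 (- T)]/flat ifF ?mul0r //.
  by apply/negbTE; rewrite -leNgt oppr_le0 ltW.
pose g n t := k n t + c n * derive1 (B n) t.
have ci n : continuous (g n : R -> R).
  move=> x; apply: cvgD; first exact: ck.
  by apply: cvgM; [exact: cvg_cst|exact: cB].
have gL n : sq_integrable T (g n).
  by apply: continuous_sq_integrable; exact: continuous_subspaceT.
have m10 : -1 < 0 :> R by rewrite ltrN10.
have gE n t : 0 <= t -> primitive (g n) t = avg n t - c n * (1 - B n t).
  move=> t0; have it (u : R -> R) : continuous (u : R -> R) ->
      mu.-integrable `]0, t[ (EFin \o u).
    by move=> cu; apply/integrable_oo/continuous_integrable; exact: continuous_subspaceT.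
  rewrite /primitive RintegralD //; last 2 first.
  - by apply: it; exact: ck.
  - by apply: integrable_scale => //; apply: it; exact: cB.
  rewrite [X in _ + X]RintegralZl //; last by apply: it; exact: cB.
  rewrite (Rintegral_derive_gt (davg n) (ck n) m10 t0).
  have cc : c1 (B n) (derive1 (B n)) by split.
  by rewrite (Rintegral_derive cc t0) B0 /c; ring.
move=> eps eps0.
(* The bound 3 M is one M for each of the average, the correction and [h]. *)
have [||t tT|t tT|n hn] := @sqint_cvg0 T (fun n t => primitive (g n) t - h t)
    (cst (3 * M)) _ _ _ _ eps eps0.
- move=> n; apply: measurable_funB.
    by have [] := primitive_sq_integrable (ltW T0) (sq_integrable_integrable (gL n)).
  by apply: measurable_continuous_oo; exact: continuous_subspaceT.
- by apply: continuous_sq_integrable; apply: continuous_subspaceT => x; exact: cvg_cst.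
- move=> t0T; case/andP: (t0T) => t0 _; rewrite (gE _ _ (ltW t0)).
  have t1 : -1 < tT by exact: lt_trans t0.
  have := avgM t tT t1; have := avgM t 0 m10; rewrite -/(c t) => c1 c2.
  have c3 := hM tT; have b0 := cutoff_ge0 T t tT; have b1 := cutoff_le1 T t tT.
  have : `|c t * (1 - B t tT)| <= M.
    rewrite normrM -[leRHS]mulr1 ler_pM // ger0_norm ?subr_ge0 //.
    by rewrite lerBlDr lerDl.
  move=> c4; apply: le_trans (ler_normB _ _) _; rewrite /cst.
  have := ler_normB (avg t tT) (c t * (1 - B t tT)); lra.
- case/andP: (tT) => t0 tlT.
  have t1 : -1 < t by exact: lt_trans t0.
  have avgh : avg ^~ t @ \oo --> h t.
    have : (fun x : R => x^-1 *: (P (x *: 1 + t) - P t)) @ 0^' --> h t.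
      rewrite -(@derive_val _ _ _ _ _ _ _ (dP t t1)).
      exact: (@ex_derive _ _ _ _ _ _ _ (dP t t1)).
    have dd : (forall n, d n > 0) /\ d @ \oo --> (0 : R).
      by split=> //; exact: cvg_harmonic.
    move=> /cvg_dnbhs_at_right/cvg_at_rightP/(_ d dd).
    suff -> : avg ^~ t = fun n => (d n)^-1 *: (P (d n *: 1 + t) - P t) by [].
    by apply/funext => n; rewrite /avg /GRing.scale /= mulr1 mul1r (addrC t).
  have cB0 : (fun n => c n * (1 - B n t)) @ \oo --> (0 : R).
    have b1 : (fun n => M * (1 - B n t)) @ \oo --> (0 : R).
      rewrite -[X in _ --> X](mulr0 M) -[X in _ --> M * X](subrr 1).
      apply: cvgM; first exact: cvg_cst.
      by apply: cvgB; [exact: cvg_cst|exact: cutoff_cvg].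
    apply: (@squeeze_cvgr _ _ _ _ (fun n => - (M * (1 - B n t)))
      (fun n => M * (1 - B n t))) => //; last first.
      by rewrite -oppr0; exact: cvgN.
    apply: nearW => n; rewrite -ler_norml normrM.
    have b := cutoff_le1 T n t.
    by rewrite ler_pM // ?avgM // ger0_norm // subr_ge0.
  have -> : (fun n => primitive (g n) t - h t) =
      (fun n => avg n t - c n * (1 - B n t) - h t).
    by apply/funext => m; rewrite gE // ltW.
  rewrite -[X in _ --> X](subrr (h t)); apply: cvgB; last exact: cvg_cst.
  by rewrite -[X in _ --> X](subr0 (h t)); exact: cvgB.
by exists (g n).
Qed.

Definition clamp (M x : R) : R := (`|x + M| - `|x - M|) / 2.

Lemma clamp_id M x : `|x| <= M -> clamp M x = x.
Proof.
rewrite ler_norml => /andP[Mx xM]; rewrite /clamp ger0_norm ?ler0_norm; first lra.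
  by rewrite subr_le0.
by rewrite -lerBlDr sub0r.
Qed.

Lemma clamp_norm M x : 0 <= M -> `|clamp M x| <= M.
Proof.
move=> M0; rewrite /clamp ler_norml.
case: (lerP 0 (x + M)) => h1; case: (lerP 0 (x - M)) => h2.
all: by rewrite ?(ger0_norm h1) ?(ltr0_norm h1) ?(ger0_norm h2) ?(ltr0_norm h2); apply/andP; split; lra.
Qed.

Lemma clamp_lip M x y : 0 <= M -> `|clamp M x - clamp M y| <= `|x - y|.
Proof.
move=> M0; rewrite /clamp.
wlog xy : x y / x <= y.
  move=> H; have [|yx] := leP x y; first exact: H.
  by rewrite distrC [leRHS]distrC; apply: H; exact: ltW.
have -> : `|x - y| = y - x by rewrite distrC ger0_norm // subr_ge0.
rewrite ler_norml.
case: (lerP 0 (x + M)) => h1; case: (lerP 0 (x - M)) => h2;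
case: (lerP 0 (y + M)) => h3; case: (lerP 0 (y - M)) => h4.
all: rewrite ?(ger0_norm h1) ?(ltr0_norm h1) ?(ger0_norm h2) ?(ltr0_norm h2).
all: rewrite ?(ger0_norm h3) ?(ltr0_norm h3) ?(ger0_norm h4) ?(ltr0_norm h4).
all: apply/andP; split; lra.
Qed.

Lemma clamp_sub M x : 0 <= M -> `|x - clamp M x| <= 2 * `|x|.
Proof.
move=> M0; have -> : clamp M x = clamp M x - clamp M 0.
  by rewrite /clamp add0r sub0r normrN subrr mul0r subr0.
rewrite (le_trans (ler_normB _ _)) //.
by have := clamp_lip x 0 M0; rewrite subr0; lra.
Qed.

Lemma clamp_continuous M : continuous (clamp M).
Proof.
move=> x; apply: cvgM; last exact: cvg_cst.
by apply: cvgB; apply: cvg_norm; [apply: cvgD|apply: cvgB];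
  (exact: cvg_id || exact: cvg_cst).
Qed.

(** Truncate [f], approximate the truncation by a bounded continuous function, then use
    [continuous_primitive_approx]. Truncation lets approximation in L^1 serve for L^2. *)
Lemma primitive_dense T f eps : 0 < T -> sq_integrable T f -> 0 < eps ->
  exists2 g, sq_integrable T g & sqint T (fun t => primitive g t - f t) < eps.
Proof.
move=> T0 fL eps0; have [mf f2i] := fL.
(* The two uses of [sqintD_le] give the three errors the weights 2, 4 and 4, in total 10/12 of
   [eps]. *)
have e12 : 0 < eps / 12 by rewrite divr_gt0.
have mclamp M (k : R -> R) : measurable_fun `]0, T[ k ->
    measurable_fun `]0, T[ (fun t => clamp M (k t)).
  move=> mk; apply: (measurableT_comp _ mk); apply: continuous_measurable_fun.
  exact: clamp_continuous.
have [|||t tT|n hn] := @sqint_cvg0 T (fun n t => f t - clamp n%:R (f t))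
    (fun t => 2 * `|f t|) _ _ _ _ _ e12.
- by move=> n; apply: measurable_funB => //; exact: mclamp.
- apply: sq_integrableZ; split; first exact: measurableT_comp.
  have -> : (fun t => `|f t| ^+ 2) = (fun t => f t ^+ 2); last by [].
  by apply/funext => t; rewrite real_normK ?num_real.
- by move=> n t _; exact: clamp_sub.
- apply: cvg_near_cst; near=> n; rewrite clamp_id ?subrr //.
  by near: n; exact: nbhs_infty_ger.
set M : R := n%:R; pose F t := clamp M (f t).
have M0 : 0 <= M by rewrite ler0n.
have FM t : `|F t| <= M by exact: clamp_norm.
have mF : measurable_fun `]0, T[ F by exact: mclamp.
have FL : sq_integrable T F.
  split=> //; apply: integrable_le (integrable_cst T (M ^+ 2)) => //.
    exact: measurable_funX.
  move=> t _; rewrite ger0_norm ?sqr_ge0 // -[leLHS]real_normK ?num_real //.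
  by rewrite ler_pXn2r ?nnegrE.
have Fi := sq_integrable_integrable FL.
have muT : (mu `]0%R, T[%classic < +oo)%E.
  by rewrite lebesgue_measure_itv /=; case: ifP => // _; rewrite -EFinB ltry.
have [g_ [cg gi gF]] := approximation_continuous_integrable (measurable_itv _) muT Fi.
have [m hm] : exists m, \int[mu]_(t in `]0, T[) `|F t - g_ m t| < eps / 12 / (2 * M + 1).
  move/fine_cvgP: gF => [_ /cvgrPdist_lt/(_ (eps / 12 / (2 * M + 1)))].
  have p : 0 < eps / 12 / (2 * M + 1).
    by rewrite divr_gt0 // ltr_wpDl // mulr_ge0.
  move=> /(_ p)[N _ hN]; exists N; have := hN N (leqnn N).
  by rewrite /= sub0r normrN => /(le_lt_trans _); apply; exact: ler_norm.
pose h t := clamp M (g_ m t).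
have ch : continuous (h : R -> R).
  move=> x; apply: (@continuous_comp _ _ _ (g_ m) (clamp M)); first exact: (cg m).
  exact: clamp_continuous.
have hM t : `|h t| <= M by exact: clamp_norm.
have [g gL gh] := continuous_primitive_approx T0 ch hM e12.
have hL : sq_integrable T h by apply: continuous_sq_integrable; exact: continuous_subspaceT.
have FhL : sq_integrable T (fun t => h t + (-1) * F t).
  by apply: sq_integrableD => //; exact: sq_integrableZ.
have FfL : sq_integrable T (fun t => F t + (-1) * f t).
  by apply: sq_integrableD => //; exact: sq_integrableZ.
have pgL : sq_integrable T (fun t => primitive g t + (-1) * h t).
  apply: sq_integrableD; last exact: sq_integrableZ.
  by apply: primitive_sq_integrable; [exact: ltW|exact: sq_integrable_integrable].
(* Both functions are bounded by M, so the squared difference is at most 2 M times the difference;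
   clamping is 1-Lipschitz and fixes [F], which leaves the L^1 error. *)
have Fh : sqint T (fun t => h t + (-1) * F t) < eps / 12.
  apply: (@le_lt_trans _ _ (\int[mu]_(t in `]0, T[) (2 * M * `|F t - g_ m t|))).
    apply: sqint_le; first by case: FhL.
      apply: integrable_scale => //; apply: integrable_norm => //.
      have -> : (fun t => F t - g_ m t) = (fun t => F t + (-1) * g_ m t).
        by apply/funext => t; rewrite mulN1r.
      by apply: integrable_add => //; apply: integrable_scale => //; exact: gi.
    move=> t _; rewrite mulN1r -real_normK ?num_real // expr2 ler_pM //.
      by rewrite (le_trans (ler_normB _ _)) //; have := hM t; have := FM t; lra.
    by rewrite distrC -{1}(clamp_id (FM t)); exact: clamp_lip.
  rewrite RintegralZl //; last first.
    apply: integrable_norm => //.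
    have -> : (fun t => F t - g_ m t) = (fun t => F t + (-1) * g_ m t).
      by apply/funext => t; rewrite mulN1r.
    by apply: integrable_add => //; apply: integrable_scale => //; exact: gi.
  have i0 : 0 <= \int[mu]_(t in `]0, T[) `|F t - g_ m t| by exact: Rintegral_ge0.
  move: hm; rewrite ltr_pdivlMr; last by rewrite ltr_wpDl // mulr_ge0.
  by apply: le_lt_trans; rewrite mulrDr mulr1 mulrC lerDl.
exists g => //.
have h2 := sqintD_le FhL FfL.
have h3 := sqintD_le pgL (sq_integrableD FhL FfL).
have e1 : sqint T (fun t => primitive g t - f t) = sqint T (fun t =>
    primitive g t + -1 * h t + (h t + -1 * F t + (F t + -1 * f t))).
  by apply: eq_Rintegral => t _; congr (_ ^+ 2); ring.
have e2 : sqint T (fun t => primitive g t + -1 * h t) = sqint T (fun t => primitive g t - h t).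
  by apply: eq_Rintegral => t _; rewrite mulN1r.
have e3 : sqint T (fun t => F t + -1 * f t) = sqint T (fun t => f t - F t).
  by apply: eq_Rintegral => t _; rewrite -sqrrN; congr (_ ^+ 2); ring.
rewrite e1; move: hn gh; rewrite -/M -/(sqint T (fun t => f t - F t)) -e2 -e3; lra.
Unshelve. all: by end_near. Qed.

(** Continuity of the primitive in L^2. The pointwise inequality |w| <= s + w^2 / s replaces
    Cauchy-Schwarz and bounds the primitive by s (T + 1). *)
Lemma sqint_primitive_small T : 0 < T -> forall eps, 0 < eps -> exists2 del, 0 < del &
  forall w, sq_integrable T w -> sqint T w < del -> sqint T (primitive w) < eps.
Proof.
move=> T0 eps eps0.
pose K := T * (T + 1) ^+ 2.
have K0 : 0 < K by rewrite mulr_gt0 // exprn_gt0 // addr_gt0.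
(* The squared norm of the primitive is at most s^2 K; with s <= 1 this is at most s K, hence at
   most eps / 2. *)
pose s := Num.min 1 (eps / (2 * K)).
have s0 : 0 < s by rewrite lt_min ltr01 divr_gt0 // mulr_gt0.
exists (s ^+ 2); first exact: exprn_gt0.
move=> w wL wN.
have wi := sq_integrable_integrable wL.
have pw t : 0 < t < T -> `|primitive w t| <= s * (T + 1).
  move=> /andP[t0 tT]; apply: le_trans (primitive_norm wi (ltW tT)) _.
  apply: (@le_trans _ _ (\int[mu]_(t in `]0, T[) (s * 1 + s^-1 * w t ^+ 2))).
    apply: le_Rintegral => //; first exact: (integrable_norm wi).
      apply: integrable_add => //; first exact: integrable_cst.
      by apply: integrable_scale => //; case: wL.
    move=> x _; rewrite mulr1 -(ler_pM2l s0) mulrDr mulVKf ?gt_eqF // -expr2.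
    have := sqr_ge0 (s - `|w x|); rewrite sqrrB real_normK ?num_real //.
    have := mulr_ge0 (ltW s0) (normr_ge0 (w x)); have := sqr_ge0 s.
    have := sqr_ge0 (w x); lra.
  rewrite RintegralD //; last 2 first.
  - exact: integrable_cst.
  - by apply: integrable_scale => //; case: wL.
  rewrite RintegralZl //; last exact: integrable_cst.
  rewrite RintegralZl //; last by case: wL.
  have c1id : c1 (id : R -> R) (cst 1).
    by split=> [x|x]; [exact: is_derive_id|exact: cvg_cst].
  rewrite (Rintegral_derive c1id (ltW T0)) subr0 mulrDr mulr1 lerD2l.
  by rewrite ler_pdivrMl // -expr2 ltW.
have pL := primitive_sq_integrable (ltW T0) wi.
apply: (@le_lt_trans _ _ (\int[mu]_(t in `]0, T[) ((s * (T + 1)) ^+ 2 * 1))).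
  apply: sqint_le; [by case: pL|exact: integrable_cst|].
  move=> t tT; rewrite mulr1 -[_ ^+ 2]real_normK ?num_real // ler_pXn2r ?nnegrE //.
    exact: pw.
  by rewrite mulr_ge0 ?ltW // addr_gt0.
rewrite RintegralZl //; last exact: integrable_cst.
have c1id : c1 (id : R -> R) (cst 1).
  by split=> [x|x]; [exact: is_derive_id|exact: cvg_cst].
rewrite (Rintegral_derive c1id (ltW T0)) subr0.
have -> : (s * (T + 1)) ^+ 2 * T = s ^+ 2 * K by rewrite /K; ring.
have s1 : s <= 1 by rewrite ge_min lexx.
have s2 : s <= eps / (2 * K) by rewrite ge_min lexx orbT.
have s3 : s ^+ 2 <= s by rewrite expr2 ler_piMl // ltW.
have : s ^+ 2 * K <= s * K by rewrite ler_wpM2r // ltW.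
have : s * K <= eps / 2.
  have -> : eps / 2 = eps / (2 * K) * K by field; rewrite gt_eqF.
  by apply: ler_wpM2r => //; exact: ltW.
lra.
Qed.

Lemma iter_primitive_sq_integrable T g L : 0 <= T -> sq_integrable T g ->
  sq_integrable T (iter L primitive g).
Proof.
move=> T0 gL; elim: L => //= L IH.
by apply: primitive_sq_integrable => //; exact: sq_integrable_integrable.
Qed.

Lemma iter_primitive_dense L T f eps : 0 < T -> sq_integrable T f -> 0 < eps ->
  exists2 g, sq_integrable T g & sqint T (fun t => iter L primitive g t - f t) < eps.
Proof.
move=> T0; elim: L f eps => [|L IH] f eps fL eps0.
  exists f => //; rewrite /sqint; under eq_Rintegral do rewrite /= subrr expr0n.
  by rewrite Rintegral_cst ?mul0r.
have e4 : 0 < eps / 4 by rewrite divr_gt0.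
have [f1 f1L f1N] := primitive_dense T0 fL e4.
have [del del0 hdel] := sqint_primitive_small T0 e4.
have [g gL gN] := IH f1 del f1L del0.
exists g => //=.
have iL := iter_primitive_sq_integrable L (ltW T0) gL.
pose w t := iter L primitive g t + (-1) * f1 t.
have wL : sq_integrable T w by apply: sq_integrableD => //; exact: sq_integrableZ.
have wN : sqint T w < del.
  by apply: le_lt_trans gN; rewrite /sqint; under eq_Rintegral do rewrite /w mulN1r.
have := hdel w wL wN => pN.
have pfL : sq_integrable T (fun t => primitive f1 t + (-1) * f t).
  apply: sq_integrableD; last exact: sq_integrableZ.
  by apply: primitive_sq_integrable => //; [exact: ltW|exact: sq_integrable_integrable].
have pwL : sq_integrable T (primitive w).
  by apply: primitive_sq_integrable => //; [exact: ltW|exact: sq_integrable_integrable].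
have := sqintD_le pwL pfL.
have -> : sqint T (fun t => primitive w t + (primitive f1 t + (-1) * f t)) =
    sqint T (fun t => primitive (iter L primitive g) t - f t).
  apply: eq_Rintegral => t; rewrite inE /= in_itv /= => /andP[_ tT].
  rewrite (@primitiveD _ _ _ T) ?(@primitiveZ _ _ _ T) ?ltW //; first 1 last.
  - exact: sq_integrable_integrable.
  - exact: sq_integrable_integrable.
  - by apply: integrable_scale => //; exact: sq_integrable_integrable.
  by congr (_ ^+ 2); ring.
have -> : sqint T (fun t => primitive f1 t + (-1) * f t) =
    sqint T (fun t => primitive f1 t - f t).
  by apply: eq_Rintegral => t _; rewrite mulN1r.
lra.
Qed.

End Density.

(** * Weak derivatives and iterated primitives *)

Section WeakDerivatives.
Context {R : realType}.
Local Notation mu := (@lebesgue_measure R).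
Implicit Types (f g h phi : R -> R) (a b t T x : R).

Definition weakly T k f g := forall phi, test_function T phi ->
  \int[mu]_(t in `]0, T[) (derive1n k phi t * f t) =
  (-1) ^+ k * \int[mu]_(t in `]0, T[) (phi t * g t).

Lemma weakly_iter_primitive T g L k : 0 < T -> sq_integrable T g -> (k <= L)%N ->
  weakly T k (iter L primitive g) (iter (L - k) primitive g).
Proof.
move=> T0 gL; elim: k => [_|k IH kL] phi tphi; first by rewrite subn0 expr0 mul1r.
have tphi' := test_function_derive tphi.
have -> : derive1n k.+1 phi = derive1n k (derive1 phi) by rewrite /derive1n iterSr.
have Lk : (L - k = (L - k.+1).+1)%N by lia.
rewrite (IH (ltnW kL) _ tphi') Lk iterS.
rewrite (integral_by_parts (ltW T0) (test_function_c1 tphi)); last first.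
  exact/sq_integrable_integrable/iter_primitive_sq_integrable/gL/ltW.
by rewrite (test_function_end tphi) mul0r sub0r mulrN exprS mulN1r mulNr.
Qed.

(** Each [s k] is a primitive of [s k.+1] up to a constant, and continuity together with the value 0
    at 0 removes the constant. Descending from L reaches [s 0], which agrees with [f] almost
    everywhere. *)
Lemma weakly_iter_primitive_ae T L f (s : nat -> R -> R) : 0 < T ->
  mu.-integrable `]0, T[ (EFin \o f) ->
  (forall k, (k <= L)%N -> sq_integrable T (s k) /\ weakly T k f (s k)) ->
  (forall k, (k < L)%N -> {within `[0, T], continuous (s k)} /\ s k 0 = 0) ->
  {ae mu, forall t, t \in `]0, T[ -> f t = iter L primitive (s L) t}.
Proof.
move=> T0 fi sL sc.
have si k : (k <= L)%N -> mu.-integrable `]0, T[ (EFin \o s k).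
  by move=> /sL[+ _]; exact: sq_integrable_integrable.
have step k : (k < L)%N -> forall t, t \in `[0, T] -> s k t = primitive (s k.+1) t.
  move=> kL; have [ck k0] := sc k kL.
  have [c ae_c] : exists c,
      {ae mu, forall t, t \in `]0, T[ -> s k t = c + primitive (s k.+1) t}.
    apply: weak_derivative_ae_primitive => //; [exact/si/ltnW|exact: si|].
    move=> phi tphi.
    have [_ wk] := sL k (ltnW kL); have [_ wk1] := sL k.+1 kL.
    have := wk1 phi tphi.
    have -> : derive1n k.+1 phi = derive1n k (derive1 phi) by rewrite /derive1n iterSr.
    rewrite (wk _ (test_function_derive tphi)) exprS mulN1r mulNr -mulrN.
    by move/(mulrI (unitrX k (unitrN1 _))).
  have cp : {within `[0, T], continuous (fun t => c + primitive (s k.+1) t)}.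
    move=> x; apply: cvgD; first exact: cvg_cst.
    by apply: primitive_continuous; [exact: ltW|exact: si].
  have eq := continuous_ae_eq T0 ck cp ae_c.
  have c0 : c = 0.
    have := eq 0; rewrite in_itv /= lexx ltW // => /(_ isT).
    by rewrite k0 primitive_at0 addr0.
  by move=> t tT; rewrite eq // c0 add0r.
have all_ j : (j <= L)%N -> forall t, t \in `]0, T[ -> s (L - j)%N t = iter j primitive (s L) t.
  elim: j => [_ t _|j IH jL t tT]; first by rewrite subn0.
  have Lj : (L - j.+1 < L)%N by lia.
  rewrite (step _ Lj) ?(subset_itv_oo_cc tT) //.
  have -> : (L - j.+1).+1 = (L - j)%N by lia.
  rewrite iterS; move: tT; rewrite in_itv /= => /andP[_ tT].
  apply: (@eq_primitive _ _ _ T); first exact: ltW.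
  by move=> u uT; apply: IH; [exact: ltnW|rewrite in_itv].
have s0 : {ae mu, forall t, t \in `]0, T[ -> f t + (-1) * s 0%N t = 0}.
  apply: test_ae_eq0.
    by apply: integrable_add => //; apply: integrable_scale => //; exact: si.
  move=> phi tphi; under eq_Rintegral do rewrite mulrDr.
  rewrite RintegralD //; [|exact: integrable_test|]; last first.
    by apply: integrable_test => //; apply: integrable_scale => //; exact: si.
  have [_ w0] := sL 0%N (leq0n _); have := w0 phi tphi.
  rewrite expr0 mul1r /= => ->; under [X in _ + X]eq_Rintegral do rewrite mulrCA.
  rewrite RintegralZl //; last by apply: integrable_test => //; exact: si.
  by rewrite mulN1r subrr.
move: s0; apply: filterS; first exact: (ae_filter_ringOfSetsType mu).
move=> t st tT; have := st tT; rewrite mulN1r => /eqP; rewrite subr_eq0 => /eqP ->.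
by have := all_ L (leqnn _) t tT; rewrite subnn.
Qed.

End WeakDerivatives.

(** * Matrix-valued functions *)

Section ComplexParts.
Context {R : realType}.
Local Notation mu := (@lebesgue_measure R).
Local Notation K := (R[i]).
Local Notation Re := (@complex.Re R).
Local Notation Im := (@complex.Im R).

Lemma RecD (x y : K) : Re (x + y) = Re x + Re y. Proof. by case: x; case: y. Qed.
Lemma ImcD (x y : K) : Im (x + y) = Im x + Im y. Proof. by case: x; case: y. Qed.
Lemma RecM (x y : K) : Re (x * y) = Re x * Re y - Im x * Im y.
Proof. by case: x; case: y. Qed.
Lemma ImcM (x y : K) : Im (x * y) = Re x * Im y + Im x * Re y.
Proof. by case: x => a b; case: y => c d /=. Qed.

Lemma Rec_sum (I : Type) (r : seq I) (P : pred I) (F : I -> K) :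
  Re (\sum_(i <- r | P i) F i) = \sum_(i <- r | P i) Re (F i).
Proof. exact: (big_morph Re RecD (erefl : Re 0 = 0)). Qed.

Lemma Imc_sum (I : Type) (r : seq I) (P : pred I) (F : I -> K) :
  Im (\sum_(i <- r | P i) F i) = \sum_(i <- r | P i) Im (F i).
Proof. exact: (big_morph Im ImcD (erefl : Im 0 = 0)). Qed.

Lemma complex_ext (x y : K) : Re x = Re y -> Im x = Im y -> x = y.
Proof. by case: x => a b; case: y => c d /= -> ->. Qed.

Definition cparts (P : (R -> R) -> Prop) (f : R -> K) :=
  P (fun t => Re (f t)) /\ P (fun t => Im (f t)).

Definition mparts (P : (R -> R) -> Prop) m n (F : R -> 'M[K]_(m, n)) :=
  forall i j, cparts P (fun t => F t i j).

(** One set of closure lemmas serves integrable, square integrable and continuous entries alike. *)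
Definition stable_linear (P : (R -> R) -> Prop) :=
  P (fun=> 0) /\ forall k f g, P f -> P g -> P (fun t => k * f t + g t).

Definition stable_mul (Q P : (R -> R) -> Prop) :=
  forall f g, Q f -> P g -> P (fun t => f t * g t).

Section Closed.
Variables (P Q : (R -> R) -> Prop).
Hypotheses (Pl : stable_linear P) (PQ : stable_mul Q P).

Lemma closedD f g : P f -> P g -> P (fun t => f t + g t).
Proof.
move=> Pf Pg; have := Pl.2 1 f g Pf Pg.
by under eq_fun do rewrite mul1r.
Qed.

Lemma closedZ k f : P f -> P (fun t => k * f t).
Proof.
move=> Pf; have := Pl.2 k f _ Pf Pl.1.
by under eq_fun do rewrite addr0.
Qed.

Lemma closedB f g : P f -> P g -> P (fun t => f t - g t).
Proof.
move=> Pf Pg; have := closedD Pf (closedZ (-1) Pg).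
by under eq_fun do rewrite mulN1r.
Qed.

Lemma cpartsD f g : cparts P f -> cparts P g -> cparts P (fun t => f t + g t).
Proof.
move=> [f1 f2] [g1 g2]; split.
  by under eq_fun do rewrite RecD; exact: closedD.
by under eq_fun do rewrite ImcD; exact: closedD.
Qed.

Lemma cparts0 : cparts P (fun=> 0).
Proof. by split; exact: Pl.1. Qed.

Lemma cpartsM f g : cparts Q f -> cparts P g -> cparts P (fun t => f t * g t).
Proof.
move=> [f1 f2] [g1 g2]; split.
  by under eq_fun do rewrite RecM; apply: closedB; exact: PQ.
by under eq_fun do rewrite ImcM; apply: closedD; exact: PQ.
Qed.

Lemma cpartsZ k g : cparts P g -> cparts P (fun t => k * g t).
Proof.
move=> [g1 g2]; split.
  by under eq_fun do rewrite RecM; apply: closedB; exact: closedZ.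
by under eq_fun do rewrite ImcM; apply: closedD; exact: closedZ.
Qed.

Lemma cparts_sum (I : Type) (r : seq I) (F : I -> R -> K) :
  (forall i, cparts P (F i)) -> cparts P (fun t => \sum_(i <- r) F i t).
Proof.
move=> Fi; elim: r => [|i r IH].
  by under eq_fun do rewrite big_nil; exact: cparts0.
by under eq_fun do rewrite big_cons; exact: cpartsD.
Qed.

Lemma mpartsD m n (F G : R -> 'M[K]_(m, n)) : mparts P F -> mparts P G ->
  mparts P (fun t => F t + G t).
Proof. by move=> PF PG i j; under eq_fun do rewrite mxE; exact: cpartsD. Qed.

Lemma mparts_mulmx m n k (F : R -> 'M[K]_(m, n)) (G : R -> 'M[K]_(n, k)) :
  mparts Q F -> mparts P G -> mparts P (fun t => F t *m G t).
Proof.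
move=> QF PG i j; under eq_fun do rewrite mxE.
by apply: cparts_sum => l; exact: cpartsM.
Qed.

Lemma mparts_mulmxl m n k (M : 'M[K]_(m, n)) (G : R -> 'M[K]_(n, k)) :
  mparts P G -> mparts P (fun t => M *m G t).
Proof.
move=> PG i j; under eq_fun do rewrite mxE.
by apply: cparts_sum => l; exact: cpartsZ.
Qed.

Lemma mparts_mulmxr m n k (M : 'M[K]_(n, k)) (G : R -> 'M[K]_(m, n)) :
  mparts P G -> mparts P (fun t => G t *m M).
Proof.
move=> PG i j; under eq_fun do rewrite mxE.
by apply: cparts_sum => l; under eq_fun do rewrite mulrC; exact: cpartsZ.
Qed.

Lemma mparts_sum (I : Type) (r : seq I) m n (F : I -> R -> 'M[K]_(m, n)) :
  (forall i, mparts P (F i)) -> mparts P (fun t => \sum_(i <- r) F i t).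
Proof.
move=> PF i j; under eq_fun do rewrite summxE.
by apply: cparts_sum => l; exact: PF.
Qed.

End Closed.

Lemma mparts_sub (P Q : (R -> R) -> Prop) m n (F : R -> 'M[K]_(m, n)) :
  (forall f, P f -> Q f) -> mparts P F -> mparts Q F.
Proof. by move=> PQ PF i j; have [? ?] := PF i j; split; exact: PQ. Qed.

Definition intg T (f : R -> R) : Prop := mu.-integrable `]0, T[ (EFin \o f).
Definition cont (f : R -> R) : Prop := continuous (f : R -> R).

Lemma linear_intg T : stable_linear (intg T).
Proof.
split; first exact: integrable_cst.
by move=> k f g fi gi; apply: integrable_add => //; exact: integrable_scale.
Qed.

Lemma linear_sq T : stable_linear (sq_integrable T).
Proof.
split; first exact: sq_integrable0.
by move=> k f g fi gi; apply: sq_integrableD => //; exact: sq_integrableZ.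
Qed.

Lemma linear_cont : stable_linear cont.
Proof.
split; first by move=> x; exact: cvg_cst.
move=> k f g cf cg x; apply: cvgD; last exact: cg.
by apply: cvgM; [exact: cvg_cst|exact: cf].
Qed.

Lemma cont_intg T : stable_mul cont (intg T).
Proof.
by move=> f g cf gi; apply: integrable_mul_continuous => //; exact: continuous_subspaceT.
Qed.

Lemma sq_intg T f : sq_integrable T f -> intg T f.
Proof. exact: sq_integrable_integrable. Qed.

Definition mint m n (F : R -> 'M[K]_(m, n)) (t : R) : 'M[K]_(m, n) :=
  \matrix_(i, j) (primitive (fun s => Re (F s i j)) t +i*
                  primitive (fun s => Im (F s i j)) t).

Lemma cvintegralE n (f : R -> 'cV[K]_n) t : cvintegral `]0, t[ f = mint f t.
Proof. by apply/colP => i; rewrite !mxE. Qed.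

Lemma eq_mint m n (F G : R -> 'M[K]_(m, n)) t :
  (forall s, 0 < s < t -> F s = G s) -> mint F t = mint G t.
Proof.
move=> FG; apply/matrixP => i j; rewrite !mxE.
by congr (_ +i* _); apply: (@eq_primitive _ _ _ t) => // s st; rewrite FG.
Qed.

Lemma mintD m n (F G : R -> 'M[K]_(m, n)) T t : t <= T ->
  mparts (intg T) F -> mparts (intg T) G ->
  mint (fun s => F s + G s) t = mint F t + mint G t.
Proof.
move=> tT Fi Gi; apply/matrixP => i j; rewrite !mxE.
have [F1 F2] := Fi i j; have [G1 G2] := Gi i j.
apply: complex_ext; rewrite /= ?RecD ?ImcD /= -(@primitiveD _ _ _ T) //.
  by congr primitive; apply/funext => s; rewrite mxE RecD.
by congr primitive; apply/funext => s; rewrite mxE ImcD.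
Qed.

Lemma primitiveB f g T t : t <= T -> intg T f -> intg T g ->
  primitive (fun s => f s - g s) t = primitive f t - primitive g t.
Proof.
by move=> tT fi gi; rewrite /primitive RintegralB //; exact: integrable_sub tT _.
Qed.

Lemma primitive_sum (I : Type) (r : seq I) (f : I -> R -> R) T t : t <= T ->
  (forall i, intg T (f i)) ->
  primitive (fun s => \sum_(i <- r) f i s) t = \sum_(i <- r) primitive (f i) t.
Proof.
move=> tT fi.
suff H : intg T (fun s => \sum_(i <- r) f i s) /\
    primitive (fun s => \sum_(i <- r) f i s) t = \sum_(i <- r) primitive (f i) t.
  by case: H.
elim: r => [|i r [IH1 IH2]].
  rewrite big_nil; under eq_fun do rewrite big_nil; split; first exact: integrable_cst.
  by rewrite /primitive Rintegral_cst ?mul0r.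
rewrite big_cons; under eq_fun do rewrite big_cons; split.
  by apply: integrable_add => //; exact: fi.
by rewrite (@primitiveD _ _ _ T) // ?IH2 //; exact: fi.
Qed.

Lemma mint_mulmxl m n k (M : 'M[K]_(m, n)) (G : R -> 'M[K]_(n, k)) T t : t <= T ->
  mparts (intg T) G -> mint (fun s => M *m G s) t = M *m mint G t.
Proof.
move=> tT Gi; apply/matrixP => i j; rewrite !mxE.
have l := linear_intg T.
apply: complex_ext; rewrite /= ?Rec_sum ?Imc_sum.
  have -> : (fun s => Re ((M *m G s) i j)) =
      (fun s => \sum_l (Re (M i l) * Re (G s l j) - Im (M i l) * Im (G s l j))).
    by apply/funext => s; rewrite mxE Rec_sum; apply: eq_bigr => u _; rewrite RecM.
  rewrite (@primitive_sum _ _ _ T) // => [|u]; last first.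
    by have [? ?] := Gi u j; apply: closedB => //; exact: closedZ.
  apply: eq_bigr => u _; rewrite mxE RecM /=; have [g1 g2] := Gi u j.
  rewrite (primitiveB tT (closedZ l _ g1) (closedZ l _ g2)).
  by rewrite (primitiveZ _ tT g1) (primitiveZ _ tT g2).
have -> : (fun s => Im ((M *m G s) i j)) =
    (fun s => \sum_l (Re (M i l) * Im (G s l j) + Im (M i l) * Re (G s l j))).
  by apply/funext => s; rewrite mxE Imc_sum; apply: eq_bigr => u _; rewrite ImcM.
rewrite (@primitive_sum _ _ _ T) // => [|u]; last first.
  by have [? ?] := Gi u j; apply: closedD => //; exact: closedZ.
apply: eq_bigr => u _; rewrite mxE ImcM /=; have [g1 g2] := Gi u j.
rewrite (primitiveD tT (closedZ l _ g2) (closedZ l _ g1)).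
by rewrite (primitiveZ _ tT g1) (primitiveZ _ tT g2).
Qed.

Definition mderiv m n (F F' : R -> 'M[K]_(m, n)) := forall i j t,
  is_derive t (1 : R) (fun s => Re (F s i j)) (Re (F' t i j)) /\
  is_derive t (1 : R) (fun s => Im (F s i j)) (Im (F' t i j)).

Lemma mderiv_ext m n (F F' G' : R -> 'M[K]_(m, n)) : (forall t, F' t = G' t) ->
  mderiv F F' -> mderiv F G'.
Proof. by move=> /funext ->. Qed.

Lemma mderiv_cont m n (F F' : R -> 'M[K]_(m, n)) : mderiv F F' -> mparts cont F.
Proof.
move=> FF' i j; split.
  exact: (is_derive_continuous (fun t => (FF' i j t).1)).
exact: (is_derive_continuous (fun t => (FF' i j t).2)).
Qed.

Lemma is_derive_add f g (x df dg : R) : is_derive x (1 : R) f df ->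
  is_derive x (1 : R) g dg -> is_derive x (1 : R) (fun y => f y + g y) (df + dg).
Proof. by move=> hf hg; exact: (is_deriveD hf hg). Qed.

Lemma is_derive_sub f g (x df dg : R) : is_derive x (1 : R) f df ->
  is_derive x (1 : R) g dg -> is_derive x (1 : R) (fun y => f y - g y) (df - dg).
Proof. by move=> hf hg; exact: (is_deriveB hf hg). Qed.

Lemma is_derive_sumR (I : Type) (r : seq I) (f : I -> R -> R) (df : I -> R) x :
  (forall i, is_derive x (1 : R) (f i) (df i)) ->
  is_derive x (1 : R) (fun y => \sum_(i <- r) f i y) (\sum_(i <- r) df i).
Proof.
move=> fi; elim: r => [|i r IH].
  by rewrite big_nil; under eq_fun do rewrite big_nil; exact: is_derive_cst.
by rewrite big_cons; under eq_fun do rewrite big_cons; exact: is_derive_add.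
Qed.

Lemma mderiv_mulmx m n k (F F' : R -> 'M[K]_(m, n)) (G G' : R -> 'M[K]_(n, k)) :
  mderiv F F' -> mderiv G G' ->
  mderiv (fun t => F t *m G t) (fun t => F' t *m G t + F t *m G' t).
Proof.
move=> FF' GG' i j t.
have -> : (F' t *m G t + F t *m G' t) i j =
    \sum_l (F' t i l * G t l j + F t i l * G' t l j).
  by rewrite !mxE big_split.
split.
  rewrite Rec_sum; under eq_fun do rewrite mxE Rec_sum.
  apply: is_derive_sumR => l; have [f1 f2] := FF' i l t; have [g1 g2] := GG' l j t.
  under eq_fun do rewrite RecM.
  have := is_derive_sub (is_derive_mul f1 g1) (is_derive_mul f2 g2).
  by rewrite RecD !RecM; congr is_derive; ring.
rewrite Imc_sum; under eq_fun do rewrite mxE Imc_sum.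
apply: is_derive_sumR => l; have [f1 f2] := FF' i l t; have [g1 g2] := GG' l j t.
under eq_fun do rewrite ImcM.
have := is_derive_add (is_derive_mul f1 g2) (is_derive_mul f2 g1).
by rewrite ImcD !ImcM; congr is_derive; ring.
Qed.

Lemma mderiv0_cst m n (F : R -> 'M[K]_(m, n)) : mderiv F (fun=> 0) ->
  forall s t, F s = F t.
Proof.
move=> F0 s t; apply/matrixP => i j; apply: complex_ext.
  apply: (is_derive_0_is_cst (f := fun s => Re (F s i j))) => x.
  by have [+ _] := F0 i j x; rewrite mxE.
apply: (is_derive_0_is_cst (f := fun s => Im (F s i j))) => x.
by have [_ +] := F0 i j x; rewrite mxE.
Qed.

Lemma mderiv_comp_affine m n (F F' : R -> 'M[K]_(m, n)) (c d : R) : mderiv F F' ->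
  mderiv (fun t => F (c * t + d)) (fun t => c%:C *: F' (c * t + d)).
Proof.
move=> FF' i j t; have aff := is_derive_affine c d t.
have [f1 f2] := FF' i j (c * t + d); split.
  have := @is_derive1_comp _ (fun s => Re (F s i j)) (fun x => c * x + d) t _ _ f1 aff.
  by rewrite mxE RecM /= mul0r subr0 mulrC.
have := @is_derive1_comp _ (fun s => Im (F s i j)) (fun x => c * x + d) t _ _ f2 aff.
by rewrite mxE ImcM /= mul0r addr0 mulrC.
Qed.

Lemma integral_by_parts_mx m n k (F F' : R -> 'M[K]_(m, n)) (w : R -> 'M[K]_(n, k)) T :
  0 <= T -> mderiv F F' -> mparts cont F' -> mparts (intg T) w ->
  mint (fun t => F' t *m mint w t) T =
  F T *m mint w T - mint (fun t => F t *m w t) T.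
Proof.
move=> T0 FF' cF' wi.
have cF := mderiv_cont FF'.
have li := linear_intg T.
have pi f : intg T f -> intg T (primitive f).
  by move=> fi; apply: sq_intg; exact: primitive_sq_integrable.
have Fc i j : c1 (fun s => Re (F s i j)) (fun s => Re (F' s i j)) /\
    c1 (fun s => Im (F s i j)) (fun s => Im (F' s i j)).
  have [c1' c2'] := cF' i j.
  by split; split=> // t; [exact: (FF' i j t).1|exact: (FF' i j t).2].
have ci f g : cont f -> intg T g -> intg T (fun t => f t * g t) by exact: cont_intg.
apply/matrixP => i j; rewrite !mxE.
have e1 (z : R) : - z = -1 * z by rewrite mulN1r.
apply: complex_ext.
  rewrite RecD /= Rec_sum.
  have -> : (fun s => Re ((F' s *m mint w s) i j)) = (fun s => \sum_l
     (Re (F' s i l) * primitive (fun s => Re (w s l j)) s -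
      Im (F' s i l) * primitive (fun s => Im (w s l j)) s)).
    by apply/funext => s; rewrite mxE Rec_sum; apply: eq_bigr => l _; rewrite RecM ?mxE.
  have -> : (fun s => Re ((F s *m w s) i j)) = (fun s => \sum_l
     (Re (F s i l) * Re (w s l j) - Im (F s i l) * Im (w s l j))).
    by apply/funext => s; rewrite mxE Rec_sum; apply: eq_bigr => l _; rewrite RecM ?mxE.
  rewrite (@primitive_sum _ _ _ T) // => [|l]; last first.
    have [w1 w2] := wi l j; have [f1 f2] := cF' i l.
    by apply: closedB => //; apply: ci => //; exact: pi.
  rewrite (@primitive_sum _ _ _ T) // => [|l]; last first.
    have [w1 w2] := wi l j; have [f1 f2] := cF i l.
    by apply: closedB => //; exact: ci.
  rewrite -sumrB; apply: eq_bigr => l _.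
  have [w1 w2] := wi l j; have [f1 f2] := cF i l; have [f1' f2'] := cF' i l.
  have [b1 b2] := Fc i l.
  rewrite mxE RecM /= {1 2}/primitive.
  rewrite RintegralB //; try (by apply: ci); try (by apply: ci => //; exact: pi).
  rewrite (integral_by_parts T0 b1 w1) (integral_by_parts T0 b2 w2) /primitive.
  rewrite [in RHS]RintegralB //; try (by apply: ci); ring.
rewrite ImcD /= Imc_sum.
have -> : (fun s => Im ((F' s *m mint w s) i j)) = (fun s => \sum_l
   (Re (F' s i l) * primitive (fun s => Im (w s l j)) s +
    Im (F' s i l) * primitive (fun s => Re (w s l j)) s)).
  by apply/funext => s; rewrite mxE Imc_sum; apply: eq_bigr => l _; rewrite ImcM ?mxE.
have -> : (fun s => Im ((F s *m w s) i j)) = (fun s => \sum_l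
   (Re (F s i l) * Im (w s l j) + Im (F s i l) * Re (w s l j))).
  by apply/funext => s; rewrite mxE Imc_sum; apply: eq_bigr => l _; rewrite ImcM ?mxE.
rewrite (@primitive_sum _ _ _ T) // => [|l]; last first.
  have [w1 w2] := wi l j; have [f1 f2] := cF' i l.
  by apply: closedD => //; apply: ci => //; exact: pi.
rewrite (@primitive_sum _ _ _ T) // => [|l]; last first.
  have [w1 w2] := wi l j; have [f1 f2] := cF i l.
  by apply: closedD => //; exact: ci.
rewrite -sumrB; apply: eq_bigr => l _.
have [w1 w2] := wi l j; have [f1 f2] := cF i l; have [f1' f2'] := cF' i l.
have [b1 b2] := Fc i l.
rewrite mxE ImcM /= {1 2}/primitive.
rewrite RintegralD //; try (by apply: ci); try (by apply: ci => //; exact: pi).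
rewrite (integral_by_parts T0 b1 w2) (integral_by_parts T0 b2 w1) /primitive.
rewrite [in RHS]RintegralD //; try (by apply: ci); ring.
Qed.

End ComplexParts.

(** * The matrix exponential and variation of constants *)

Section MatrixExponential.
Context {R : realType} {d : nat}.
Local Notation mu := (@lebesgue_measure R).
Local Notation K := (R[i]).
Local Notation Re := (@complex.Re R).
Local Notation Im := (@complex.Im R).
Variable A : 'M[K]_d.

(** Submultiplicative and an upper bound for both parts, so that real power series can be used entry
    by entry. *)
Let N (z : K) : R := `|Re z| + `|Im z|.

Let N_ge0 z : 0 <= N z. Proof. exact: addr_ge0. Qed.

Let ND x y : N (x + y) <= N x + N y.
Proof. by rewrite /N RecD ImcD addrACA lerD // ler_normD. Qed.

Let NM x y : N (x * y) <= N x * N y.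
Proof.
rewrite /N RecM ImcM mulrDl !mulrDr -!normrM.
have := ler_normB (Re x * Re y) (Im x * Im y).
have := ler_normD (Re x * Im y) (Im x * Re y); lra.
Qed.

Let N_sum (I : Type) (r : seq I) (F : I -> K) :
  N (\sum_(i <- r) F i) <= \sum_(i <- r) N (F i).
Proof.
elim: r => [|i r IH]; first by rewrite !big_nil /N /= normr0 addr0.
by rewrite !big_cons (le_trans (ND _ _)) // lerD2l.
Qed.

Let S : R := \sum_(i < d) \sum_(j < d) N (A i j).

Let S_ge0 : 0 <= S.
Proof. by apply: sumr_ge0 => i _; apply: sumr_ge0. Qed.

Let pow_bound k i j : N ((A ^+ k) i j) <= S ^+ k.
Proof.
elim: k i j => [|k IH] i j.
  rewrite !expr0 mxE /N; case: eqP => _ /=; first by rewrite normr1 normr0 addr0.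
  by rewrite normr0 addr0 ler01.
rewrite !exprS mxE (le_trans (N_sum _ _)) //.
apply: (@le_trans _ _ ((\sum_(l < d) N (A i l)) * S ^+ k)).
  rewrite mulr_suml; apply: ler_sum => l _.
  by rewrite (le_trans (NM _ _)) // ler_wpM2l.
rewrite ler_wpM2r ?exprn_ge0 // /S [leRHS](bigD1 i) //= lerDl.
by apply: sumr_ge0 => r _; apply: sumr_ge0.
Qed.

Let cvg_exp_series (c : nat -> R) M x : 0 <= M ->
  (forall k, `|c k| <= M * (S ^+ k / k`!%:R)) -> cvgn (pseries c x).
Proof.
move=> M0 cM; apply: normed_cvg; rewrite /normed_series_of.
have h1 k : 0 <= `|c k * x ^+ k| by exact: normr_ge0.
have h2 k : 0 <= (M *: exp_coeff (S * `|x|)) k.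
  by rewrite /GRing.scale /= mulr_ge0 // /exp_coeff /= divr_ge0 ?exprn_ge0 ?mulr_ge0.
have h3 k : `|c k * x ^+ k| <= (M *: exp_coeff (S * `|x|)) k.
  have -> : (M *: exp_coeff (S * `|x|)) k = M * (S ^+ k / k`!%:R) * `|x| ^+ k.
    rewrite -[LHS]/(M * ((S * `|x|) ^+ k / k`!%:R)) exprMn -!mulrA.
    by congr (_ * (_ * _)); rewrite mulrC.
  rewrite normrM normrX.
  by rewrite ler_wpM2r // exprn_ge0.
apply: (series_le_cvg h1 h2 h3).
exact: (@is_cvg_seriesZ _ _ M (is_cvg_series_exp_coeff (S * `|x|))).
Qed.

Section Functional.
Variable l : 'M[K]_d -> R.
Hypothesis lS : forall k, `|l (A ^+ k)| <= S ^+ k.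

(** The coefficients of l(A^n e^(tA)) as a power series in t: differentiating in t raises n by
    one. *)
Let c n k : R := l (A ^+ (k + n)%N) / k`!%:R.

Let cvgc n x : cvgn (pseries (c n) x).
Proof.
apply: (@cvg_exp_series _ (S ^+ n)); first exact: exprn_ge0.
move=> k; rewrite /c normrM normfV (ger0_norm (ler0n _ _)) mulrA.
by rewrite ler_wpM2r ?invr_ge0 // (le_trans (lS _)) // exprD mulrC.
Qed.

Let diffs n : pseries_diffs (c n) = c n.+1.
Proof.
apply/funext => k; rewrite /pseries_diffs /c addSnnS factS natrM invfM.
by rewrite mulrCA mulVKf // pnatr_eq0.
Qed.

Lemma exp_functional_cvg n t : pseries (c n) t @ \oo --> limn (pseries (c n) t).
Proof. exact: cvgc. Qed.

Lemma exp_functional_derive t :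
  is_derive t (1 : R) (fun t => limn (pseries (c 0%N) t)) (limn (pseries (c 1%N) t)).
Proof.
rewrite -(diffs 0%N); apply: (@pseries_snd_diffs _ _ (`|t| + 1)).
- exact: cvgc.
- by rewrite diffs; exact: cvgc.
- by rewrite !diffs; exact: cvgc.
- by rewrite [ltRHS]ger0_norm ?addr_ge0 // ltrDl.
Qed.

End Functional.

Definition mcvg m n (X : nat -> 'M[K]_(m, n)) (Y : 'M[K]_(m, n)) := forall i j,
  (fun k => Re (X k i j)) @ \oo --> Re (Y i j) /\
  (fun k => Im (X k i j)) @ \oo --> Im (Y i j).

Let cvg_sumR (I : Type) (r : seq I) (F : I -> nat -> R) (f : I -> R) :
  (forall i, F i @ \oo --> f i) ->
  (fun k => \sum_(i <- r) F i k) @ \oo --> \sum_(i <- r) f i.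
Proof.
move=> Ff; elim: r => [|i r IH].
  by rewrite big_nil; under eq_fun do rewrite big_nil; exact: cvg_cst.
by rewrite big_cons; under eq_fun do rewrite big_cons; exact: cvgD.
Qed.

Let mcvg_mulmx m n k (X : nat -> 'M[K]_(m, n)) Y (Z : nat -> 'M[K]_(n, k)) W :
  mcvg X Y -> mcvg Z W -> mcvg (fun r => X r *m Z r) (Y *m W).
Proof.
move=> XY ZW i j; split.
  rewrite mxE Rec_sum; under eq_fun do rewrite mxE Rec_sum.
  apply: cvg_sumR => u; have [x1 x2] := XY i u; have [z1 z2] := ZW u j.
  by rewrite RecM; under eq_fun do rewrite RecM; apply: cvgB; exact: cvgM.
rewrite mxE Imc_sum; under eq_fun do rewrite mxE Imc_sum.
apply: cvg_sumR => u; have [x1 x2] := XY i u; have [z1 z2] := ZW u j.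
by rewrite ImcM; under eq_fun do rewrite ImcM; apply: cvgD; exact: cvgM.
Qed.

Let mcvg_cst m n (Y : 'M[K]_(m, n)) : mcvg (fun=> Y) Y.
Proof. by move=> i j; split; exact: cvg_cst. Qed.

Let partialE (l : 'M[K]_d -> R) t n i : (forall M N' : 'M[K]_d, l (M + N') = l M + l N') ->
    (forall (k : R) M, l (k%:C *: M) = k * l M) ->
  l (A ^+ i *m expmx_partial A t n) =
  pseries (fun k => l (A ^+ (k + i)%N) / k`!%:R) t n.
Proof.
move=> lD lZ; have l0 : l 0 = 0 by rewrite -[X in l X](scale0r 0) lZ mul0r.
rewrite /expmx_partial mulmx_sumr /pseries /series /= (big_morph l lD l0).
apply: eq_bigr => k _; rewrite -scalemxAr lZ addnC exprD.
by rewrite mulrC mulrA mulrAC.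
Qed.

Let ReEntry i j (M : 'M[K]_d) := Re (M i j).
Let ImEntry i j (M : 'M[K]_d) := Im (M i j).

Let ReD' i j M N' : ReEntry i j (M + N') = ReEntry i j M + ReEntry i j N'.
Proof. by rewrite /ReEntry mxE RecD. Qed.
Let ImD' i j M N' : ImEntry i j (M + N') = ImEntry i j M + ImEntry i j N'.
Proof. by rewrite /ImEntry mxE ImcD. Qed.
Let ReZ' i j (k : R) M : ReEntry i j (k%:C *: M) = k * ReEntry i j M.
Proof. by rewrite /ReEntry mxE RecM /= mul0r subr0. Qed.
Let ImZ' i j (k : R) M : ImEntry i j (k%:C *: M) = k * ImEntry i j M.
Proof. by rewrite /ImEntry mxE ImcM /= mul0r addr0. Qed.

Let Rebound i j k : `|ReEntry i j (A ^+ k)| <= S ^+ k.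
Proof. by apply: le_trans (pow_bound k i j); rewrite lerDl. Qed.
Let Imbound i j k : `|ImEntry i j (A ^+ k)| <= S ^+ k.
Proof. by apply: le_trans (pow_bound k i j); rewrite lerDr. Qed.

Let ReP i j t n r : Re ((A ^+ n *m expmx_partial A t r) i j) =
  pseries (fun k => ReEntry i j (A ^+ (k + n)%N) / k`!%:R) t r.
Proof. exact: (partialE t r n (@ReD' i j) (@ReZ' i j)). Qed.
Let ImP i j t n r : Im ((A ^+ n *m expmx_partial A t r) i j) =
  pseries (fun k => ImEntry i j (A ^+ (k + n)%N) / k`!%:R) t r.
Proof. exact: (partialE t r n (@ImD' i j) (@ImZ' i j)). Qed.

Lemma expmx_cvg t : mcvg (expmx_partial A t) (expmx A t).
Proof.
move=> i j; split; rewrite mxE /=.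
  have -> : (fun k => Re (expmx_partial A t k i j)) =
      pseries (fun k => ReEntry i j (A ^+ (k + 0)%N) / k`!%:R) t.
    by apply/funext => r; rewrite -ReP expr0 mul1mx.
  exact: (@exp_functional_cvg _ (Rebound i j) 0%N t).
have -> : (fun k => Im (expmx_partial A t k i j)) =
    pseries (fun k => ImEntry i j (A ^+ (k + 0)%N) / k`!%:R) t.
  by apply/funext => r; rewrite -ImP expr0 mul1mx.
exact: (@exp_functional_cvg _ (Imbound i j) 0%N t).
Qed.

Lemma mderiv_expmx : mderiv (expmx A) (fun t => A *m expmx A t).
Proof.
move=> i j t; have [c1 c2] := mcvg_mulmx (mcvg_cst A) (expmx_cvg t) i j; split.
  have -> : Re ((A *m expmx A t) i j) =
      limn (pseries (fun k => ReEntry i j (A ^+ (k + 1)%N) / k`!%:R) t).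
    have -> : pseries (fun k => ReEntry i j (A ^+ (k + 1)%N) / k`!%:R) t =
        (fun r => Re ((A *m expmx_partial A t r) i j)).
      by apply/funext => r; rewrite -ReP expr1.
    exact/esym/cvg_lim.
  have -> : (fun s => Re (expmx A s i j)) =
      (fun s => limn (pseries (fun k => ReEntry i j (A ^+ (k + 0)%N) / k`!%:R) s)).
    apply/funext => s; rewrite mxE /=; congr (limn _); apply/funext => r.
    by rewrite -ReP expr0 mul1mx.
  exact: (exp_functional_derive (Rebound i j) t).
have -> : Im ((A *m expmx A t) i j) =
    limn (pseries (fun k => ImEntry i j (A ^+ (k + 1)%N) / k`!%:R) t).
  have -> : pseries (fun k => ImEntry i j (A ^+ (k + 1)%N) / k`!%:R) t =
      (fun r => Im ((A *m expmx_partial A t r) i j)).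
    by apply/funext => r; rewrite -ImP expr1.
  exact/esym/cvg_lim.
have -> : (fun s => Im (expmx A s i j)) =
    (fun s => limn (pseries (fun k => ImEntry i j (A ^+ (k + 0)%N) / k`!%:R) s)).
  apply/funext => s; rewrite mxE /=; congr (limn _); apply/funext => r.
  by rewrite -ImP expr0 mul1mx.
exact: (exp_functional_derive (Imbound i j) t).
Qed.

Lemma mcvg_unique m n (X : nat -> 'M[K]_(m, n)) Y Z : mcvg X Y -> mcvg X Z -> Y = Z.
Proof.
move=> XY XZ; apply/matrixP => i j; have [y1 y2] := XY i j; have [z1 z2] := XZ i j.
by apply: complex_ext; [exact: cvg_unique y1 z1|exact: cvg_unique y2 z2].
Qed.

Lemma expmx_comm t : A *m expmx A t = expmx A t *m A.
Proof.
have h := mcvg_mulmx (mcvg_cst A) (expmx_cvg t).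
apply: (mcvg_unique h); have := mcvg_mulmx (expmx_cvg t) (mcvg_cst A).
suff -> : (fun r => expmx_partial A t r *m A) = (fun r => A *m expmx_partial A t r) by [].
apply/funext => r; rewrite /expmx_partial mulmx_suml mulmx_sumr; apply: eq_bigr => k _.
by rewrite -scalemxAl -scalemxAr -[_ *m A]/(A ^+ k * A) -[A *m _]/(A * A ^+ k) -exprS -exprSr.
Qed.

Lemma expmx0 : expmx A 0 = 1%:M.
Proof.
apply: (mcvg_unique (expmx_cvg 0)).
have p1 n : (0 < n)%N -> expmx_partial A 0 n = 1%:M.
  case: n => // n _; rewrite /expmx_partial big_nat_recl // big1_seq ?addr0.
    by rewrite !expr0 fact0 divr1 scale1r.
  by move=> k _; rewrite expr0n /= mul0r scale0r.
by move=> i j; split; apply: cvg_near_cst; near=> n; rewrite p1 //; near: n; exact: nbhs_infty_gt.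
Unshelve. all: by end_near. Qed.

(** The product has derivative 0 in t, because A commutes with its exponential; its value is read at
    t = 0. *)
Lemma expmx_mul c t : expmx A t *m expmx A (c - t) = expmx A c.
Proof.
pose G s := expmx A s *m expmx A ((-1) * s + c).
have dG : mderiv G (fun=> 0).
  apply: mderiv_ext (mderiv_mulmx mderiv_expmx (mderiv_comp_affine (-1) c mderiv_expmx)) => s.
  rewrite -scalemxAr expmx_comm mulmxA (_ : (-1)%:C = -1) ?scaleN1r ?subrr //.
  by apply: complex_ext; rewrite /= ?oppr0.
have := mderiv0_cst dG t 0; rewrite /G mulN1r mulr0 add0r expmx0 mul1mx => <-.
by rewrite addrC.
Qed.

Lemma expmx_inv t : expmx A t *m expmx A (- t) = 1%:M.
Proof. by rewrite -[- t]add0r expmx_mul expmx0. Qed.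

Lemma expmx_cont : mparts cont (expmx A).
Proof. exact: mderiv_cont mderiv_expmx. Qed.

(** e^(-tA), written as an affine substitution to match [mderiv_comp_affine]. *)
Let flip t := expmx A ((-1) * t + 0).

Let flipE t : flip t = expmx A (- t).
Proof. by rewrite /flip mulN1r addr0. Qed.

Let flip_deriv : mderiv flip (fun t => - (flip t *m A)).
Proof.
apply: mderiv_ext (mderiv_comp_affine (-1) 0 mderiv_expmx) => s.
rewrite expmx_comm (_ : (-1)%:C = -1) ?scaleN1r //.
by apply: complex_ext; rewrite /= ?oppr0.
Qed.

Let flip_cont : mparts cont flip.
Proof. exact: mderiv_cont flip_deriv. Qed.

(** The mild solution of x' = A x + v with x(0) = 0. *)
Definition duhamel (v : R -> 'cV[K]_d) t := mint (fun s => expmx A (t - s) *m v s) t.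

Section Duhamel.
Variables (v : R -> 'cV[K]_d) (T : R).
Hypothesis vi : mparts (intg T) v.

Let wi : mparts (intg T) (fun s => flip s *m v s).
Proof. exact: (mparts_mulmx (linear_intg T) (@cont_intg _ T) flip_cont vi). Qed.

(** Taking e^(tA) out of the integral leaves an ordinary primitive, to which integration by parts
    applies. *)
Lemma duhamelE t : t <= T ->
  duhamel v t = expmx A t *m mint (fun s => flip s *m v s) t.
Proof.
move=> tT; rewrite -(mint_mulmxl _ tT wi); apply: eq_mint => s _.
by rewrite mulmxA flipE -(expmx_mul (t - s) t) addrAC subrr add0r.
Qed.

Lemma mint_sq m n (F : R -> 'M[K]_(m, n)) : 0 <= T -> mparts (intg T) F ->
  mparts (sq_integrable T) (mint F).
Proof.
move=> T0 Fi i j; have [f1 f2] := Fi i j.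
split; under eq_fun do rewrite mxE /=; exact: primitive_sq_integrable.
Qed.

Lemma duhamel_sq : 0 <= T -> mparts (sq_integrable T)
  (fun t => expmx A t *m mint (fun s => flip s *m v s) t).
Proof.
move=> T0; apply: (mparts_mulmx (linear_sq T) _ expmx_cont (mint_sq T0 wi)).
move=> f g cf [mg gi]; have cf' : {within `[0, T], continuous f} by exact: continuous_subspaceT.
split; first by apply: measurable_funM => //; exact: measurable_continuous_oo.
have c2 : cont (fun t => f t ^+ 2).
  by move=> x; under eq_fun do rewrite expr2; apply: cvgM; exact: cf.
rewrite (_ : (fun t => (f t * g t) ^+ 2) = (fun t => f t ^+ 2 * g t ^+ 2)).
  exact: (@cont_intg _ T _ _ c2 gi).
by apply/funext => t; rewrite exprMn.
Qed.

(** Integration by parts of A e^(sA) against the primitive of e^(-sA) v, where the two exponentials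
    cancel in the last term. *)
Lemma duhamel_eq t : 0 <= t <= T ->
  duhamel v t = mint (fun s => A *m duhamel v s + v s) t.
Proof.
move=> /andP[t0 tT].
have sub m n (F : R -> 'M[K]_(m, n)) : mparts (intg T) F -> mparts (intg t) F.
  by apply: mparts_sub => f; exact: integrable_sub.
have cAE : mparts cont (fun t => A *m expmx A t).
  exact: (mparts_mulmxl linear_cont A expmx_cont).
pose X s := expmx A s *m mint (fun s => flip s *m v s) s.
have X_sq : mparts (intg t) (fun s => A *m X s).
  apply: sub; apply: (mparts_sub (@sq_intg _ T)).
  exact: (mparts_mulmxl (linear_sq T) A (duhamel_sq (le_trans t0 tT))).
rewrite (eq_mint (G := fun s => A *m X s + v s)); last first.
  by move=> s /andP[s0 st]; rewrite duhamelE // ltW // (lt_le_trans st tT).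
rewrite (mintD (lexx t) X_sq (sub _ _ _ vi)).
have h := integral_by_parts_mx t0 mderiv_expmx cAE (sub _ _ _ wi).
have e1 s : A *m expmx A s *m mint (fun s => flip s *m v s) s = A *m X s.
  by rewrite -mulmxA.
have e2 s : expmx A s *m (flip s *m v s) = v s.
  by rewrite mulmxA flipE expmx_inv mul1mx.
rewrite (funext e1) (funext e2) -duhamelE // in h.
by rewrite h subrK.
Qed.

(** Integration by parts of e^(-sA) against x, the primitive of A x + v: the terms with A x cancel
    and e^(-tA) x(t) is left as the integral of e^(-sA) v. *)
Lemma duhamel_unique (x : R -> 'cV[K]_d) :
  mparts (intg T) (fun t => A *m x t) ->
  (forall t, 0 <= t <= T -> x t = mint (fun s => A *m x s + v s) t) ->
  forall t, 0 <= t <= T -> x t = duhamel v t.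
Proof.
move=> xi xE t /andP[t0 tT].
have sub m n (F : R -> 'M[K]_(m, n)) : mparts (intg T) F -> mparts (intg t) F.
  by apply: mparts_sub => f; exact: integrable_sub.
pose w s := A *m x s + v s.
have Axv : mparts (intg T) w by exact: (mpartsD (linear_intg T) xi vi).
have cF : mparts cont (fun t => - (flip t *m A)).
  have := mparts_mulmxl linear_cont (- 1%:M) (mparts_mulmxr linear_cont A flip_cont).
  by under eq_fun do rewrite mulNmx mul1mx.
have := integral_by_parts_mx t0 flip_deriv cF (sub _ _ _ Axv).
have fAx : mparts (intg t) (fun s => flip s *m (A *m x s)).
  exact: (mparts_mulmx (linear_intg t) (@cont_intg _ t) flip_cont (sub _ _ _ xi)).
rewrite (eq_mint (G := fun s => (- 1%:M) *m (flip s *m (A *m x s)))); last first.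
  move=> s /andP[s0 st]; rewrite -xE ?mulNmx ?mul1mx -?mulmxA //.
  by rewrite (ltW s0) (ltW (lt_le_trans st tT)).
rewrite (mint_mulmxl _ (lexx t) fAx) mulNmx mul1mx -xE ?t0 //.
rewrite (eq_mint (F := fun s => flip s *m w s)
  (G := fun s => flip s *m (A *m x s) + flip s *m v s)); last first.
  by move=> s _; rewrite mulmxDr.
rewrite (mintD (lexx t) fAx (sub _ _ _ wi)) => /eqP.
rewrite opprD addrCA -[X in X == _]addr0 (inj_eq (addrI _)) eq_sym subr_eq0 => /eqP e.
by rewrite duhamelE // -e mulmxA flipE expmx_inv mul1mx.
Qed.

End Duhamel.

End MatrixExponential.

(** * Square integrable and Sobolev vector functions through real components *)

Section SystemOnInterval.
Context {R : realType}.
Local Notation mu := (@lebesgue_measure R).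
Local Notation K := (R[i]).
Local Notation Re := (@complex.Re R).
Local Notation Im := (@complex.Im R).

Lemma eq_sq_integrable T (f g : R -> R) : (forall t, 0 < t < T -> f t = g t) ->
  sq_integrable T f -> sq_integrable T g.
Proof.
move=> fg [mf fi]; split.
  by apply: eq_measurable_fun mf => t; rewrite inE /= in_itv /= => /fg.
apply: eq_integrable fi => // t; rewrite inE /= in_itv /= => /fg.
by rewrite /= => ->.
Qed.

Lemma eq_mparts_sq T m n (F G : R -> 'M[K]_(m, n)) :
  (forall t, 0 < t < T -> F t = G t) ->
  mparts (sq_integrable T) F -> mparts (sq_integrable T) G.
Proof.
move=> FG Fs i j; have [f1 f2] := Fs i j.
by split; [apply: eq_sq_integrable f1|apply: eq_sq_integrable f2] => t /FG ->.
Qed.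

Definition vsqint n T (f : R -> 'cV[K]_n) : R :=
  \sum_(i < n) (sqint T (fun t => Re (f t i ord0)) + sqint T (fun t => Im (f t i ord0))).

Lemma sqnorm_integrable n T (f : R -> 'cV[K]_n) : mparts (sq_integrable T) f ->
  intg T (fun t => sqnorm (f t)) /\
  \int[mu]_(t in `]0, T[) sqnorm (f t) = vsqint T f.
Proof.
move=> fs; rewrite /vsqint /sqnorm.
have fi (i : 'I_n) : intg T (fun t => Re (f t i ord0) ^+ 2 + Im (f t i ord0) ^+ 2).
  by have [[_ f1] [_ f2]] := fs i ord0; exact: integrable_add.
split.
  suff H (r : seq 'I_n) : intg T (fun t =>
      \sum_(i <- r) (Re (f t i ord0) ^+ 2 + Im (f t i ord0) ^+ 2)) by exact: H.
  elim: r => [|i r IH]; first by under eq_fun do rewrite big_nil; exact: integrable_cst.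
  by under eq_fun do rewrite big_cons; apply: integrable_add => //; exact: fi.
have := @primitive_sum R _ (index_enum 'I_n) _ T T (lexx T) fi.
rewrite /primitive => ->; apply: eq_bigr => i _.
by have [[_ f1] [_ f2]] := fs i ord0; rewrite RintegralD.
Qed.

Lemma sqnorm_ge0 n (v : 'cV[K]_n) : 0 <= sqnorm v.
Proof. by apply: sumr_ge0 => i _; rewrite addr_ge0 ?sqr_ge0. Qed.

Lemma L2P n T (f : R -> 'cV[K]_n) : L2 `]0, T[ f <-> mparts (sq_integrable T) f.
Proof.
split=> [[mf fN] i j|fs]; last first.
  split=> [i|]; first by have [[? _] [? _]] := fs i ord0.
  rewrite /L2norm; apply: poweR_lty; have [si _] := sqnorm_integrable fs.
  have /integrableP[_] := si; apply: le_lt_trans; apply: ge0_le_integral => //.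
  - by move=> t _; rewrite lee_fin sqnorm_ge0.
  - by case/integrableP: si.
  - by apply: measurableT_comp => //; case/integrableP: si.
  - by move=> t _; rewrite /= lee_fin ler_norm.
rewrite (ord1 j); have [m1 m2] := mf i.
have ms : measurable_fun `]0, T[ (fun t => sqnorm (f t)).
  rewrite /sqnorm; apply: (@measurable_sum _ _ _ _ _ _
    (fun i t => Re (f t i ord0) ^+ 2 + Im (f t i ord0) ^+ 2)) => l.
  by have [? ?] := mf l; apply: measurable_funD; exact: measurable_funX.
have si : mu.-integrable `]0, T[ (EFin \o (fun t => sqnorm (f t))).
  apply/integrableP; split; first exact/measurable_EFinP.
  have := lty_poweRy _ fN; rewrite invr_neq0 // => /(_ isT).
  apply: le_lt_trans; apply: ge0_le_integral => //.
  - by apply/measurable_EFinP; exact: measurableT_comp.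
  - exact/measurable_EFinP.
  - by move=> t _; rewrite /= lee_fin ger0_norm // sqnorm_ge0.
have le t : Re (f t i ord0) ^+ 2 + Im (f t i ord0) ^+ 2 <= sqnorm (f t).
  rewrite /sqnorm (bigD1 i) //= lerDl.
  by apply: sumr_ge0 => l _; rewrite addr_ge0 ?sqr_ge0.
split; split=> //; (apply: integrable_le si => //; first exact: measurable_funX);
  move=> t _; rewrite ger0_norm ?sqr_ge0 //; apply: le_trans (le t);
  by rewrite ?lerDl ?lerDr sqr_ge0.
Qed.

Lemma L2normE n T (f : R -> 'cV[K]_n) : mparts (sq_integrable T) f ->
  L2norm `]0, T[ f = (Num.sqrt (vsqint T f))%:E.
Proof.
move=> fs; have [si <-] := sqnorm_integrable fs.
rewrite /L2norm poweR12_sqrt; last by apply: integral_ge0 => t _; rewrite lee_fin sqnorm_ge0.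
by rewrite -EFin_Rintegral.
Qed.

Lemma vsqint_ge0 n T (f : R -> 'cV[K]_n) : 0 <= vsqint T f.
Proof. by apply: sumr_ge0 => i _; rewrite addr_ge0 ?sqint_ge0. Qed.

Lemma L2norm_lt n T (f : R -> 'cV[K]_n) eps : 0 < eps -> mparts (sq_integrable T) f ->
  (L2norm `]0%R, T[ f < eps%:E)%E = (vsqint T f < eps ^+ 2).
Proof.
move=> e0 fs; rewrite L2normE // lte_fin -[in RHS](sqr_sqrtr (vsqint_ge0 T f)).
by rewrite ltr_pXn2r ?nnegrE ?sqrtr_ge0 // ltW.
Qed.

Lemma eq_L2norm n T (f g : R -> 'cV[K]_n) : (forall t, 0 < t < T -> f t = g t) ->
  L2norm `]0, T[ f = L2norm `]0, T[ g.
Proof.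
move=> fg; rewrite /L2norm; congr (_ `^ _)%E; apply: eq_integral => t.
by rewrite inE /= in_itv /= => /fg ->.
Qed.

Lemma iter_mintE j n (g : R -> 'cV[K]_n) i :
  (fun t => Re (iter j (@mint R n 1) g t i ord0)) =
    iter j primitive (fun t => Re (g t i ord0)) /\
  (fun t => Im (iter j (@mint R n 1) g t i ord0)) =
    iter j primitive (fun t => Im (g t i ord0)).
Proof.
elim: j => //= j [<- <-]; split; apply/funext => t; by rewrite mxE.
Qed.

Lemma iter_mint_sq T j n (g : R -> 'cV[K]_n) : 0 <= T -> mparts (sq_integrable T) g ->
  mparts (sq_integrable T) (iter j (@mint R n 1) g).
Proof.
move=> T0 gs i l; rewrite (ord1 l); have [g1 g2] := gs i ord0.
have [e1 e2] := iter_mintE j g i.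
by split; rewrite ?e1 ?e2; exact: iter_primitive_sq_integrable.
Qed.

Lemma iter_mint_dense L T n (f : R -> 'cV[K]_n) eps : 0 < T ->
  mparts (sq_integrable T) f -> 0 < eps ->
  exists2 g, mparts (sq_integrable T) g &
    vsqint T (fun t => iter L (@mint R n 1) g t - f t) < eps.
Proof.
move=> T0 fs e0.
(* There are 2 n real components; the successor keeps the quotient meaningful for n = 0 and the
   final inequality strict. *)
pose e := eps / (2 * n.+1%:R).
have e0' : 0 < e by rewrite divr_gt0 // mulr_gt0.
pose g1 i := cid2 (iter_primitive_dense L T0 (fs i ord0).1 e0').
pose g2 i := cid2 (iter_primitive_dense L T0 (fs i ord0).2 e0').
pose g t : 'cV[K]_n := \col_i (s2val (g1 i) t +i* s2val (g2 i) t).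
have gE i : (fun t => Re (g t i ord0)) = s2val (g1 i) /\
    (fun t => Im (g t i ord0)) = s2val (g2 i).
  by split; apply/funext => t; rewrite mxE.
exists g.
  move=> i j; rewrite (ord1 j); have [e1 e2] := gE i.
  by split; rewrite ?e1 ?e2; [exact: (s2valP (g1 i))|exact: (s2valP (g2 i))].
apply: (@le_lt_trans _ _ (\sum_(i < n) (e + e))).
  apply: ler_sum => i _; have [e1 e2] := iter_mintE L g i; have [e3 e4] := gE i.
  apply: lerD; apply: ltW.
    have -> : (fun t => Re ((iter L (@mint R n 1) g t - f t) i ord0)) =
        (fun t => iter L primitive (s2val (g1 i)) t - Re (f t i ord0)).
      rewrite -e3 -e1; apply/funext => t; rewrite 2!mxE RecD.
      by congr (_ + _); case: (f t i ord0).
    exact: (s2valP' (g1 i)).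
  have -> : (fun t => Im ((iter L (@mint R n 1) g t - f t) i ord0)) =
      (fun t => iter L primitive (s2val (g2 i)) t - Im (f t i ord0)).
    rewrite -e4 -e2; apply/funext => t; rewrite 2!mxE ImcD.
    by congr (_ + _); case: (f t i ord0).
  exact: (s2valP' (g2 i)).
rewrite sumr_const card_ord -mulr_natr /e.
have -> : (eps / (2 * n.+1%:R) + eps / (2 * n.+1%:R)) * n%:R = eps * (n%:R / n.+1%:R).
  have : n.+1%:R != 0 :> R by rewrite pnatr_eq0.
  by move: (n.+1%:R) => c c0; field.
by rewrite gtr_pMr // ltr_pdivrMr // mul1r ltr_nat.
Qed.

Let sgn k : (-1) ^+ k = ((-1) ^+ k : R)%:C :> K.
Proof. by rewrite rmorphXn /= rmorphN rmorph1. Qed.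

Lemma weak_derivativeP n T k (f g : R -> 'cV[K]_n) : weak_derivative T k f g <->
  forall i, weakly T k (fun t => Re (f t i ord0)) (fun t => Re (g t i ord0)) /\
            weakly T k (fun t => Im (f t i ord0)) (fun t => Im (g t i ord0)).
Proof.
have ReZ (a : R) (z : K) : Re (a%:C * z) = a * Re z by rewrite RecM /= mul0r subr0.
have ImZ (a : R) (z : K) : Im (a%:C * z) = a * Im z by rewrite ImcM /= mul0r addr0.
split=> [fg i|fg phi tphi].
  split=> phi tphi; have := fg phi tphi; move/matrixP/(_ i ord0); rewrite !mxE sgn.
    move/(congr1 Re); rewrite ReZ /= => e.
    under eq_Rintegral do rewrite -ReZ.
    under [in RHS]eq_Rintegral do rewrite -ReZ.
    rewrite -[RHS](_ : (-1) ^+ k * \int[mu]_(t in `]0, T[) Re (((phi t)%:C *: g t) i ord0) = _).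
      by rewrite -e; apply: eq_Rintegral => t _; rewrite mxE.
    by congr (_ * _); apply: eq_Rintegral => t _; rewrite mxE.
  move/(congr1 Im); rewrite ImZ /= => e.
  under eq_Rintegral do rewrite -ImZ.
  under [in RHS]eq_Rintegral do rewrite -ImZ.
  rewrite -[RHS](_ : (-1) ^+ k * \int[mu]_(t in `]0, T[) Im (((phi t)%:C *: g t) i ord0) = _).
    by rewrite -e; apply: eq_Rintegral => t _; rewrite mxE.
  by congr (_ * _); apply: eq_Rintegral => t _; rewrite mxE.
apply/colP => i; rewrite !mxE sgn; have [f1 f2] := fg i; apply: complex_ext.
  rewrite ReZ /= -[RHS](_ : (-1) ^+ k * \int[mu]_(t in `]0, T[) (phi t * Re (g t i ord0)) = _).
    by rewrite -f1 //; apply: eq_Rintegral => t _; rewrite mxE ReZ.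
  by congr (_ * _); apply: eq_Rintegral => t _; rewrite mxE ReZ.
rewrite ImZ /= -[RHS](_ : (-1) ^+ k * \int[mu]_(t in `]0, T[) (phi t * Im (g t i ord0)) = _).
  by rewrite -f2 //; apply: eq_Rintegral => t _; rewrite mxE ImZ.
by congr (_ * _); apply: eq_Rintegral => t _; rewrite mxE ImZ.
Qed.

Lemma HL0_iter_mint L T n (g : R -> 'cV[K]_n) : 0 < T -> mparts (sq_integrable T) g ->
  HL0 L T (iter L (@mint R n 1) g).
Proof.
move=> T0 gs; have sq j := iter_mint_sq j (ltW T0) gs.
have wd k : (k <= L)%N ->
    weak_derivative T k (iter L (@mint R n 1) g) (iter (L - k) (@mint R n 1) g).
  move=> kL; apply/weak_derivativeP => i; have [g1 g2] := gs i ord0.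
  have [-> ->] := iter_mintE L g i; have [-> ->] := iter_mintE (L - k) g i.
  by split; exact: weakly_iter_primitive.
split; first split; first exact/L2P.
  by move=> k kL; exists (iter (L - k) (@mint R n 1) g); [exact/L2P|exact: wd].
move=> k kL; exists (iter (L - k) (@mint R n 1) g); split; last 2 first.
- exact/wd/ltnW.
- have -> : (L - k = (L - k.+1).+1)%N by lia.
  by apply/matrixP => i j; rewrite iterS !mxE !primitive_at0.
move=> i; have [-> ->] := iter_mintE (L - k) g i.
have -> : (L - k = (L - k.+1).+1)%N by lia.
have [g1 g2] := gs i ord0.
by split; rewrite iterS; apply: primitive_continuous; rewrite ?ltW //;
  apply: sq_integrable_integrable; apply: iter_primitive_sq_integrable; rewrite ?ltW.
Qed.

(** For k < L the continuous representative that vanishes at 0 is chosen, for k = L the square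
    integrable weak derivative; the scalar result then applies to each component. *)
Lemma HL0_ae_iter_mint L T n (f : R -> 'cV[K]_n) : 0 < T -> HL0 L T f ->
  exists2 g, mparts (sq_integrable T) g &
    {ae mu, forall t, t \in `]0, T[ -> iter L (@mint R n 1) g t = f t}.
Proof.
move=> T0 [[/L2P fs fw] fc].
have sP k : exists s : R -> 'cV[K]_n,
    ((k <= L)%N -> mparts (sq_integrable T) s /\ weak_derivative T k f s) /\
    ((k < L)%N -> ccontinuous_on `[0, T] s /\ s 0 = 0).
  have [kL|Lk] := ltnP k L.
    have [h [ch wh h0]] := fc k kL; exists h; split=> // _; split=> //.
    move=> i j; rewrite (ord1 j); have [c1 c2] := ch i.
    by split; exact: continuous_sq_integrable.
  have [kL|] := leqP k L; last by exists (cst 0).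
  by have [h /L2P hs wh] := fw k kL; exists h.
pose s k := projT1 (cid (sP k)).
have sL k : (k <= L)%N -> mparts (sq_integrable T) (s k) /\ weak_derivative T k f (s k).
  by rewrite /s; case: cid => ? [].
have sc k : (k < L)%N -> ccontinuous_on `[0, T] (s k) /\ s k 0 = 0.
  by rewrite /s; case: cid => ? [].
exists (s L); first by have [] := sL L (leqnn L).
have F : Filter (almost_everywhere mu) by exact: (ae_filter_ringOfSetsType mu).
have key i : {ae mu, forall t, t \in `]0, T[ ->
    iter L (@mint R n 1) (s L) t i ord0 = f t i ord0}.
  have [f1 f2] := fs i ord0; have [e1 e2] := iter_mintE L (s L) i.
  have a1 : {ae mu, forall t, t \in `]0, T[ -> Re (f t i ord0) =
      iter L primitive (fun t => Re (s L t i ord0)) t}.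
    apply: (@weakly_iter_primitive_ae _ _ _ _ (fun k t => Re (s k t i ord0))) => //.
    - exact: sq_integrable_integrable.
    - move=> k kL; have [s1 /weak_derivativeP/(_ i)[w1 _]] := sL k kL.
      by split=> //; have [] := s1 i ord0.
    - move=> k kL; have [/(_ i)[c1 _] s0] := sc k kL; split=> //.
      by rewrite s0 mxE.
  have a2 : {ae mu, forall t, t \in `]0, T[ -> Im (f t i ord0) =
      iter L primitive (fun t => Im (s L t i ord0)) t}.
    apply: (@weakly_iter_primitive_ae _ _ _ _ (fun k t => Im (s k t i ord0))) => //.
    - exact: sq_integrable_integrable.
    - move=> k kL; have [s1 /weak_derivativeP/(_ i)[_ w1]] := sL k kL.
      by split=> //; have [] := s1 i ord0.
    - move=> k kL; have [/(_ i)[_ c1] s0] := sc k kL; split=> //.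
      by rewrite s0 mxE.
  apply: filterS2 a1 a2 => t b1 b2 tT; apply: complex_ext.
    by rewrite b1 // -e1.
  by rewrite b2 // -e2.
have all_ : {ae mu, forall t, forall i, i \in enum 'I_n -> t \in `]0, T[ ->
    iter L (@mint R n 1) (s L) t i ord0 = f t i ord0}.
  elim: (enum 'I_n) => [|i r IH]; first exact: aeW.
  apply: filterS2 (key i) IH => t hi hr j; rewrite inE => /orP[/eqP ->|] //; exact: hr.
by apply: filterS all_ => t h tT; apply/colP => i; apply: h => //; rewrite mem_enum.
Qed.

End SystemOnInterval.

(** * The input-output map *)

Section Extension.
Context {R : realType}.
Local Notation mu := (@lebesgue_measure R).
Local Notation K := (R[i]).
Local Notation Re := (@complex.Re R).
Local Notation Im := (@complex.Im R).

Definition extend0 n T (u : R -> 'cV[K]_n) (t : R) := if t \in `]0, T[ then u t else 0.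

Lemma extend0E n T (u : R -> 'cV[K]_n) t : 0 < t < T -> extend0 T u t = u t.
Proof. by move=> tT; rewrite /extend0 in_itv /= tT. Qed.

Lemma patch_sq_integrable T S (f : R -> R) : sq_integrable T f ->
  sq_integrable S (f \_ `]0, T[).
Proof.
move=> [mf fi]; split.
  have := (measurable_restrictT f (measurable_itv `]0, T[)).1 mf.
  exact: measurable_funS.
have fi' : mu.-integrable setT (EFin \o ((fun t => f t ^+ 2) \_ `]0, T[)).
  exact: integrable_patch.
have -> : (EFin \o (fun t => (f \_ `]0, T[) t ^+ 2)) =
    (EFin \o ((fun t => f t ^+ 2) \_ `]0, T[)).
  by apply/funext => t; rewrite /= /patch; case: ifP => // _; rewrite expr0n.
exact: integrableS fi'.
Qed.

Lemma extend0_L2loc n T (u : R -> 'cV[K]_n) : L2 `]0, T[ u -> L2loc (extend0 T u).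
Proof.
move=> /L2P us S S0; apply/L2P => i j; have [u1 u2] := us i j.
have e1 : (fun t => Re (extend0 T u t i j)) = (fun t => Re (u t i j)) \_ `]0, T[.
  by apply/funext => t; rewrite /extend0 /patch mem_setE; case: ifP => //; rewrite mxE.
have e2 : (fun t => Im (extend0 T u t i j)) = (fun t => Im (u t i j)) \_ `]0, T[.
  by apply/funext => t; rewrite /extend0 /patch mem_setE; case: ifP => //; rewrite mxE.
by split; rewrite ?e1 ?e2; exact: patch_sq_integrable.
Qed.

Lemma sqint_eq0 T (f : R -> R) : 0 < T -> cont f -> sqint T f = 0 ->
  forall t, 0 <= t <= T -> f t = 0.
Proof.
move=> T0 cf f0 t tT.
have cf' : {within `[0, T], continuous f} by exact: continuous_subspaceT.
have [_ fi] := continuous_sq_integrable cf'.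
have fi' : mu.-integrable `[0, T] (EFin \o (fun t => f t ^+ 2)) by exact: integrable_cc.
have p0 s : 0 < s < T -> primitive (fun t => f t ^+ 2) s = 0.
  move=> /andP[s0 sT]; apply: le_anti; apply/andP; split; last first.
    by apply: Rintegral_ge0 => r _; exact: sqr_ge0.
  rewrite -f0 /sqint; have := primitive_norm fi (ltW sT).
  under eq_Rintegral do rewrite ger0_norm ?sqr_ge0 //.
  exact/le_trans/ler_norm.
have sq0 := primitive_eq0_ae fi p0.
have c0 : {within `[0, T], continuous (cst 0 : R -> R)}.
  by apply: continuous_subspaceT => x; exact: cvg_cst.
apply: (@continuous_ae_eq _ f (cst 0) T) => //.
have F : Filter (almost_everywhere mu) by exact: (ae_filter_ringOfSetsType mu).
by apply: filterS sq0 => s + sT => /(_ sT)/eqP; rewrite sqrf_eq0 => /eqP.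
Qed.

Lemma mint_sum m n (I : Type) (r : seq I) (F : I -> R -> 'M[K]_(m, n)) T t : t <= T ->
  (forall i, mparts (intg T) (F i)) ->
  mint (fun s => \sum_(i <- r) F i s) t = \sum_(i <- r) mint (F i) t.
Proof.
move=> tT Fi; elim: r => [|i r IH].
  rewrite big_nil; apply/matrixP => a b; rewrite !mxE.
  by apply: complex_ext => /=; rewrite /primitive; under eq_Rintegral do rewrite big_nil mxE;
    rewrite Rintegral_cst ?mul0r.
rewrite big_cons -IH -(mintD tT) //; last exact: (mparts_sum (linear_intg T)).
by apply: eq_mint => s _; rewrite big_cons.
Qed.

End Extension.

Section InputOutput.
Context {R : realType} {d p q : nat}.
Local Notation mu := (@lebesgue_measure R).
Local Notation K := (R[i]).
Local Notation Re := (@complex.Re R).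
Local Notation Im := (@complex.Im R).
Variables (A : 'M[K]_d) (B : 'M[K]_(d, p)) (C : 'M[K]_(q, d)) (D : 'M[K]_(q, p)).

Lemma mparts_sq_intg m n T (F : R -> 'M[K]_(m, n)) :
  mparts (sq_integrable T) F -> mparts (intg T) F.
Proof. exact: (mparts_sub (@sq_intg _ T)). Qed.

Lemma mparts_sqB m n T (F G : R -> 'M[K]_(m, n)) : mparts (sq_integrable T) F ->
  mparts (sq_integrable T) G -> mparts (sq_integrable T) (fun t => F t - G t).
Proof.
move=> Fs Gs; have := mpartsD (linear_sq T) Fs (mparts_mulmxl (linear_sq T) (- 1%:M) Gs).
by under eq_fun do rewrite mulNmx mul1mx.
Qed.

Lemma mparts_intgS m n T t (F : R -> 'M[K]_(m, n)) : t <= T ->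
  mparts (intg T) F -> mparts (intg t) F.
Proof. by move=> tT; apply: mparts_sub => f; exact: integrable_sub. Qed.

Lemma duhamel_sq_integrable (M : 'M[K]_d) T v : 0 <= T -> mparts (intg T) v ->
  mparts (sq_integrable T) (duhamel M v).
Proof.
move=> T0 vi; apply: eq_mparts_sq (duhamel_sq M vi T0) => t /andP[_ tT].
by rewrite (duhamelE M vi (ltW tT)).
Qed.

Lemma io_mapE T u t : mparts (intg T) u -> t <= T ->
  io_map A B C D u t = C *m duhamel A (fun s => B *m u s) t + D *m u t.
Proof.
move=> ui tT; rewrite /io_map cvintegralE; congr (_ + _).
have Bu := mparts_mulmxl (linear_intg t) B (mparts_intgS tT ui).
have cE := mderiv_cont (mderiv_comp_affine (-1) t (mderiv_expmx A)).
have h := mparts_mulmx (linear_intg t) (@cont_intg _ t) cE Bu.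
rewrite /duhamel -(mint_mulmxl C (lexx t)).
  by apply: eq_mint => s _; rewrite !mulmxA.
move: h; congr mparts; apply/funext => s.
by rewrite mulN1r addrC.
Qed.

Lemma io_map_sq T u : 0 <= T -> mparts (sq_integrable T) u ->
  mparts (sq_integrable T) (io_map A B C D u).
Proof.
move=> T0 us; have ui := mparts_sq_intg us.
apply: (eq_mparts_sq (F := fun t => C *m duhamel A (fun s => B *m u s) t + D *m u t)).
  by move=> t /andP[_ tT]; rewrite (io_mapE ui (ltW tT)).
apply: (mpartsD (linear_sq T)); last exact: (mparts_mulmxl (linear_sq T)).
apply: (mparts_mulmxl (linear_sq T)); apply: duhamel_sq_integrable => //.
exact: (mparts_mulmxl (linear_intg T)).
Qed.

(** Causality: the output at t depends only on the input up to t. Thus an input on (0, T) can be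
    extended by 0. *)
Lemma eq_io_map T u v : (forall t, 0 < t < T -> u t = v t) ->
  forall t, 0 < t < T -> io_map A B C D u t = io_map A B C D v t.
Proof.
move=> uv t /andP[t0 tT]; rewrite /io_map !cvintegralE uv ?t0 //; congr (_ + _).
by apply: eq_mint => s /andP[s0 st]; rewrite uv // s0 (lt_trans st tT).
Qed.

Lemma io_dense_L2loc_L2 : io_dense_L2loc A B C D ->
  forall tau, 0 < tau -> io_dense_L2 A B C D tau.
Proof.
move=> dense tau tau0 f /extend0_L2loc fl eps eps0.
have [u ul lt] := dense _ fl tau eps tau0 eps0; exists u; first exact: ul.
rewrite (eq_L2norm (g := fun t => io_map A B C D u t - extend0 tau f t)) //.
by move=> t tT; rewrite extend0E.
Qed.

Lemma HL0_in_range_dense L : (forall tau, 0 < tau -> HL0_in_range A B C D L tau) ->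
  io_dense_L2loc A B C D.
Proof.
move=> range f fl T eps T0 eps0; have /L2P fs := fl T T0.
have [g gs lt] := iter_mint_dense L T0 fs (exprn_gt0 2 eps0).
have [u /L2P us ue] := range T T0 _ (HL0_iter_mint L T0 gs).
exists (extend0 T u); first exact/extend0_L2loc/L2P.
have ys := io_map_sq (ltW T0) us; have hs := iter_mint_sq L (ltW T0) gs.
rewrite (eq_L2norm (g := fun t => io_map A B C D u t - f t)); last first.
  by move=> t tT; rewrite (@eq_io_map T _ u _ t tT) // => s; exact: extend0E.
suff -> : L2norm `]0%R, T[ (fun t => io_map A B C D u t - f t) =
    L2norm `]0%R, T[ (fun t => iter L (@mint R q 1) g t - f t).
  by rewrite L2norm_lt //; exact: mparts_sqB.
rewrite /L2norm; congr (_ `^ _)%E; apply: ae_eq_integral => //.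
- by have [/integrableP[]] := sqnorm_integrable (mparts_sqB ys fs).
- by have [/integrableP[]] := sqnorm_integrable (mparts_sqB hs fs).
have F : Filter (almost_everywhere mu) by exact: (ae_filter_ringOfSetsType mu).
by apply: filterS ue => t h tT; rewrite h ?inE.
Qed.

End InputOutput.

(** * A function orthogonal to the range *)

Section Density.
Context {R : realType} {d p q : nat}.
Local Notation K := (R[i]).
Local Notation Re := (@complex.Re R).
Local Notation Im := (@complex.Im R).
Variables (A : 'M[K]_d) (B : 'M[K]_(d, p)) (C : 'M[K]_(q, d)) (D : 'M[K]_(q, p)).

Lemma RecN (z : K) : Re (- z) = - Re z. Proof. by case: z. Qed.
(** The power (tau - t)^i / i!: differentiation lowers i and changes the sign, so it acts on
    discrete time as a shift. *)
Definition taylor_kernel (tau : R) i t : R := ((-1) * t + tau) ^+ i / i`!%:R.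

Lemma is_derive_taylor_kernel tau i t :
  is_derive t (1 : R) (taylor_kernel tau i.+1) (- taylor_kernel tau i t).
Proof.
have h : is_derive t (1 : R) ((fun s => (-1) * s + tau) ^+ i.+1)
    (((i.+1%:R * ((-1) * t + tau) ^+ i)) *: (-1)).
  exact: (@is_deriveX R R (fun s => (-1) * s + tau) i.+1 t 1 (-1) (is_derive_affine (-1) tau t)).
have := is_derive_mul h (is_derive_cst (i.+1`!%:R^-1 : R) t 1).
rewrite /taylor_kernel.
set X := ((-1) * t + tau).
congr is_derive.
  by apply/funext => s; rewrite fctE.
rewrite mulr0 addr0 factS natrM invfM /GRing.scale /= -/X.
have : i.+1%:R != 0 :> R by rewrite pnatr_eq0.
have : i`!%:R != 0 :> R by rewrite pnatr_eq0 -lt0n fact_gt0.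
by move: (i.+1%:R) (i`!%:R) => a b b0 a0; field; rewrite a0 b0.
Qed.

Lemma mderiv_scale_sum n (f f' : nat -> R -> R) m (V : nat -> 'rV[K]_n) :
  (forall i t, (i < m)%N -> is_derive t (1 : R) (f i) (f' i t)) ->
  mderiv (fun t => \sum_(i < m) (f i t)%:C *: V i)
         (fun t => \sum_(i < m) (f' i t)%:C *: V i).
Proof.
have ReZ (a : R) (z : K) : Re (a%:C * z) = Re z * a by rewrite RecM /= mul0r subr0 mulrC.
have ImZ (a : R) (z : K) : Im (a%:C * z) = Im z * a by rewrite ImcM /= mul0r addr0 mulrC.
move=> df i j t; split.
  under eq_fun do (rewrite summxE Rec_sum; under eq_bigr do rewrite mxE ReZ).
  rewrite summxE Rec_sum; under eq_bigr do rewrite mxE ReZ.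
  apply: is_derive_sumR => l; have := df l t (ltn_ord l) => h.
  by have := is_derive_mul (is_derive_cst (Re (V l i j)) t 1) h; congr is_derive; rewrite mul0r add0r.
under eq_fun do (rewrite summxE Imc_sum; under eq_bigr do rewrite mxE ImZ).
rewrite summxE Imc_sum; under eq_bigr do rewrite mxE ImZ.
apply: is_derive_sumR => l; have := df l t (ltn_ord l) => h.
by have := is_derive_mul (is_derive_cst (Im (V l i j)) t 1) h; congr is_derive; rewrite mul0r add0r.
Qed.

Lemma taylor_kernel_free tau n m (w : nat -> 'rV[K]_m) : 0 < tau ->
  (forall t, 0 <= t <= tau -> \sum_(i < n) (taylor_kernel tau i t)%:C *: w i = 0) ->
  forall i, (i < n)%N -> w i = 0.
Proof.
move=> tau0 w0 i0 i0n; apply/rowP => j; rewrite mxE.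
pose Q : {poly K} := \poly_(i < n) ((i`!%:R^-1 : R)%:C * w i ord0 j).
have Q0 : Q = 0.
  (* Values of tau - t at n + 1 distinct points t of [0, tau), too many roots for a polynomial of
     size at most n. *)
  pose rs := [seq (tau / k.+1%:R)%:C | k <- iota 0 n.+1].
  apply: (@roots_geq_poly_eq0 _ Q rs).
  - apply/allP => _ /mapP[k _ ->]; rewrite rootE horner_poly; apply/eqP.
    have k0 : 0 < k.+1%:R :> R by rewrite ltr0n.
    have hk : 0 <= tau - tau / k.+1%:R <= tau.
      rewrite subr_ge0 ler_pdivrMr // ler_peMr ?ler1n ?(ltW tau0) //=.
      by rewrite lerBlDr lerDl divr_ge0 ?ltW.
    have := w0 _ hk; move/matrixP/(_ ord0 j); rewrite summxE mxE => e; rewrite -[RHS]e.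
    apply: eq_bigr => i _; rewrite mxE /taylor_kernel.
    have -> : -1 * (tau - tau / k.+1%:R) + tau = tau / k.+1%:R by ring.
    by rewrite [in RHS]rmorphM rmorphXn /=; ring.
  - rewrite map_inj_uniq ?iota_uniq // => k l /(congr1 Re) /= /(mulfI (lt0r_neq0 tau0)).
    by move/invr_inj/eqP; rewrite eqr_nat => /eqP[].
  - by rewrite size_map size_iota /Q (leq_trans (size_poly _ _)).
have := congr1 (fun P : {poly K} => P`_i0) Q0; rewrite coef0 coef_poly i0n => /eqP.
rewrite mulf_eq0 => /orP[/eqP/(congr1 Re)/= /eqP|/eqP //].
by rewrite invr_eq0 pnatr_eq0 -leqn0 leqNgt fact_gt0.
Qed.

(* If [w] violates injectivity, then [P] is a nonzero polynomial, and
   [Z' = - (Z A + P C)], [Z tau = 0], [Z B + P D = 0].  Integrating [(Z x)'] shows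
   that [P] annihilates the range of the input-output map. *)
Lemma io_dense_L2_dual_injective tau : 0 < tau -> io_dense_L2 A B C D tau ->
  dual_injective A B C D.
Proof.
move=> tau0 dense w n w_out wn.
pose P t := \sum_(i < n) (taylor_kernel tau i t)%:C *: w i.
pose Z t := \sum_(i < n) (taylor_kernel tau i t)%:C *: dual_state A C w i.
pose k' i t := if i is i'.+1 then - taylor_kernel tau i' t else 0.
have kd i t : is_derive t (1 : R) (taylor_kernel tau i) (k' i t).
  case: i => [|i]; last exact: is_derive_taylor_kernel.
  by rewrite /taylor_kernel /k'; under eq_fun do rewrite expr0; exact: is_derive_cst.
have dZ' : mderiv Z (fun t => \sum_(i < n) (k' i t)%:C *: dual_state A C w i).
  by apply: mderiv_scale_sum => i t _; exact: kd.
have Pc : mparts cont P by apply: mderiv_cont (mderiv_scale_sum w (fun i t _ => kd i t)).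
(* After the index shift this is the state recursion; the term that would be missing at the end is
   [dual_state A C w n], which is 0. *)
have Z'E t : \sum_(i < n) (k' i t)%:C *: dual_state A C w i = - (Z t *m A + P t *m C).
  rewrite /Z /P !mulmx_suml -big_split -sumrN /=.
  case: n wn {Pc dZ' Z P w_out} => [|n] wn; first by rewrite !big_ord0.
  rewrite big_ord_recl big_ord_recr /= scaler0 add0r.
  rewrite -!scalemxAl -scalerDr -[_ *m A + _]/(dual_state A C w n.+1) wn scaler0 oppr0 addr0.
  apply: eq_bigr => i _; rewrite -!scalemxAl -scalerDr rmorphN scaleNr; congr (- (_ *: _)).
have dZ : mderiv Z (fun t => - (Z t *m A + P t *m C)) := mderiv_ext Z'E dZ'.
have Zc : mparts cont Z := mderiv_cont dZ.
have Zc' : mparts cont (fun t => - (Z t *m A + P t *m C)).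
  have h := mpartsD linear_cont (mparts_mulmxr linear_cont A Zc) (mparts_mulmxr linear_cont C Pc).
  have := mparts_mulmxr linear_cont (- 1%:M) h.
  by under eq_fun do rewrite mulmxN mulmx1.
have Zt : Z tau = 0.
  rewrite /Z; case: (n) => [|n']; first by rewrite big_ord0.
  rewrite big_ord_recl /= scaler0 add0r big1 // => i _.
  by rewrite /taylor_kernel mulN1r addNr expr0n /= mul0r scale0r.
have ZP t : Z t *m B + P t *m D = 0.
  rewrite /Z /P !mulmx_suml -big_split /= big1 // => i _.
  by rewrite -!scalemxAl -scalerDr -/(dual_output A B C D w i) w_out // scaler0.
have orth u : mparts (sq_integrable tau) u ->
    mparts (intg tau) (fun t => - (P t *m io_map A B C D u t)) /\
    mint (fun t => - (P t *m io_map A B C D u t)) tau = 0.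
  move=> us; have ui := mparts_sq_intg us.
  have li := linear_intg tau.
  have Bu : mparts (intg tau) (fun t => B *m u t) by exact: mparts_mulmxl.
  pose x := duhamel A (fun t => B *m u t).
  have xi : mparts (intg tau) x.
    by apply: mparts_sq_intg; apply: duhamel_sq_integrable => //; exact: ltW.
  pose v t := A *m x t + B *m u t.
  have vi : mparts (intg tau) v by apply: mpartsD => //; exact: mparts_mulmxl.
  have i1 : mparts (intg tau) (fun t => - (Z t *m A + P t *m C) *m x t).
    exact: (mparts_mulmx li (@cont_intg _ tau) Zc' xi).
  have i2 : mparts (intg tau) (fun t => Z t *m v t).
    exact: (mparts_mulmx li (@cont_intg _ tau) Zc vi).
  have e : mint (fun t => - (Z t *m A + P t *m C) *m x t + Z t *m v t) tau = 0.
    rewrite (mintD (lexx tau) i1 i2).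
    have := integral_by_parts_mx (ltW tau0) dZ Zc' vi.
    rewrite (eq_mint (G := fun t => - (Z t *m A + P t *m C) *m x t)); last first.
      by move=> s /andP[s0 st]; rewrite -(duhamel_eq A Bu) // (ltW s0) ltW.
    by move=> ->; rewrite Zt mul0mx sub0r addNr.
  split.
    have := mparts_mulmx li (@cont_intg _ tau) Pc (mparts_sq_intg (io_map_sq A B C D (ltW tau0) us)).
    move/(mparts_mulmxl li (- 1%:M)); by under eq_fun do rewrite mulNmx mul1mx.
  rewrite -e; apply: eq_mint => t /andP[_ tt]; rewrite (io_mapE A B C D ui (ltW tt)) -/x.
  have /eqP := ZP t; rewrite addr_eq0 => /eqP ZB.
  rewrite /v !mulmxDr !mulmxA ZB !mulNmx mulmxDl !opprD.
  by rewrite addrACA addNr add0r.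
(* The conjugate of P, so that the real part of P y is the real inner product of [f] and y. *)
pose f t : 'cV[K]_q := \col_j (Re (P t ord0 j) -i* Im (P t ord0 j)).
have fc : mparts cont f.
  move=> i j; have [p1 p2] := Pc ord0 i; split.
    by under eq_fun do rewrite mxE.
  by under eq_fun do rewrite mxE; move=> x; apply: cvgN; exact: p2.
have fs : mparts (sq_integrable tau) f.
  apply: mparts_sub fc => g cg; apply: continuous_sq_integrable.
  exact: continuous_subspaceT.
have [fi fE] := sqnorm_integrable fs.
(* Since [f] is orthogonal to every output y, its norm is at most that of y - f. Pointwise, |f|^2 -
   2 Re(P y) <= |y - f|^2, and the middle term integrates to 0. *)
have small eps : 0 < eps -> vsqint tau f < eps ^+ 2.
  move=> eps0; have [u /L2P us] := dense f ((L2P _ f).2 fs) eps eps0.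
  have ys := io_map_sq A B C D (ltW tau0) us; have [hi h0] := orth u us.
  have yfs := mparts_sqB ys fs; have [yi yE] := sqnorm_integrable yfs.
  rewrite (L2norm_lt eps0 yfs); apply: le_lt_trans; rewrite -fE -yE.
  pose h t := Re ((- (P t *m io_map A B C D u t)) ord0 ord0).
  have hi' : intg tau h by have [] := hi ord0 ord0.
  have {}h0 : \int[lebesgue_measure]_(t in `]0, tau[) h t = 0.
    by move/matrixP: h0 => /(_ ord0 ord0); rewrite !mxE => /(congr1 Re).
  have -> : \int[lebesgue_measure]_(t in `]0, tau[) sqnorm (f t) =
      \int[lebesgue_measure]_(t in `]0, tau[) (sqnorm (f t) + 2 * h t).
    rewrite RintegralD //; last exact: integrable_scale.
    by rewrite RintegralZl // h0 mulr0 addr0.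
  apply: le_Rintegral => //; first by apply: integrable_add => //; exact: integrable_scale.
  move=> t _; rewrite /h; move: (io_map A B C D u t) => y.
  rewrite mxE RecN mxE Rec_sum mulrN mulr_sumr -sumrN -big_split /=.
  apply: ler_sum => i _; rewrite !mxE RecD ImcD RecM /=.
  have := sqr_ge0 (Re (y i ord0)); have := sqr_ge0 (Im (y i ord0)).
  move: (Re (y _ _)) (Im (y _ _)) (Re (P _ _ _)) (Im (P _ _ _)).
  move=> a b c e; nra.
have f0 : vsqint tau f = 0.
  apply: le_anti; rewrite vsqint_ge0 andbT; apply/ler_addgt0Pl => e e0.
  have := small (Num.sqrt e); rewrite sqrtr_gt0 sqr_sqrtr ?(ltW e0) // => /(_ e0)/ltW.
  by rewrite addr0.
apply: (taylor_kernel_free tau0) => t tT; apply/rowP => j; rewrite [RHS]mxE.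
have [c1 c2] := fc j ord0.
have [z1 z2] : sqint tau (fun t => Re (f t j ord0)) = 0 /\ sqint tau (fun t => Im (f t j ord0)) = 0.
  move/eqP: f0; rewrite psumr_eq0 => [/allP/(_ j)|i _]; last by rewrite addr_ge0 ?sqint_ge0.
  by rewrite mem_index_enum => /(_ isT); rewrite paddr_eq0 ?sqint_ge0 // => /andP[/eqP ? /eqP].
have := sqint_eq0 tau0 c1 z1 tT; have := sqint_eq0 tau0 c2 z2 tT.
rewrite !mxE /= => /eqP; rewrite oppr_eq0 => /eqP z3 z4.
by apply: complex_ext.
Qed.

End Density.

(** * A right inverse up to L integrations *)

Section RightInverse.
Context {R : realType} {d p q : nat}.
Local Notation mu := (@lebesgue_measure R).
Local Notation K := (R[i]).
Variables (A : 'M[K]_d) (B : 'M[K]_(d, p)) (C : 'M[K]_(q, d)) (D : 'M[K]_(q, p)).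

(** The primitive of the solution satisfies the integral equation with integrated forcing, so
    uniqueness identifies it. *)
Lemma duhamel_mint (M : 'M[K]_d) (v : R -> 'cV[K]_d) T : 0 <= T -> mparts (intg T) v ->
  forall t, 0 <= t <= T -> duhamel M (mint v) t = mint (duhamel M v) t.
Proof.
move=> T0 vi t tT; have li := linear_intg T.
have xi : mparts (intg T) (duhamel M v) by apply/mparts_sq_intg/duhamel_sq_integrable.
have pi m n (F : R -> 'M[K]_(m, n)) : mparts (intg T) F -> mparts (intg T) (mint F).
  by move=> Fi; apply: mparts_sq_intg; exact: mint_sq.
apply/esym/(@duhamel_unique _ _ M (mint v) T) => //; first exact: pi.
  by apply: mparts_mulmxl => //; exact: pi.
move=> s /andP[s0 sT]; apply: eq_mint => r /andP[r0 rs].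
have rT : r <= T := ltW (lt_le_trans rs sT).
have r0T : 0 <= r <= T by rewrite (ltW r0).
rewrite (duhamel_eq M vi r0T). rewrite (mintD rT) //; last exact: mparts_mulmxl.
by rewrite (mint_mulmxl _ rT).
Qed.

(* Formally, the input [sum_k X k y^(L - k)] produces the output [y] up to the
   truncation error [M L.+1 y] in the state equation.  Feeding this error back,
   that is, replacing [y^(L - k)] by [xi k = phi k - C e k] where
   [e k' = (A - N C) e k + N phi k], removes it. *)
Lemma io_map_right_inverse L X T (g : R -> 'cV[K]_q) : 0 < T ->
  (forall k, (k <= L)%N ->
    C *m direct_state A B X k + D *m X k = if k == L then 1%:M else 0) ->
  mparts (sq_integrable T) g ->
  exists2 u, mparts (sq_integrable T) u &
    forall t, 0 < t < T -> io_map A B C D u t = iter L (@mint R q 1) g t.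
Proof.
move=> /ltW T0 XL gs; pose M := direct_state A B X; pose N := M L.+1.
pose phi k := iter k (@mint R q 1) g.
pose e k := duhamel (A - N *m C) (fun t => N *m phi k t).
pose xi k t := phi k t - C *m e k t.
pose u t := \sum_(k < L.+1) X k *m xi k t.
pose x t := e L t + \sum_(k < L.+1) M k *m xi k t.
have ls := linear_sq T; have li := linear_intg T.
have phi_sq k : mparts (sq_integrable T) (phi k) by exact: iter_mint_sq.
have phi_i k := mparts_sq_intg (phi_sq k).
have Nphi k : mparts (intg T) (fun t => N *m phi k t) by exact: mparts_mulmxl.
have e_sq k : mparts (sq_integrable T) (e k) by exact: duhamel_sq_integrable.
have e_i k := mparts_sq_intg (e_sq k).
have xi_sq k : mparts (sq_integrable T) (xi k).
  by apply: mparts_sqB => //; exact: mparts_mulmxl.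
have xi_i k := mparts_sq_intg (xi_sq k).
have u_sq : mparts (sq_integrable T) u.
  by apply: (mparts_sum ls) => k; exact: mparts_mulmxl.
have u_i := mparts_sq_intg u_sq.
have x_i : mparts (intg T) x.
  by apply: mpartsD => //; apply: (mparts_sum li) => k; exact: mparts_mulmxl.
have eS k t : 0 <= t <= T -> e k.+1 t = mint (e k) t.
  move=> tT; rewrite -(duhamel_mint _ T0 (Nphi k) tT).
  apply: eq_mint => s /andP[s0 st]; congr (_ *m _).
  case/andP: tT => _ tT.
  by rewrite (mint_mulmxl N (le_trans (ltW st) tT) (phi_i k)).
have xiS k t : 0 <= t <= T -> xi k.+1 t = mint (xi k) t.
  move=> /[dup] tT /andP[_ tT']; rewrite /xi eS //.
  have -> : mint (fun s => phi k s - C *m e k s) t =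
      mint (fun s => phi k s + (- C) *m e k s) t.
    by apply: eq_mint => s _; rewrite mulNmx.
  rewrite (mintD tT') //; last exact: mparts_mulmxl.
  by rewrite (mint_mulmxl _ tT') // mulNmx.
have Bu : mparts (intg T) (fun t => B *m u t) by exact: mparts_mulmxl.
(* The recursion turns A M_k + B X_k into M_(k+1). The top term N xi_L splits into N phi_L - N C
   e_L, which joins A e_L to form the equation of e_L; every other term integrates to the next one
   in the sum for x. *)
have xE t : 0 <= t <= T -> x t = mint (fun s => A *m x s + B *m u s) t.
  move=> /[dup] tT /andP[_ tT'].
  have sum_i : mparts (intg T) (fun s => \sum_(k < L) M k.+1 *m xi k s).
    by apply: (mparts_sum li) => k; exact: mparts_mulmxl.
  have Ae : mparts (intg T) (fun s => (A - N *m C) *m e L s + N *m phi L s).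
    by apply: mpartsD => //; exact: mparts_mulmxl.
  rewrite (eq_mint (G := fun s => ((A - N *m C) *m e L s + N *m phi L s) +
      \sum_(k < L) M k.+1 *m xi k s)); last first.
    move=> s _; rewrite /x /u mulmxDr !mulmx_sumr -addrA -big_split /=.
    under eq_bigr do rewrite !mulmxA -mulmxDl -[A *m M _ + _]/(M _.+1).
    rewrite big_ord_recr /= -/N [xi L s]/xi mulmxBr mulmxBl -!mulmxA.
    by rewrite addrCA [RHS]addrC; congr (_ + _); rewrite addrA addrAC.
  rewrite (mintD tT') // -(duhamel_eq _ (Nphi L) tT) -/(e L t).
  rewrite (@mint_sum _ _ _ _ _ _ T t tT') => [|k]; last exact: mparts_mulmxl.
  rewrite /x big_ord_recl /= mul0mx add0r; congr (_ + _); apply: eq_bigr => k _.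
  by rewrite (mint_mulmxl _ tT') // -xiS.
exists u => // t /andP[/ltW t0 /ltW tT].
rewrite (io_mapE A B C D u_i tT) -(duhamel_unique Bu _ xE) ?t0 //; last exact: mparts_mulmxl.
rewrite /x /u mulmxDr !mulmx_sumr -addrA -big_split /=.
under eq_bigr do rewrite !mulmxA -mulmxDl.
rewrite big_ord_recr /= big1 ?add0r => [|k _].
  by rewrite XL // eqxx mul1mx /xi addrC subrK.
by rewrite (XL _ (ltnW (ltn_ord k))) (ltn_eqF (ltn_ord k)) mul0mx.
Qed.

Lemma dual_injective_HL0_in_range : dual_injective A B C D ->
  forall tau, 0 < tau -> HL0_in_range A B C D (sobolev_order d q (\rank D)) tau.
Proof.
move=> inj tau tau0 f /(HL0_ae_iter_mint tau0)[g gs gf].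
have [X XL] := right_inverse_coefficients (fun w => @dual_order_bound _ _ _ _ A B C D w inj).
have [u us uE] := io_map_right_inverse tau0 XL gs; exists u; first exact/L2P.
have F : Filter (almost_everywhere mu) by exact: (ae_filter_ringOfSetsType mu).
by apply: filterS gf => t gf tT; rewrite uE ?gf // -in_itv.
Qed.

End RightInverse.

Theorem proposition4 (R : realType) (d p q : nat)
  (hd : (1 <= d)%N) (hp : (1 <= p)%N) (hq : (1 <= q)%N)
  (A : 'M[R[i]]_d) (B : 'M[R[i]]_(d, p))
  (C : 'M[R[i]]_(q, d)) (D : 'M[R[i]]_(q, p)) :
  [<-> io_dense_L2loc A B C D;
       forall tau : R, 0 < tau -> io_dense_L2 A B C D tau;
       exists tau : R, 0 < tau /\ io_dense_L2 A B C D tau;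
       surjective_mx (transfer A B C D);
       exists s : R[i], resolvent_set A s /\
         \rank (block_mx (A - s%:M) B C D) = (d + q)%N;
       surjective_mx (Toeplitz A B C D);
       exists L : nat, forall tau : R, 0 < tau -> HL0_in_range A B C D L tau;
       (q <= d + \rank D)%N /\
         forall tau : R, 0 < tau ->
           HL0_in_range A B C D (sobolev_order d q (\rank D)) tau].
Proof.
(* Serves two implications: from the Toeplitz matrix to some order, and from some order to the
   explicit one. *)
have inj8 : dual_injective A B C D -> (q <= d + \rank D)%N /\
    forall tau : R, 0 < tau -> HL0_in_range A B C D (sobolev_order d q (\rank D)) tau.
  by move=> inj; split; [exact: dual_injective_rank inj|exact: dual_injective_HL0_in_range].
tfae.
- exact: io_dense_L2loc_L2.
- by move=> dense; exists 1; split=> //; exact: dense.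
- move=> [tau [tau0 /(io_dense_L2_dual_injective tau0) inj]].
  exact/transfer_surjective_poly/dual_injective_poly.
- exact: transfer_surjective_rosenbrock.
- move=> [s [_ /eqP sr]]; apply: injective_markov_mx_surjective.
  by apply/dual_injective_poly; apply: (@rosenbrock_poly_injective _ _ _ _ _ _ _ _ s).
- move=> /markov_mx_surjective_injective/inj8[_ range].
  by exists (sobolev_order d q (\rank D)).
(* An unspecified L is traded for the explicit order through density on the interval (0, 1), which
   yields [dual_injective]. *)
- move=> [L /HL0_in_range_dense/io_dense_L2loc_L2/(_ 1 ltr01)].
  by move=> /(io_dense_L2_dual_injective ltr01)/inj8.
- by move=> [_ /HL0_in_range_dense].
Qed.
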